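(* For real $R>1$, let $P(R)$ denote the number of prime elements $x+y\sqrt{-2}$ of $\mathbb{Z}[\sqrt{-2}]$ (with $x,y\in\mathbb{Z}$) such that $x>0$, $y\ge 0$ and $N(x+y\sqrt{-2})=x^2+2y^2\le R^2$. Then $$P(R)\sim\frac{R^2}{4\log R}\qquad\text{as } R\to\infty .$$
   Context: $N$ is the norm $N(\alpha)=\alpha\bar\alpha$, so $N(x+y\sqrt{-2})=x^2+2y^2$. The notation $f(R)\sim g(R)$ as $R\to\infty$ means $f(R)/g(R)\to 1$. $\log$ is the natural logarithm. *)

(* Defs.v *)
From HB Require Import structures.
From mathcomp Require Import all_boot all_order all_algebra finmap ring zify.
From mathcomp Require Import all_classical all_reals all_analysis.
Set Implicit Arguments.
Unset Strict Implicit.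
Unset Printing Implicit Defensive.
Import Order.TTheory GRing.Theory Num.Theory.
Local Open Scope ring_scope.

(* [Zsqrtm2 x y] stands for x + y√-2; a fresh record rather than [int * int],
   whose canonical ring structure is the componentwise one. *)
Record zsqrtm2 := Zsqrtm2 { zre : int; zim : int }.

Definition zsqrtm2_pair (a : zsqrtm2) : int * int := (zre a, zim a).
Definition pair_zsqrtm2 (p : int * int) : zsqrtm2 := Zsqrtm2 p.1 p.2.
Lemma zsqrtm2_pairK : cancel zsqrtm2_pair pair_zsqrtm2.
Proof. by case. Qed.

HB.instance Definition _ := Countable.copy zsqrtm2 (can_type zsqrtm2_pairK).

Definition zsqrtm2_add (a b : zsqrtm2) :=
  Zsqrtm2 (zre a + zre b) (zim a + zim b).
Definition zsqrtm2_opp (a : zsqrtm2) := Zsqrtm2 (- zre a) (- zim a).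
Definition zsqrtm2_mul (a b : zsqrtm2) :=
  Zsqrtm2 (zre a * zre b - 2 * (zim a * zim b))
          (zre a * zim b + zim a * zre b).

Lemma zsqrtm2_addA : associative zsqrtm2_add.
Proof. by move=> [? ?] [? ?] [? ?]; congr Zsqrtm2; rewrite /= addrA. Qed.
Lemma zsqrtm2_addC : commutative zsqrtm2_add.
Proof. by move=> [? ?] [? ?]; congr Zsqrtm2; rewrite /= addrC. Qed.
Lemma zsqrtm2_add0 : left_id (Zsqrtm2 0 0) zsqrtm2_add.
Proof. by move=> [? ?]; congr Zsqrtm2; rewrite /= add0r. Qed.
Lemma zsqrtm2_addN : left_inverse (Zsqrtm2 0 0) zsqrtm2_opp zsqrtm2_add.
Proof. by move=> [? ?]; congr Zsqrtm2; rewrite /= addNr. Qed.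

HB.instance Definition _ := GRing.isZmodule.Build zsqrtm2
  zsqrtm2_addA zsqrtm2_addC zsqrtm2_add0 zsqrtm2_addN.

Lemma zsqrtm2_mulA : associative zsqrtm2_mul.
Proof. by move=> [? ?] [? ?] [? ?]; congr Zsqrtm2; rewrite /=; ring. Qed.
Lemma zsqrtm2_mulC : commutative zsqrtm2_mul.
Proof. by move=> [? ?] [? ?]; congr Zsqrtm2; rewrite /=; ring. Qed.
Lemma zsqrtm2_mul1 : left_id (Zsqrtm2 1 0) zsqrtm2_mul.
Proof. by move=> [? ?]; congr Zsqrtm2; rewrite /=; ring. Qed.
Lemma zsqrtm2_mulDl : left_distributive zsqrtm2_mul +%R.
Proof. by move=> [? ?] [? ?] [? ?]; congr Zsqrtm2; rewrite /=; ring. Qed.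
Lemma zsqrtm2_1neq0 : Zsqrtm2 1 0 != 0.
Proof. by []. Qed.

HB.instance Definition _ := GRing.Zmodule_isComNzRing.Build zsqrtm2
  zsqrtm2_mulA zsqrtm2_mulC zsqrtm2_mul1 zsqrtm2_mulDl zsqrtm2_1neq0.

Definition zconj (a : zsqrtm2) : zsqrtm2 := Zsqrtm2 (zre a) (- zim a).

Definition znorm (a : zsqrtm2) : int := zre a ^+ 2 + 2 * zim a ^+ 2.

Lemma znormE (a : zsqrtm2) : a * zconj a = Zsqrtm2 (znorm a) 0.
Proof. by case: a => ? ?; congr Zsqrtm2; rewrite /znorm /=; ring. Qed.

Lemma znormM : {morph znorm : a b / a * b}.
Proof.
move=> [x y] [z t].
have -> : Zsqrtm2 x y * Zsqrtm2 z t
        = Zsqrtm2 (x * z - 2 * (y * t)) (x * t + y * z) by [].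
rewrite /znorm /=; ring.
Qed.

Lemma znorm_ge0 (a : zsqrtm2) : 0 <= znorm a.
Proof. by rewrite addr_ge0 ?sqr_ge0 // mulr_ge0 ?sqr_ge0. Qed.

Lemma znorm_eq0 (a : zsqrtm2) : (znorm a == 0) = (a == 0).
Proof.
apply/eqP/eqP => [|->]; last by rewrite /znorm /= !expr0n mulr0 addr0.
case: a => x y; rewrite /znorm /= => /eqP.
have y2ge0 : 0 <= 2 * y ^+ 2 by rewrite mulr_ge0 ?sqr_ge0.
rewrite paddr_eq0 ?sqr_ge0 // (mulf_eq0 2) !sqrf_eq0 /=.
by move=> /andP[/eqP-> /eqP->].
Qed.

Definition zsqrtm2_unit : pred zsqrtm2 := fun a => znorm a == 1.
Definition zsqrtm2_inv (a : zsqrtm2) := if znorm a == 1 then zconj a else a.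

Lemma zsqrtm2_mulVx :
  {in zsqrtm2_unit, left_inverse 1 zsqrtm2_inv *%R}.
Proof.
move=> a; rewrite unfold_in /zsqrtm2_inv => Na.
by rewrite Na mulrC znormE (eqP Na).
Qed.

Lemma zsqrtm2_unitP (a b : zsqrtm2) : b * a = 1 -> zsqrtm2_unit a.
Proof.
move=> /(congr1 znorm); rewrite znormM => ba1.
have: znorm a \is a GRing.unit.
  by apply/unitrPr; exists (znorm b); rewrite mulrC.
rewrite /zsqrtm2_unit; case/orP => /eqP Na; first exact/eqP.
by have := znorm_ge0 a; rewrite Na.
Qed.

Lemma zsqrtm2_inv_out : {in [predC zsqrtm2_unit], zsqrtm2_inv =1 id}.
Proof. by move=> a; rewrite inE /zsqrtm2_inv unfold_in => /negbTE ->. Qed.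

HB.instance Definition _ := GRing.ComNzRing_hasMulInverse.Build zsqrtm2
  zsqrtm2_mulVx zsqrtm2_unitP zsqrtm2_inv_out.

Lemma zsqrtm2_integral : GRing.integral_domain_axiom zsqrtm2.
Proof.
by move=> a b /eqP; rewrite -znorm_eq0 znormM mulf_eq0 !znorm_eq0.
Qed.

HB.instance Definition _ :=
  GRing.ComUnitRing_isIntegral.Build zsqrtm2 zsqrtm2_integral.

Definition sqrtm2 : zsqrtm2 := Zsqrtm2 0 1.

Lemma sqr_sqrtm2 : sqrtm2 ^+ 2 = - 2%:R.
Proof. by []. Qed.

Lemma zsqrtm2E (x y : int) : Zsqrtm2 x y = x%:~R + y%:~R * sqrtm2.
Proof.
have zintE (n : int) : n%:~R = Zsqrtm2 n 0.
  elim: n => [|n IHn|n IHn] //.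
    by rewrite intS rmorphD /= IHn.
  by rewrite -addn1 PoszD opprD rmorphB /= IHn.
by rewrite !zintE; congr Zsqrtm2; rewrite /=; ring.
Qed.

Definition divides (A : comUnitRingType) (a b : A) : Prop :=
  exists c : A, b = c * a.

Definition prime_elt (A : comUnitRingType) (p : A) : Prop :=
  [/\ p <> 0, p \isn't a GRing.unit &
      forall a b : A, divides p (a * b) -> divides p a \/ divides p b].

Local Open Scope classical_set_scope.

Definition quadrant_primes (R : realType) (r : R) : set zsqrtm2 :=
  [set a | [/\ prime_elt a, 0 < zre a, 0 <= zim a & (znorm a)%:~R <= r ^+ 2]].

Lemma finite_quadrant_primes (R : realType) (r : R) :
  finite_set (quadrant_primes r).
Proof.
have [n rn] : exists n : nat, r ^+ 2 <= n%:R.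
  by exists (Num.bound (r ^+ 2)); rewrite ltW // archi_boundP ?sqr_ge0.
pose f (p : nat * nat) := Zsqrtm2 p.1%:Z p.2%:Z.
apply: (@sub_finite_set _ _ (f @` (`I_n.+1 `*` `I_n.+1))); last first.
  by apply/finite_image/finite_setX; exact: finite_II.
case=> x y [_ /= x0 y0 xyr].
have {xyr rn}: znorm (Zsqrtm2 x y) <= n%:Z.
  by rewrite -(ler_int R) (le_trans xyr).
rewrite /znorm /=; case: x x0 => // x x0; case: y y0 => // y y0 le_n.
exists (x, y) => //; split => /=; rewrite ltnS -lez_nat.
- by move: le_n; nia.
- by move: le_n; nia.
Qed.

(* [fset_set] is meaningful here by [finite_quadrant_primes]. *)
Definition quadrant_prime_count (R : realType) (r : R) : nat :=
  #|` fset_set (quadrant_primes r)|.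

(* Main.v *)
(* The norms of the nonzero elements of Z[sqrt -2] modulo +-1 form a Beurling
   system: [a n] elements of norm [n] with [sum_(n <= x) a n = c x + O(sqrt x)] by
   counting lattice points in an ellipse, and a von Mangoldt function [L] with
   [a * L = a ln] (Dirichlet convolution) by unique factorization.  The
   Erdos-Selberg method uses nothing else: with [psi x = sum_(n <= x) L n] and
   [r x = psi x - x], the Tatuzawa-Iseki identity gives
   [r x * ln x + sum_(n <= x) L n * r (x / n) = O(x)].  Iterating it bounds [|r x| / x]
   by a logarithmic average of itself, and the limsup of [|r x| / x] cannot be
   positive: on a long block of [n] either [r (x / n)] keeps a constant sign and
   cancels in the mean (Mertens), or it changes sign and is small nearby.  Hence
   [psi x ~ x].  Prime elements with norm at most [r ^ 2] number four times those of
   the open quadrant up to [O(r)] lying on the axes, so splitting primes never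
   have to be characterized by a congruence. *)
Require Import Defs.
From mathcomp Require Import all_boot all_order all_algebra ring lra zify.
From mathcomp Require Import all_classical all_reals all_analysis.
From mathcomp Require finmap.
Set Implicit Arguments.
Unset Strict Implicit.
Unset Printing Implicit Defensive.
Import Order.TTheory GRing.Theory Num.Theory numFieldNormedType.Exports.
Local Open Scope ring_scope.

(** * Partial sums and Abel summation *)

Section Psum.
Variable R : realType.
Implicit Types (f g : nat -> R) (x y : R).

(** The Dirichlet inverse [mu] of [a] does not satisfy [|mu| <= 1]; what nonnegativity of [L]
    provides is [|mu| <= a], and [a] has linear partial sums. Sums against [mu] are therefore
    bounded term by term, which requires the inner sums [sum_n a n F (y / n)] of the Tatuzawa-Iseki
    identity to be well below [y]. For [F = psi - id] they are in general of order [y]; adding a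
    suitable constant to [F] leaves [O(sqrt y (ln y + 1))], and the total is then [O(x)].
    Chebyshev's bound comes out of this shifted formula, Mertens' estimate follows from it, and only
    then can the shift be removed. One iteration of the formula has the irregular weights
    [L ln + L * L]. Their mean is [2 ln], and they may be replaced by [2 ln n] because [psi] and the
    identity are both increasing. The density [c] drops out: [psi x ~ x] whatever its value. No
    ideal occurs: [p] and [- p] are the only generators of an ideal, so halving counts of elements
    has the effect of counting ideals. *)

Definition psum f x : R := \sum_(1 <= n < (Num.truncn x).+1) f n.

Lemma psum_nat f N : psum f N%:R = \sum_(1 <= n < N.+1) f n.
Proof. by rewrite /psum natrK. Qed.

Lemma le_psum f g x :
  (forall n, (0 < n)%N -> n%:R <= x -> f n <= g n) -> psum f x <= psum g x.
Proof.
move=> fg; rewrite /psum big_nat_cond [leRHS]big_nat_cond.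
apply: ler_sum => n /andP[/andP[n0 nx] _]; apply: fg => //.
by case: n n0 nx => // n _; rewrite ltnS truncn_gt_nat.
Qed.

Lemma eq_psum f g x :
  (forall n, (0 < n)%N -> n%:R <= x -> f n = g n) -> psum f x = psum g x.
Proof.
by move=> fg; apply/eqP; rewrite eq_le !le_psum// => n n0 nx; rewrite fg.
Qed.

Lemma psum0 x : psum (fun=> 0) x = 0.
Proof. by rewrite /psum big1. Qed.

Lemma psum_ge0 f x :
  (forall n, (0 < n)%N -> n%:R <= x -> 0 <= f n) -> 0 <= psum f x.
Proof. by move=> f0; rewrite -(psum0 x); exact: le_psum. Qed.

Lemma psumD f g x : psum (fun n => f n + g n) x = psum f x + psum g x.
Proof. exact: big_split. Qed.

Lemma psumB f g x : psum (fun n => f n - g n) x = psum f x - psum g x.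
Proof. exact: sumrB. Qed.

Lemma psumZ c f x : psum (fun n => c * f n) x = c * psum f x.
Proof. by rewrite /psum mulr_sumr. Qed.

Lemma psumZr c f x : psum (fun n => f n * c) x = psum f x * c.
Proof. by rewrite /psum mulr_suml. Qed.

Lemma norm_psum f x : `|psum f x| <= psum (fun n => `|f n|) x.
Proof. exact: ler_norm_sum. Qed.

Lemma psum_homo f x y : (forall n, (0 < n)%N -> 0 <= f n) -> x <= y ->
  psum f x <= psum f y.
Proof.
move=> f0 /le_truncn xy; rewrite /psum [leRHS](@big_cat_nat _ _ _ (Num.truncn x).+1) //=.
rewrite lerDl big_nat_cond; apply: sumr_ge0 => n /andP[/andP[n1 _] _].
by apply: f0; apply: leq_trans n1.
Qed.

Lemma psum1 x : 0 <= x -> psum (fun=> 1) x = (Num.truncn x)%:R.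
Proof. by move=> x0; rewrite /psum big_const_nat subn1 /= iter_addr_0. Qed.

Lemma truncn_divn x d : 0 <= x -> Num.truncn (x / d%:R) = (Num.truncn x %/ d)%N.
Proof.
move=> x0; case: d => [|d]; first by rewrite invr0 mulr0 truncn0 divn0.
apply: truncn_def; rewrite ler_pdivlMr ?ltr0n// ltr_pdivrMr ?ltr0n//.
rewrite -!natrM -truncn_ge_nat// -truncn_lt_nat// leq_trunc_div /=.
by rewrite ltn_ceil.
Qed.

Lemma psum_div f x d : 0 <= x ->
  psum f (x / d%:R) = \sum_(1 <= n < (Num.truncn x %/ d).+1) f n.
Proof. by move=> x0; rewrite /psum truncn_divn. Qed.

Lemma sum_divisors_widen (F : nat -> R) n M : (0 < n <= M)%N ->
  \sum_(1 <= d < M.+1 | (d %| n)%N) F d = \sum_(1 <= d < n.+1 | (d %| n)%N) F d.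
Proof.
move=> /andP[n0 nM]; rewrite (@big_cat_nat _ _ _ n.+1) //= [X in _ + X]big1_seq ?addr0 //.
move=> d; rewrite mem_index_iota => /andP[dn /andP[nd _]].
by have := dvdn_leq n0 dn; rewrite leqNgt nd.
Qed.

(* Both sides run over the pairs [(d, e)] with [d * e <= x]. *)
Lemma psum_dirichlet (G : nat -> nat -> R) x : 0 <= x ->
  psum (fun n => \sum_(1 <= d < n.+1 | (d %| n)%N) G d (n %/ d)%N) x
  = psum (fun d => psum (G d) (x / d%:R)) x.
Proof.
move=> x0; under [RHS]eq_psum => d _ _ do rewrite psum_div//.
rewrite /psum; set N := Num.truncn x.
suff H K : (K <= N)%N ->
    \sum_(1 <= n < K.+1) \sum_(1 <= d < n.+1 | (d %| n)%N) G d (n %/ d)%N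
    = \sum_(1 <= d < N.+1) \sum_(1 <= e < (K %/ d).+1) G d e by exact: H.
elim: K => [_|K IH KN].
  by rewrite big_nil big1 // => d _; rewrite div0n big_nil.
rewrite big_nat_recr //= IH ?(ltnW KN) // -(@sum_divisors_widen _ _ N) //.
rewrite [X in _ + X]big_mkcond /= -big_split /=.
apply: eq_big_nat => d /andP[d0 _]; rewrite divnS //.
case: (_ %| _)%N => /=; last by rewrite add0n addr0.
by rewrite add1n [RHS]big_nat_recr.
Qed.

Lemma abel_sum (d r : nat -> R) N : (0 < N)%N ->
  \sum_(1 <= n < N.+1) d n * r n
  = (\sum_(1 <= n < N.+1) d n) * r N
    + \sum_(1 <= n < N) (\sum_(1 <= i < n.+1) d i) * (r n - r n.+1).
Proof.
case: N => // N _; elim: N => [|N IH].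
  by rewrite !big_nat1 big_geq // addr0.
rewrite big_nat_recr //= IH // [X in _ = X * _ + _]big_nat_recr //=.
rewrite [X in _ = _ + X]big_nat_recr //=; ring.
Qed.

(* Abel summation on both sides reduces to the bounds on [r n - r n.+1]. *)
Lemma abel_le (d k r t : nat -> R) N :
  (forall n, (0 < n <= N)%N ->
     `|\sum_(1 <= i < n.+1) d i| <= \sum_(1 <= i < n.+1) k i) ->
  (forall n, (0 < n < N)%N -> `|r n - r n.+1| <= t n - t n.+1) ->
  `|r N| <= t N ->
  `|\sum_(1 <= n < N.+1) d n * r n| <= \sum_(1 <= n < N.+1) k n * t n.
Proof.
case: N => [_ _ _|N Dk rt rN]; first by rewrite !big_geq // normr0.
rewrite abel_sum // [leRHS]abel_sum //; apply: le_trans (ler_normD _ _) _; apply: lerD.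
  by rewrite normrM ler_pM ?Dk //= leqnn.
apply: le_trans (ler_norm_sum _ _ _) _.
rewrite big_nat_cond [leRHS]big_nat_cond; apply: ler_sum => n /andP[/andP[n0 nN] _].
by rewrite normrM ler_pM ?Dk ?rt ?n0 //= ltnW.
Qed.

Lemma abel_psum_le (d k r t : nat -> R) x : 0 <= x ->
  (forall n, (0 < n)%N -> n%:R <= x -> `|psum d n%:R| <= psum k n%:R) ->
  (forall n, (0 < n)%N -> n.+1%:R <= x -> `|r n - r n.+1| <= t n - t n.+1) ->
  (forall n, (0 < n)%N -> n%:R <= x -> `|r n| <= t n) ->
  `|psum (fun n => d n * r n) x| <= psum (fun n => k n * t n) x.
Proof.
move=> x0 dk rt rN; rewrite /psum; have [T0|T0] := posnP (Num.truncn x).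
  by rewrite T0 !big_geq // normr0.
apply: abel_le => [n /andP[n0 nN]|n /andP[n0 nN]|].
- by have := dk n n0; rewrite !psum_nat -truncn_ge_nat//; exact.
- by apply: rt; rewrite // -truncn_ge_nat.
- by apply: rN; rewrite // -truncn_ge_nat.
Qed.

End Psum.

(** * Elementary bounds for logarithms, roots and their sums *)

Section Elementary.
Variable R : realType.
Implicit Types (x y : R) (n N : nat).

Lemma ln_le_subr1 x : 0 < x -> ln x <= x - 1.
Proof. by move=> x0; have := @le_ln1Dx R (x - 1); rewrite subrKC; apply; lra. Qed.

Lemma ln_ge_1subV x : 0 < x -> 1 - x^-1 <= ln x.
Proof.
move=> x0; have := @ln_le_subr1 x^-1; rewrite invr_gt0 => /(_ x0).
rewrite lnV ?posrE //; lra.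
Qed.

Lemma ln_mono x y : 0 < x -> x <= y -> ln x <= ln y.
Proof. by move=> x0 xy; rewrite ler_ln// posrE// (lt_le_trans x0). Qed.

Lemma ln_divE x y : 0 < x -> 0 < y -> ln (x / y) = ln x - ln y.
Proof. by move=> x0 y0; rewrite ln_div// posrE. Qed.

Lemma ln_mulE x y : 0 < x -> 0 < y -> ln (x * y) = ln x + ln y.
Proof. by move=> x0 y0; rewrite lnM// posrE. Qed.

Lemma lnB_le x y : 0 < x -> 0 < y -> ln y - ln x <= (y - x) / x.
Proof.
move=> x0 y0; rewrite -ln_divE //; apply: le_trans (ln_le_subr1 _) _.
  exact: divr_gt0.
by rewrite mulrBl divff ?gt_eqF.
Qed.

Lemma lnB_ge x y : 0 < x -> 0 < y -> (y - x) / y <= ln y - ln x.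
Proof.
move=> x0 y0; rewrite -ln_divE //; apply: le_trans (ln_ge_1subV _).
  by rewrite mulrBl divff ?gt_eqF// invf_div.
exact: divr_gt0.
Qed.

Lemma lnS_bounds n : (0 < n)%N ->
  n.+1%:R^-1 <= ln n.+1%:R - ln n%:R :> R /\ ln n.+1%:R - ln n%:R <= n%:R^-1 :> R.
Proof.
move=> n0; have nR : 0 < n%:R :> R by rewrite ltr0n.
have E : n.+1%:R - n%:R = 1 :> R by rewrite -natr1; ring.
split.
  by have := @lnB_ge n%:R n.+1%:R nR (ltr0Sn _ _); rewrite E mul1r.
by have := @lnB_le n%:R n.+1%:R nR (ltr0Sn _ _); rewrite E mul1r.
Qed.

Lemma ln_nat_ge0 n : 0 <= ln n%:R :> R.
Proof. by case: n => [|n]; [rewrite ln0|rewrite ln_ge0// ler1n]. Qed.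

Lemma truncn_bounds x : 1 <= x ->
  [/\ (0 < Num.truncn x)%N, (Num.truncn x)%:R <= x & x < (Num.truncn x)%:R + 1].
Proof.
move=> x1; have /andP[] := truncn_itv (le_trans ler01 x1).
by rewrite natr1 => -> ->; rewrite truncn_gt0.
Qed.

(** [N (ln (N + 1) - ln N) <= 1 <= (N + 1) (ln (N + 1) - ln N)], from [lnS_bounds], is exactly what
    the two bounds need in the induction step. *)
Lemma sum_ln_bounds N : (0 < N)%N ->
  N%:R * ln N%:R - N%:R <= \sum_(1 <= n < N.+1) ln n%:R :> R /\
  \sum_(1 <= n < N.+1) ln n%:R <= (N%:R + 1) * ln N%:R - N%:R + 1 :> R.
Proof.
case: N => // N _; elim: N => [|N [IH1 IH2]].
  by rewrite big_nat1 ln1; split; lra.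
rewrite big_nat_recr //=; have [l u] := @lnS_bounds N.+1 isT.
move: l u IH1 IH2; set s := \sum_(_ <= _ < _) _.
set L := ln N.+1%:R; set L' := ln N.+2%:R.
have -> : N.+2%:R = N.+1%:R + 1 :> R by rewrite natr1.
have : 0 < N.+1%:R :> R by [].
move: (N.+1%:R : R) => m m0 l u IH1 IH2.
have {}l : 1 <= (m + 1) * (L' - L) by rewrite mulrC -ler_pdivrMr ?mul1r//; lra.
have {}u : m * (L' - L) <= 1 by rewrite mulrC -ler_pdivlMr ?mul1r//; lra.
split; nra.
Qed.

Lemma psum_ln_div x : 1 <= x ->
  x - ln x - 2 <= psum (fun n => ln (x / n%:R)) x /\
  psum (fun n => ln (x / n%:R)) x <= x.
Proof.
move=> x1; have x0 : 0 < x by lra.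
have -> : psum (fun n => ln (x / n%:R)) x = psum (fun=> ln x) x - psum (fun n => ln n%:R) x.
  by rewrite -psumB; apply: eq_psum => n n0 _; rewrite ln_divE ?ltr0n.
have -> : psum (fun=> ln x) x = ln x * (Num.truncn x)%:R.
  rewrite -psum1 ?(ltW x0)// -psumZ; apply: eq_psum => *; ring.
have [N0 Nx xN] := truncn_bounds x1; rewrite /psum.
move: (Num.truncn x) N0 Nx xN => N N0 Nx xN.
have [l u] := sum_ln_bounds N0; have N0' : 0 < N%:R :> R by rewrite ltr0n.
move: l u N0' Nx xN; set s := \sum_(_ <= _ < _) _; move: (N%:R : R) => m l u m0 mx xm.
have : m * (ln x - ln m) <= x - m.
  by rewrite mulrC -ler_pdivlMr//; exact: lnB_le.
have : ln m <= ln x by exact: ln_mono.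
split; nra.
Qed.

Lemma harmonic_bounds x : 1 <= x ->
  ln x <= psum (fun n => n%:R^-1) x /\ psum (fun n => n%:R^-1) x <= ln x + 1.
Proof.
move=> x1; have [N0 Nx xN] := truncn_bounds x1; rewrite /psum.
move: (Num.truncn x) N0 Nx xN => N N0 Nx xN.
suff [l u] : ln N.+1%:R <= \sum_(1 <= n < N.+1) n%:R^-1 :> R /\
    \sum_(1 <= n < N.+1) n%:R^-1 <= ln N%:R + 1 :> R.
  split; first by apply: le_trans l; apply: ln_mono; [lra|rewrite -natr1 ltW].
  by apply: le_trans u _; rewrite lerD2r; apply: ln_mono => //; rewrite ltr0n.
case: N N0 {Nx xN} => // N _; elim: N => [|N [IH1 IH2]].
  rewrite big_nat1 ln1 invr1; have [_] := @lnS_bounds 1 isT; rewrite ln1 invr1.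
  by split; lra.
rewrite big_nat_recr //=; have [l _] := @lnS_bounds N.+1 isT.
have [_ u] := @lnS_bounds N.+2 isT; move: l u IH1 IH2.
move: (\sum_(_ <= _ < _) _) (ln _) (ln _) (ln _) => s a b c.
by move: (N.+2%:R^-1) => q *; split; lra.
Qed.

Lemma sum_ln_div_le N :
  \sum_(1 <= n < N.+1) ln n%:R / n%:R <= ln N%:R ^+ 2 / 2 + 1 :> R.
Proof.
case: N => [|N]; first by rewrite big_geq // ln0 //; lra.
(* The extra [- N.+1^-1] feeds the induction: replacing [ln (n + 1)] by [ln n] in the new term costs
   at most [1 / (n (n + 1))], which telescopes. *)
suff : \sum_(1 <= n < N.+2) ln n%:R / n%:R <= ln N.+1%:R ^+ 2 / 2 + 1 - N.+1%:R^-1 :> R.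
  have : 0 <= N.+1%:R^-1 :> R by [].
  by move: (\sum_(_ <= _ < _) _) (ln _) (N.+1%:R^-1) => a b c; lra.
elim: N => [|N IH]; first by rewrite big_nat1 ln1 invr1; lra.
rewrite big_nat_recr //=; have [l u] := @lnS_bounds N.+1 isT.
have L0 := ln_nat_ge0 N.+1.
move: l u IH L0; set s := \sum_(_ <= _ < _) _.
set L := ln N.+1%:R; set L' := ln N.+2%:R => l u IH L0.
have q0 : 0 < N.+2%:R^-1 :> R by [].
have E : N.+2%:R^-1 * N.+1%:R^-1 = N.+1%:R^-1 - N.+2%:R^-1 :> R.
  rewrite -[N.+2%:R]natr1; have : 0 < N.+1%:R :> R by [].
  by move: (N.+1%:R : R) => m m0; field; apply/andP; split; lra.
move: E q0 l u IH; set p := N.+1%:R^-1; set q := N.+2%:R^-1 => E q0 l u IH.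
have : (L' - L) * q <= p * q by rewrite ler_pM2r.
have : q * L <= (L' - L) * L by rewrite ler_wpM2r.
have : 0 <= (L' - L) ^+ 2 by exact: sqr_ge0.
nra.
Qed.

Lemma sum_invsqrt_le N : \sum_(1 <= n < N.+1) (Num.sqrt n%:R)^-1 <= 2 * Num.sqrt N%:R :> R.
Proof.
elim: N => [|N IH]; first by rewrite big_geq // sqrtr0 mulr0.
rewrite big_nat_recr //=.
have su : 0 < Num.sqrt N.+1%:R :> R by rewrite sqrtr_gt0.
have sv : 0 <= Num.sqrt N%:R :> R by rewrite sqrtr_ge0.
have E : Num.sqrt N.+1%:R ^+ 2 - Num.sqrt N%:R ^+ 2 = 1 :> R.
  by rewrite !sqr_sqrtr// -natr1; ring.
move: su sv E IH; move: (Num.sqrt N.+1%:R : R) (Num.sqrt N%:R : R) => u v u0 v0 E IH.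
have : u^-1 <= 2 * u - 2 * v.
  rewrite -[u^-1]mul1r ler_pdivrMr//; nra.
lra.
Qed.

Lemma psum_sqrt_div x : 0 <= x -> psum (fun n => Num.sqrt (x / n%:R)) x <= 2 * x.
Proof.
move=> x0; have -> : psum (fun n => Num.sqrt (x / n%:R)) x
    = Num.sqrt x * psum (fun n => (Num.sqrt n%:R)^-1) x.
  by rewrite -psumZ; apply: eq_psum => n _ _; rewrite sqrtrM// sqrtrV.
apply: (@le_trans _ _ (Num.sqrt x * (2 * Num.sqrt (Num.truncn x)%:R))).
  by rewrite ler_wpM2l ?sqrtr_ge0// sum_invsqrt_le.
rewrite mulrCA ler_wpM2l// -[leRHS]sqr_sqrtr// expr2 ler_wpM2l ?sqrtr_ge0//.
by rewrite ler_sqrt// truncn_le.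
Qed.

(** This is [x ^ (3/4)]: the exponent is above [1/2], to absorb [sqrt x] times powers of the
    logarithm, and below 1, so that the sum over [x / n] is [O(x)]. *)
Definition root34 x : R := Num.sqrt x * Num.sqrt (Num.sqrt x).

Lemma root34_ge0 x : 0 <= root34 x.
Proof. by rewrite mulr_ge0 ?sqrtr_ge0. Qed.

(** For [w = x ^ (1/8)], [ln x = 8 ln w <= 8 (w - 1)], hence
    [(ln x + 1)^2 <= 64 w^2 = 64 x ^ (1/4)]. *)
Lemma sqrt_lnsq_le x : 1 <= x -> Num.sqrt x * (ln x + 1) ^+ 2 <= 64 * root34 x.
Proof.
move=> x1; have x0 : 0 <= x by lra.
rewrite /root34 [leRHS]mulrCA ler_wpM2l ?sqrtr_ge0//.
set v := Num.sqrt (Num.sqrt x); pose w := Num.sqrt v.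
have v0 : 0 <= v by rewrite sqrtr_ge0.
have wv : w ^+ 2 = v by rewrite sqr_sqrtr.
have wx : w ^+ 8 = x.
  by rewrite -[8%N]/(2 * 4)%N exprM wv -[4%N]/(2 * 2)%N exprM !sqr_sqrtr// sqrtr_ge0.
have w0 : 0 < w.
  by rewrite /w /v !sqrtr_gt0; lra.
have l0 : 0 <= ln x by rewrite ln_ge0.
have : ln x <= 8 * (w - 1).
  by rewrite -wx lnXn// mulr_natl lerMn2r /= ln_le_subr1.
rewrite -wv => lw; have : ln x + 1 <= 8 * w by lra.
nra.
Qed.

Lemma sum_inv34_le N :
  \sum_(1 <= n < N.+1) (root34 n%:R)^-1 <= 4 * Num.sqrt (Num.sqrt N%:R).
Proof.
elim: N => [|N IH]; first by rewrite big_geq // !sqrtr0 mulr0.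
rewrite big_nat_recr //= /root34.
have E : Num.sqrt N.+1%:R ^+ 2 - Num.sqrt N%:R ^+ 2 = 1 :> R.
  by rewrite !sqr_sqrtr// -natr1; ring.
have su : 0 < Num.sqrt N.+1%:R :> R by rewrite sqrtr_gt0.
have sv : 0 <= Num.sqrt N%:R :> R by rewrite sqrtr_ge0.
move: su sv E IH; move: (Num.sqrt N.+1%:R : R) (Num.sqrt N%:R : R) => U V U0 V0 E IH.
have u0 : 0 < Num.sqrt U by rewrite sqrtr_gt0.
have v0 : 0 <= Num.sqrt V by rewrite sqrtr_ge0.
have : Num.sqrt U ^+ 2 = U by rewrite sqr_sqrtr// ltW.
have : Num.sqrt V ^+ 2 = V by rewrite sqr_sqrtr.
move: u0 v0 IH; move: (Num.sqrt U) (Num.sqrt V) => u v u0 v0 IH vV uU.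
suff : (U * u)^-1 <= 4 * u - 4 * v by lra.
have Uu : 0 < U * u by rewrite mulr_gt0.
rewrite -[leLHS]mul1r ler_pdivrMr// -[leLHS]E -uU -vV.
have vu : v <= u.
  rewrite -(@ler_pXn2r _ 2)// ?nnegrE ?ltW//; rewrite vV uU; nra.
(* Convexity of the fourth power, [u^4 - v^4 <= 4 u^3 (u - v)], for fourth roots [u], [v] of
   consecutive integers: the left side is 1 and the sum telescopes. *)
have H : (4 * u - 4 * v) * (u ^+ 2 * u) - ((u ^+ 2) ^+ 2 - (v ^+ 2) ^+ 2) =
  (u - v) * ((u - v) * (3 * u ^+ 2 + 2 * u * v + v ^+ 2)) by ring.
rewrite -subr_ge0 [leRHS]H mulrA -expr2 mulr_ge0 ?sqr_ge0//.
by rewrite !addr_ge0 ?mulr_ge0 ?sqr_ge0// ltW.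
Qed.

Lemma psum_root34_div x : 0 <= x -> psum (fun n => root34 (x / n%:R)) x <= 4 * x.
Proof.
move=> x0; have -> : psum (fun n => root34 (x / n%:R)) x
    = root34 x * psum (fun n => (root34 n%:R)^-1) x.
  rewrite -psumZ; apply: eq_psum => n _ _; rewrite /root34.
  by rewrite !sqrtrM// ?sqrtr_ge0// !sqrtrV// ?sqrtr_ge0// invfM; ring.
apply: (@le_trans _ _ (root34 x * (4 * Num.sqrt (Num.sqrt (Num.truncn x)%:R)))).
  by rewrite ler_wpM2l ?root34_ge0// sum_inv34_le.
rewrite mulrCA ler_wpM2l//.
apply: (@le_trans _ _ (root34 x * Num.sqrt (Num.sqrt x))).
  by rewrite ler_wpM2l ?root34_ge0// !ler_sqrt ?sqrtr_ge0// truncn_le.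
by rewrite /root34 -mulrA -expr2 sqr_sqrtr ?sqrtr_ge0// -expr2 sqr_sqrtr.
Qed.

(* [s - b] increases and [s + b] decreases, so [s] converges at speed [b]. *)
Lemma telescoping_limit (s b : nat -> R) :
  (forall n, (0 < n)%N -> 0 <= b n) ->
  (forall n, (0 < n)%N -> `|s n.+1 - s n| <= b n - b n.+1) ->
  exists l, forall n, (0 < n)%N -> `|s n - l| <= b n.
Proof.
move=> b0 sb.
have mono m n : (0 < m)%N -> (m <= n)%N -> s m - b m <= s n - b n /\ s n + b n <= s m + b m.
  move=> m0; elim: n => [|n IH]; first by rewrite leqn0 => /eqP mn; move: m0; rewrite mn.
  rewrite leq_eqVlt => /predU1P[<-|]; first by split.
  rewrite ltnS => mn; have [] := IH mn.
  have := sb n (leq_trans m0 mn); rewrite ler_norml => /andP[]; split; lra.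
have cross m n : (0 < m)%N -> (0 < n)%N -> s m - b m <= s n + b n.
  move=> m0 n0; have [h1 _] := mono m (maxn m n) m0 (leq_maxl _ _).
  have [_ h2] := mono n (maxn m n) n0 (leq_maxr _ _).
  have := b0 (maxn m n); rewrite (leq_trans m0 (leq_maxl _ _)) => /(_ isT); lra.
pose E := [set s n - b n | n in [set n | (0 < n)%N]]%classic.
have E0 : (E !=set0)%classic by exists (s 1%N - b 1%N); exists 1%N.
exists (sup E) => n n0; rewrite ler_norml; apply/andP; split.
  have : sup E <= s n + b n by apply: sup_le_ub => // _ [m m0 <-]; exact: cross.
  lra.
have : s n - b n <= sup E.
  apply: ub_le_sup; last by exists n.
  by exists (s 1%N + b 1%N) => _ [m m0 <-]; exact: cross.
lra.
Qed.

End Elementary.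

(** * Dirichlet convolution *)

Section Convolution.
Variable R : realType.
Implicit Types (f g h : nat -> R) (n : nat) (x : R).

Definition dconv f g n : R :=
  \sum_(1 <= d < n.+1 | (d %| n)%N) f d * g (n %/ d)%N.

Lemma eq_dconv f f' g g' n : (0 < n)%N ->
  (forall d, (0 < d <= n)%N -> f d = f' d) -> (forall d, (0 < d <= n)%N -> g d = g' d) ->
  dconv f g n = dconv f' g' n.
Proof.
move=> n0 ff gg; rewrite /dconv big_nat_cond [RHS]big_nat_cond.
apply: eq_bigr => d /andP[/andP[d0 dn] ddn].
rewrite ltnS in dn.
by rewrite ff ?d0// gg// divn_gt0// dn leq_div.
Qed.

Lemma dconvC f g n : (0 < n)%N -> dconv f g n = dconv g f n.
Proof.
move=> n0.
have pairs f' g' : dconv f' g' n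
    = \sum_(1 <= d < n.+1) \sum_(1 <= e < n.+1 | (d * e == n)%N) f' d * g' e.
  rewrite /dconv big_mkcond /=; apply: eq_big_nat => d /andP[d0 _].
  case: ifPn => [/dvdnP[e ne]|ndv]; last first.
    by rewrite big1// => e /eqP de; move: ndv; rewrite -de dvdn_mulr.
  have e0 : (0 < e)%N by move: n0; rewrite ne muln_gt0 => /andP[].
  rewrite big_mkcond (bigD1_seq e) ?iota_uniq//=; last first.
    by rewrite mem_index_iota e0 ltnS ne leq_pmulr.
  rewrite ne mulnK// [(d * e)%N]mulnC eqxx big1 ?addr0// => i /negPf ie.
  by rewrite mulnC eqn_pmul2r// ie.
rewrite !pairs (exchange_big_dep xpredT)//=.
apply: eq_big_nat => d _; apply: eq_big => [e|e _]; first by rewrite mulnC.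
by rewrite mulrC.
Qed.

Lemma psum_dconv f g x : 0 <= x ->
  psum (dconv f g) x = psum (fun d => f d * psum g (x / d%:R)) x.
Proof.
move=> x0; rewrite (psum_dirichlet (fun d e => f d * g e))//.
by apply: eq_psum => d _ _; rewrite psumZ.
Qed.

Lemma psum_dconv_weight f g (F : R -> R) x : 0 <= x ->
  psum (fun n => dconv f g n * F (x / n%:R)) x
  = psum (fun d => f d * psum (fun e => g e * F (x / d%:R / e%:R)) (x / d%:R)) x.
Proof.
move=> x0.
transitivity (psum (fun n => \sum_(1 <= d < n.+1 | (d %| n)%N)
    f d * (g (n %/ d)%N * F (x / d%:R / (n %/ d)%N%:R))) x).
  apply: eq_psum => n n0 _; rewrite /dconv mulr_suml big_nat_cond [RHS]big_nat_cond.
  apply: eq_bigr => d /andP[/andP[d0 _] /dvdnP[e ->]].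
  rewrite mulnK// mulrA; congr (_ * F _).
  by rewrite natrM invfM; ring.
rewrite (psum_dirichlet (fun d e => f d * (g e * F (x / d%:R / e%:R))))//.
by apply: eq_psum => d _ _; rewrite psumZ.
Qed.

Lemma psum_inj f g : (forall N : nat, psum f N%:R = psum g N%:R) ->
  forall n, (0 < n)%N -> f n = g n.
Proof.
move=> fg [//|n] _; have := fg n.+1; have := fg n; rewrite !psum_nat => E.
rewrite big_nat_recr//= E [in RHS]big_nat_recr//=; exact: addrI.
Qed.

(** Partial sums determine a function on the positive integers ([psum_inj]), and those of both sides
    reduce to the same nested sum; triples of divisors are never reindexed. *)
Lemma dconvA f g h n : (0 < n)%N -> dconv f (dconv g h) n = dconv (dconv f g) h n.
Proof.
apply: psum_inj => N; rewrite psum_dconv// [RHS]psum_dconv//.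
rewrite (psum_dconv_weight _ _ (psum h))//; apply: eq_psum => d _ _.
by rewrite psum_dconv// divr_ge0.
Qed.

Lemma dconv_ln f g n : (0 < n)%N -> dconv f g n * ln n%:R
  = dconv (fun d => f d * ln d%:R) g n + dconv f (fun d => g d * ln d%:R) n.
Proof.
move=> n0; rewrite /dconv mulr_suml -big_split /= big_nat_cond [RHS]big_nat_cond.
apply: eq_bigr => d /andP[/andP[d0 _] /dvdnP[e ne]]; rewrite ne mulnK//.
have e0 : (0 < e)%N by move: n0; rewrite ne muln_gt0 => /andP[].
by rewrite natrM ln_mulE ?ltr0n//; ring.
Qed.

Lemma dconv1l f n : (0 < n)%N -> dconv (fun d => (d == 1)%N%:R) f n = f n.
Proof.
move=> n0; rewrite /dconv big_mkcond (bigD1_seq 1%N) ?iota_uniq//=; last first.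
  by rewrite mem_index_iota.
rewrite dvd1n mul1r divn1 big1 ?addr0// => i /negPf ->.
by rewrite mul0r; case: ifP.
Qed.

Lemma dconvNl f g n : dconv (fun d => - f d) g n = - dconv f g n.
Proof. by rewrite /dconv -sumrN; apply: eq_bigr => d _; rewrite mulNr. Qed.

Lemma dconv_ge0 f g n : (forall d, 0 <= f d) -> (forall d, 0 <= g d) -> 0 <= dconv f g n.
Proof. by move=> f0 g0; apply: sumr_ge0 => d _; exact: mulr_ge0. Qed.

(** [k] is fuel: the recursion visits proper divisors, so for positive [n] every [k >= n] yields the
    same value ([mobius_aux_fuel]). *)
Fixpoint mobius_aux (L : nat -> R) (k n : nat) : R :=
  if k is k'.+1 then
    if n == 1%N then 1 else
    - (\sum_(1 <= d < n | (d %| n)%N) mobius_aux L k' d * L (n %/ d)%N) / ln n%:R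
  else 0.

(* The Dirichlet inverse of [a], computed from the logarithmic derivative [L] of
   [a] through mu * ln = - mu * L: since [L] is nonnegative, this recursion
   yields the bound by [a]. *)
Definition mobius L n := mobius_aux L n n.

Lemma mobius_aux_fuel L k l n : (0 < n <= k)%N -> (n <= l)%N ->
  mobius_aux L k n = mobius_aux L l n.
Proof.
elim: k l n => [|k IH] l n; first by case: n.
case: l => [|l]; first by rewrite leqn0 => /[swap] /eqP ->.
move=> /andP[n0 nk] nl /=; case: eqP => // _; congr (- _ / _).
rewrite big_nat_cond [RHS]big_nat_cond; apply: eq_bigr => d /andP[/andP[d0 dn] _].
have dk : (d <= k)%N by rewrite -ltnS (leq_trans dn).
by rewrite (IH l) ?d0// -ltnS (leq_trans dn).
Qed.

Lemma mobius_rec L n : (1 < n)%N -> mobius L n * ln n%:R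
  = - \sum_(1 <= d < n | (d %| n)%N) mobius L d * L (n %/ d)%N.
Proof.
case: n => // n n1; rewrite /mobius /= ifN ?gtn_eqF// divfK; last first.
  by rewrite gt_eqF// ln_gt0// ltr1n.
congr (- _); rewrite big_nat_cond [RHS]big_nat_cond.
apply: eq_bigr => d /andP[/andP[d0 dn] _].
by rewrite (@mobius_aux_fuel _ _ d) ?d0.
Qed.

Section Mobius.
Variables a L : nat -> R.
Hypothesis a1 : a 1%N = 1.
Hypothesis a_ge0 : forall n, 0 <= a n.
Hypothesis L_ge0 : forall n, 0 <= L n.
Hypothesis aL : forall n, (0 < n)%N -> dconv a L n = a n * ln n%:R.

Lemma dconv_recr f g n : (0 < n)%N -> dconv f g n
  = \sum_(1 <= d < n | (d %| n)%N) f d * g (n %/ d)%N + f n * g 1%N.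
Proof.
by move=> n0; rewrite /dconv big_mkcond big_nat_recr//= -big_mkcond dvdnn divnn n0.
Qed.

Lemma logderiv1 : L 1%N = 0.
Proof. by have := aL (ltnSn 0); rewrite dconv_recr// big_geq// add0r a1 ln1 mul1r mulr0. Qed.

Lemma mobius_ln n : (0 < n)%N -> dconv (mobius L) L n = - (mobius L n * ln n%:R).
Proof.
move=> n0; rewrite dconv_recr// logderiv1 mulr0 addr0.
have [->|n1] := eqVneq n 1%N; first by rewrite big_geq// ln1 mulr0 oppr0.
by rewrite mobius_rec ?opprK// ltn_neqAle eq_sym n1.
Qed.

(** Multiplication by [ln] is a derivation for convolution. With [mu = mobius L], the product of
    [mu * a] with [ln] is [- (mu * L) * a + mu * (L * a) = 0], and [ln n] is nonzero for [n > 1]. *)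
Lemma mobius_dconv n : (0 < n)%N -> dconv (mobius L) a n = (n == 1)%N%:R.
Proof.
move=> n0; have [->|n1] := eqVneq n 1%N.
  by rewrite dconv_recr// big_geq// add0r a1 mulr1.
have n_gt1 : (1 < n)%N by rewrite ltn_neqAle eq_sym n1.
apply: (@mulIf _ (ln n%:R)); first by rewrite gt_eqF// ln_gt0// ltr1n.
rewrite mul0r dconv_ln//.
have -> : dconv (fun d => mobius L d * ln d%:R) a n = - dconv (dconv (mobius L) L) a n.
  rewrite -dconvNl; apply: eq_dconv => // d /andP[d0 _]; by rewrite mobius_ln// opprK.
have -> : dconv (mobius L) (fun d => a d * ln d%:R) n = dconv (mobius L) (dconv L a) n.
  by apply: eq_dconv => // d /andP[d0 _]; rewrite -aL// dconvC.
by rewrite dconvA// addNr.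
Qed.

Lemma mobius_dconv_ln n : (0 < n)%N ->
  dconv (mobius L) (fun d => a d * ln d%:R) n = L n.
Proof.
move=> n0; have -> : dconv (mobius L) (fun d => a d * ln d%:R) n
    = dconv (mobius L) (dconv a L) n.
  by apply: eq_dconv => // d /andP[d0 _]; rewrite aL.
rewrite dconvA// -[RHS]dconv1l//; apply: eq_dconv => // d /andP[d0 _].
exact: mobius_dconv.
Qed.

(** Strong induction: [|mu n| ln n <= sum |mu d| L (n / d) <= sum a d L (n / d) = a n ln n], over
    proper divisors [d]; the divisor [n] adds nothing as [L 1 = 0]. *)
Lemma mobius_le n : (0 < n)%N -> `|mobius L n| <= a n.
Proof.
have [m] := ubnP n; elim: m n => // m IH n nm n0.
have [->|n1] := eqVneq n 1%N; first by rewrite a1 normr1.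
have n_gt1 : (1 < n)%N by rewrite ltn_neqAle eq_sym n1.
have l0 : 0 < ln n%:R :> R by rewrite ln_gt0// ltr1n.
rewrite -(ler_pM2r l0) -{1}(ger0_norm (ltW l0)) -normrM mobius_rec// normrN.
apply: le_trans (ler_norm_sum _ _ _) _; rewrite -aL// dconv_recr// logderiv1 mulr0 addr0.
rewrite big_nat_cond [leRHS]big_nat_cond; apply: ler_sum => d /andP[/andP[d0 dn] _].
by rewrite normrM (ger0_norm (L_ge0 _)) ler_wpM2r// IH// (leq_trans dn).
Qed.

End Mobius.
End Convolution.

(** * Monotone weights and comparison of sums *)

Section Comparison.
Variable R : realType.
Implicit Types (x y : R) (n N : nat).

Lemma divn_ge1 x n : (0 < n)%N -> n%:R <= x -> 1 <= x / n%:R.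
Proof. by move=> n0 nx; rewrite ler_pdivlMr ?ltr0n// mul1r. Qed.

Lemma nat_ge1 n : (0 < n)%N -> 1 <= n%:R :> R.
Proof. by rewrite ler1n. Qed.

Lemma ln_div_decr x n : 0 < x -> (0 < n)%N -> ln (x / n.+1%:R) <= ln (x / n%:R).
Proof.
move=> x0 n0; apply: ln_mono; first by rewrite divr_gt0.
by rewrite ler_pM2l// lef_pV2 ?posrE ?ltr0n// ler_nat.
Qed.

Lemma sqrt_div_decr x n : 0 <= x -> (0 < n)%N ->
  Num.sqrt (x / n.+1%:R) <= Num.sqrt (x / n%:R).
Proof.
move=> x0 n0; rewrite ler_sqrt ?divr_ge0//.
by rewrite ler_wpM2l// lef_pV2 ?posrE ?ltr0n// ler_nat.
Qed.

Lemma root34_div_decr x n : 0 <= x -> (0 < n)%N ->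
  root34 (x / n.+1%:R) <= root34 (x / n%:R).
Proof.
move=> x0 n0; have h := sqrt_div_decr x0 n0; rewrite /root34.
by apply: ler_pM; rewrite ?sqrtr_ge0// ler_sqrt ?sqrtr_ge0.
Qed.

(** Abel summation against the decreasing weight [t]: a linear bound on the partial sums of [f] lets
    [f] be replaced by the constant [B]. *)
Lemma psum_compare (f t : nat -> R) B x : 0 <= x ->
  (forall n, (0 < n)%N -> 0 <= f n) ->
  (forall n, (0 < n)%N -> psum f n%:R <= B * n%:R) ->
  (forall n, (0 < n)%N -> n%:R <= x -> 0 <= t n) ->
  (forall n, (0 < n)%N -> n.+1%:R <= x -> t n.+1 <= t n) ->
  psum (fun n => f n * t n) x <= B * psum t x.
Proof.
move=> x0 f0 fB t0 tt; rewrite -psumZ; apply: le_trans (ler_norm _) _.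
apply: abel_psum_le => // [n n0 nx|n n0 nx|n n0 nx].
- rewrite ger0_norm ?psum_ge0// => [|m m0 _]; last exact: f0.
  have -> : psum (fun=> B) n%:R = B * psum (fun=> 1) n%:R.
    by rewrite -psumZ; apply: eq_psum => *; rewrite mulr1.
  by rewrite psum1// natrK fB.
- by rewrite ger0_norm// subr_ge0 tt.
- by rewrite ger0_norm// t0.
Qed.

Lemma sqrt_le_id x : 1 <= x -> Num.sqrt x <= x.
Proof.
move=> x1; have x0 : 0 <= x by lra.
rewrite -[leRHS](ger0_norm x0) -sqrtr_sqr ler_sqrt ?sqr_ge0//; nra.
Qed.

Lemma sqrt_ge1 x : 1 <= x -> 1 <= Num.sqrt x.
Proof. by move=> x1; rewrite -sqrtr1 ler_sqrt// (le_trans ler01). Qed.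

Lemma lnS_le_sqrt x : 1 <= x -> ln x + 1 <= 2 * Num.sqrt x.
Proof.
move=> x1; have s1 := sqrt_ge1 x1.
have : ln (Num.sqrt x ^+ 2) <= 2 * (Num.sqrt x - 1).
  by rewrite lnXn ?mulr_natl ?lerMn2r/= ?ln_le_subr1//; lra.
rewrite sqr_sqrtr; lra.
Qed.

Lemma sqrt_lnS_le x : 1 <= x -> Num.sqrt x * (ln x + 1) <= 2 * x.
Proof.
move=> x1; rewrite -[in leRHS](@sqr_sqrtr _ x); last lra.
have := lnS_le_sqrt x1; have := sqrt_ge1 x1; nra.
Qed.

(** [abel_psum_le] takes its error bound in the shape of a partial sum; this gives [sqrt N] that
    shape. *)
Lemma sqrt_le_sum_invsqrt N : Num.sqrt N%:R <= psum (fun n => (Num.sqrt n%:R)^-1) N%:R :> R.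
Proof.
case: N => [|N]; first by rewrite sqrtr0 psum_ge0// => n _ _; rewrite invr_ge0 sqrtr_ge0.
have s0 : 0 < Num.sqrt N.+1%:R :> R by rewrite sqrtr_gt0.
apply: (@le_trans _ _ (psum (fun=> (Num.sqrt N.+1%:R)^-1 * 1) N.+1%:R)).
  rewrite psumZ psum1// natrK -[X in _ <= _ * X](@sqr_sqrtr _ N.+1%:R)//.
  by rewrite expr2 mulKf ?gt_eqF.
apply: le_psum => n n0 nN; rewrite mulr1 lef_pV2 ?posrE// ?sqrtr_gt0 ?ltr0n//.
by rewrite ler_sqrt.
Qed.

Lemma psum_invsqrt_le x : 0 <= x -> psum (fun n => (Num.sqrt n%:R)^-1) x <= 2 * Num.sqrt x.
Proof.
move=> x0; apply: le_trans (sum_invsqrt_le _ _) _.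
by rewrite ler_wpM2l// ler_sqrt// truncn_le.
Qed.

(** The left side is [(1/r - 1/q) (1 + r/q)]. With [r = sqrt n] and [q = sqrt (n + 1)] it makes the
    errors in [psum_a_div] telescope. *)
Lemma invsqrtB_ge (r q : R) : 0 < r -> 0 < q -> q ^+ 2 = r ^+ 2 + 1 ->
  r * ((r ^+ 2)^-1 - (q ^+ 2)^-1) <= 2 * (r^-1 - q^-1).
Proof.
move=> r0 q0 E; have rq : r < q by nra.
rewrite -!exprVn subr_sqr mulrCA [leRHS]mulrC ler_wpM2l//.
  by rewrite subr_ge0 lef_pV2 ?posrE ?ltW.
rewrite mulrDr divff ?gt_eqF//; have : r / q <= 1 by rewrite ler_pdivrMr ?mul1r ?ltW.
lra.
Qed.

End Comparison.

(** * Weighted sums of the counting function [a] *)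

Section BeurlingPrimes.
Variable R : realType.
Variables a L : nat -> R.
Variables c K0 : R.
Hypothesis a1 : a 1%N = 1.
Hypothesis a_ge0 : forall n, 0 <= a n.
Hypothesis L_ge0 : forall n, 0 <= L n.
Hypothesis aL : forall n, (0 < n)%N -> dconv a L n = a n * ln n%:R.
Hypothesis c_gt0 : 0 < c.
Hypothesis aA : forall x, 1 <= x -> `|psum a x - c * x| <= K0 * Num.sqrt x.
Implicit Types (x y : R) (n N : nat).

Let K0_ge0 : 0 <= K0.
Proof. by have := @aA 1 (lexx _); rewrite sqrtr1 !mulr1; move/(le_trans (normr_ge0 _)). Qed.

Let psi := psum L.

Lemma psum_a_le x : 1 <= x -> psum a x <= (c + K0) * x.
Proof.
move=> x1; have := aA x1; rewrite ler_norml => /andP[_].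
have := sqrt_le_id x1; have := K0_ge0; nra.
Qed.

(** Beyond [s ^ 2] the error [K0 sqrt x] is at most half of [c x]; below it the single term
    [a 1 = 1] suffices. *)
Lemma psum_a_ge : exists2 k, 0 < k & forall x, 1 <= x -> k * x <= psum a x.
Proof.
pose s := 2 * K0 / c + 1.
have s1 : 1 <= s by rewrite lerDr divr_ge0 ?mulr_ge0 ?K0_ge0// ltW.
have s0 : 0 < s by lra.
have sk : 0 < (s ^+ 2)^-1 by rewrite invr_gt0 exprn_gt0.
exists (Num.min (c / 2) (s ^+ 2)^-1) => [|x x1].
  by rewrite lt_min sk divr_gt0.
have [xs|xs] := leP x (s ^+ 2).
  apply: (@le_trans _ _ ((s ^+ 2)^-1 * x)).
    by rewrite ler_wpM2r ?ge_min ?lexx ?orbT//; lra.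
  apply: (@le_trans _ _ 1); first by rewrite mulrC ler_pdivrMr ?mul1r ?exprn_gt0.
  apply: le_trans (psum_homo _ x1); last by move=> n _.
  by rewrite /psum truncn1 big_nat1 a1.
apply: (@le_trans _ _ (c / 2 * x)).
  by rewrite ler_wpM2r ?ge_min ?lexx//; lra.
have x0 : 0 <= x by lra.
have ss : s <= Num.sqrt x.
  by rewrite -[leLHS](ger0_norm (ltW s0)) -sqrtr_sqr ler_sqrt// ltW.
have : 2 * K0 <= c * Num.sqrt x.
  have : c * s <= c * Num.sqrt x by rewrite ler_pM2l.
  have -> : c * s = 2 * K0 + c by rewrite /s; field; rewrite gt_eqF.
  by have := c_gt0; lra.
have := aA x1; rewrite ler_norml => /andP[+ _].
have := sqr_sqrtr x0; have := sqrtr_ge0 x; move: (Num.sqrt x) => r r0 <-; nra.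
Qed.

(** Abel summation applies to [a - c], whose partial sums are [O(sqrt n)]; the constant part is
    [psum_ln_div]. *)
Lemma psum_a_ln_div : exists2 K, 0 <= K & forall x, 1 <= x ->
  `|psum (fun n => a n * ln (x / n%:R)) x - c * x| <= K * (Num.sqrt x * (ln x + 1)).
Proof.
exists (2 * K0 + 2 * c) => [|x x1]; first by have := K0_ge0; have := c_gt0; lra.
have x0 : 0 < x by lra.
pose e n := a n - c.
have -> : psum (fun n => a n * ln (x / n%:R)) x
    = psum (fun n => e n * ln (x / n%:R)) x + c * psum (fun n => ln (x / n%:R)) x.
  by rewrite -psumZ -psumD; apply: eq_psum => n _ _; rewrite /e; ring.
have lx : 0 <= ln x by rewrite ln_ge0.
have H : `|psum (fun n => e n * ln (x / n%:R)) x|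
    <= psum (fun n => K0 / Num.sqrt n%:R * ln (x / n%:R)) x.
  apply: abel_psum_le => [|n n0 nx|n n0 nx|n n0 nx]; first exact: ltW.
  - have -> : psum e n%:R = psum a n%:R - c * n%:R.
      rewrite psumB; congr (_ - _).
      have -> : psum (fun=> c) n%:R = c * psum (fun=> 1) n%:R.
        by rewrite -psumZ; apply: eq_psum => *; rewrite mulr1.
      by rewrite psum1// natrK.
    apply: le_trans (aA (nat_ge1 R n0)) _.
    by rewrite psumZ ler_wpM2l// sqrt_le_sum_invsqrt.
  - by rewrite ger0_norm// subr_ge0 ln_div_decr.
  - by rewrite ger0_norm// ln_ge0// divn_ge1.
have {}H : `|psum (fun n => e n * ln (x / n%:R)) x| <= 2 * K0 * (Num.sqrt x * ln x).
  apply: le_trans H _.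
  apply: (@le_trans _ _ (psum (fun n => K0 * ln x * (Num.sqrt n%:R)^-1) x)).
    apply: le_psum => n n0 nx; rewrite [leRHS]mulrAC; apply: ler_wpM2l.
      by rewrite divr_ge0 ?sqrtr_ge0.
    have nR : 0 < n%:R :> R by rewrite ltr0n.
    apply: ln_mono; first by rewrite divr_gt0.
    by rewrite ler_pdivrMr// ler_peMr ?nat_ge1// ltW.
  rewrite psumZ; have := psum_invsqrt_le (ltW x0); have : 0 <= K0 * ln x by rewrite mulr_ge0.
  move: (psum _ _) (Num.sqrt x) => p r h1 h2; nra.
have [l u] := psum_ln_div x1.
have := sqrt_ge1 x1; move: H l u lx; rewrite !ler_norml.
move: (psum _ _) (psum _ _) (Num.sqrt x) (ln x) => p q r lx.
move=> /andP[h1 h2] l u lx0 r1; have := K0_ge0.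
move=> k0.
have : 0 <= K0 * r by rewrite mulr_ge0//; lra.
have : lx + 2 <= 2 * (r * (lx + 1)) by nra.
move=> h3; have := ler_wpM2l (ltW c_gt0) h3; have := ler_wpM2l (ltW c_gt0) l.
have := ler_wpM2l (ltW c_gt0) u.
move=> *; apply/andP; split; nra.
Qed.

Lemma psum_a_div : exists g, exists2 K, 0 <= K & forall x, 1 <= x ->
  `|psum (fun n => a n / n%:R) x - c * ln x - g| <= K / Num.sqrt x.
Proof.
(* What Abel summation leaves besides the boundary term, less [c ln N]; its increments are dominated
   by those of [B / sqrt n], so it converges at that speed. *)
pose w N := \sum_(1 <= k < N) psum a k%:R * (k%:R^-1 - k.+1%:R^-1) - c * ln N%:R.
pose B := 2 * (K0 + c).
have B0 : 0 <= B by rewrite mulr_ge0// addr_ge0// ?K0_ge0// ltW.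
have [] := @telescoping_limit R w (fun n => B / Num.sqrt n%:R).
- by move=> n _; rewrite divr_ge0// sqrtr_ge0.
- move=> n n0; rewrite /w big_nat_recr//=.
  set s := \sum_(_ <= _ < _) _.
  have [l u] := lnS_bounds R n0.
  have An := aA (nat_ge1 R n0).
  have n1 : 1 <= n%:R :> R := nat_ge1 R n0.
  have rn := sqrt_ge1 n1.
  have rE : Num.sqrt n%:R ^+ 2 = n%:R :> R by rewrite sqr_sqrtr.
  have qE : Num.sqrt n.+1%:R ^+ 2 = n%:R + 1 :> R by rewrite sqr_sqrtr// natr1.
  have q0 : 0 < Num.sqrt n.+1%:R :> R by rewrite sqrtr_gt0.
  rewrite -!natr1 in l u An *; rewrite -!natr1 in qE q0.
  move: l u An rn rE qE q0.
  move: (psum a _) (ln (n%:R + 1)) (ln n%:R) (Num.sqrt n%:R) (Num.sqrt (n%:R + 1)).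
  move=> A l' l r q; move: (n%:R : R) n1 => m m1 h1 h2 An r1 rE qE q0.
  have r0 : 0 < r by lra.
  have H : r * (m^-1 - (m + 1)^-1) <= 2 * (r^-1 - q^-1).
    by have := @invsqrtB_ge _ r q r0 q0; rewrite qE rE; apply.
  have d0 : 0 <= m^-1 - (m + 1)^-1 by rewrite subr_ge0 lef_pV2 ?posrE; lra.
  have cd : c * m * (m^-1 - (m + 1)^-1) = c * (m + 1)^-1.
    by field; apply/andP; split; lra.
  have -> : B / r - B / q = (K0 + c) * (2 * (r^-1 - q^-1)) by rewrite /B; ring.
  apply: le_trans (ler_wpM2l _ H); last by rewrite addr_ge0 ?K0_ge0// ltW.
  have {}h1 := ler_wpM2l (ltW c_gt0) h1; have {}h2 := ler_wpM2l (ltW c_gt0) h2.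
  move: An; rewrite !ler_norml => /andP[A1 A2].
  have {}A1 := ler_wpM2r d0 A1; have {}A2 := ler_wpM2r d0 A2.
  have h3 : 0 <= c * (r - 1) * (m^-1 - (m + 1)^-1).
    by rewrite mulr_ge0// mulr_ge0 ?subr_ge0// ltW.
  by move: cd A1 A2 h1 h2 h3; move: (m^-1) ((m + 1)^-1) => p p' *; apply/andP; split; lra.
(* [l] is the limit of [w], and [c] that of the boundary term, [psum a x] divided by the integer
   part of [x]. *)
move=> l Hl; exists (c + l); exists (2 * (K0 + B) + 2 * c); first by have := K0_ge0; have := c_gt0; lra.
move=> x x1; have [N0 Nx xN] := truncn_bounds x1.
have -> : psum (fun n => a n / n%:R) x = psum a x / (Num.truncn x)%:R +
   (w (Num.truncn x) + c * ln (Num.truncn x)%:R).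
  rewrite /psum abel_sum// /w subrK; congr (_ + _); apply: eq_big_nat => k _.
  by rewrite psum_nat.
have := aA (nat_ge1 R N0); rewrite psum_nat -/(psum a x).
move: (Hl _ N0) (N0) Nx xN => {N0 Hl}; rewrite {}/w; move: (Num.truncn x) => N.
move: (_ - c * ln N%:R) => w HN N0 Nx xN AN.
have N1 : 1 <= N%:R :> R := nat_ge1 R N0.
have r1 := sqrt_ge1 N1; have rE : Num.sqrt N%:R ^+ 2 = N%:R :> R by rewrite sqr_sqrtr.
have xr : Num.sqrt x <= 2 * Num.sqrt N%:R.
  rewrite -[leRHS](@ger0_norm _ (2 * _)) ?mulr_ge0 ?sqrtr_ge0//.
  by rewrite -sqrtr_sqr ler_sqrt ?sqr_ge0// exprMn rE; lra.
have x0 : 0 < Num.sqrt x by rewrite sqrtr_gt0; lra.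
have l1 : 0 <= ln x - ln N%:R by rewrite subr_ge0 ln_mono//; lra.
have l2 : ln x - ln N%:R <= N%:R^-1.
  apply: le_trans (lnB_le _ _) _; rewrite ?ltr0n//; first by lra.
  by rewrite ler_pdivrMr ?mulVf//; lra.
have {xr} : 2 * (K0 + B + c) / (2 * Num.sqrt N%:R) <= (2 * (K0 + B) + 2 * c) / Num.sqrt x.
  have -> : 2 * (K0 + B) + 2 * c = 2 * (K0 + B + c) by ring.
  rewrite ler_wpM2l ?lef_pV2 ?posrE//; last by rewrite mulr_gt0; lra.
  by rewrite mulr_ge0// !addr_ge0// ?K0_ge0// ltW.
apply: le_trans; rewrite -mulf_div divff ?mul1r//.
move: AN HN l1 l2 rE; move: (psum a x) (ln x) (Num.sqrt N%:R) r1 (ln N%:R) => A lx r r1 l'.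
move: (N%:R : R) => m AN HN l1 l2 rE; subst m.
have r0 : 0 < r by lra.
have -> : A / r ^+ 2 + (w + c * l') - c * lx - (c + l)
   = (A - c * r ^+ 2) / r ^+ 2 + (w - l) - c * (lx - l') by field; lra.
have v1 : (r ^+ 2)^-1 <= r^-1 by rewrite lef_pV2 ?posrE// ?exprn_gt0// ler_eXnr.
have {}AN : `|(A - c * r ^+ 2) / r ^+ 2| <= K0 / r.
  rewrite normrM [X in _ * X]ger0_norm ?invr_ge0 ?sqr_ge0//.
  rewrite ler_pdivrMr ?exprn_gt0// (le_trans AN)//.
  by rewrite -mulrA expr2 mulKf ?gt_eqF.
have {l1 v1} l2 : `|c * (lx - l')| <= c / r.
  rewrite normrM (gtr0_norm c_gt0) (ger0_norm l1) ler_pM2l//; lra.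
apply: le_trans (ler_normB _ _) _; rewrite ![in leRHS]mulrDl lerD//.
by apply: le_trans (ler_normD _ _) _; rewrite lerD.
Qed.

End BeurlingPrimes.

(** * Selberg's symmetry formula *)

Section Selberg.
Variable R : realType.
Variables a L : nat -> R.
Variables c K0 : R.
Hypothesis a1 : a 1%N = 1.
Hypothesis a_ge0 : forall n, 0 <= a n.
Hypothesis L_ge0 : forall n, 0 <= L n.
Hypothesis aL : forall n, (0 < n)%N -> dconv a L n = a n * ln n%:R.
Hypothesis c_gt0 : 0 < c.
Hypothesis aA : forall x, 1 <= x -> `|psum a x - c * x| <= K0 * Num.sqrt x.
Implicit Types (x y : R) (n N : nat).

Let K0_ge0 : 0 <= K0.
Proof. by have := @aA 1 (lexx _); rewrite sqrtr1 !mulr1; move/(le_trans (normr_ge0 _)). Qed.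

Let psi := psum L.

Let psi_ge0 x : 0 <= psi x.
Proof. by apply: psum_ge0 => n _ _; exact: L_ge0. Qed.

Lemma psum_a_ln x : 1 <= x ->
  psum (fun n => a n * ln n%:R) x = ln x * psum a x - psum (fun n => a n * ln (x / n%:R)) x.
Proof.
move=> x1; rewrite -psumZ -psumB; apply: eq_psum => n n0 _.
by rewrite ln_divE ?ltr0n//; [ring|lra].
Qed.

(** The analogue of Chebyshev's identity [ln N! = sum_n psi (N / n)]. *)
Lemma psum_a_psi x : 0 <= x ->
  psum (fun n => a n * psi (x / n%:R)) x = psum (fun n => a n * ln n%:R) x.
Proof. by move=> x0; rewrite -psum_dconv//; apply: eq_psum => n n0 _; exact: aL. Qed.

Lemma psum_L_A x : 0 <= x ->
  psum (fun n => L n * psum a (x / n%:R)) x = psum (fun n => a n * ln n%:R) x.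
Proof.
by move=> x0; rewrite -psum_dconv//; apply: eq_psum => n n0 _; rewrite dconvC// aL.
Qed.

(* The constant [C] is chosen so that the terms of order [y * ln y] and [y] cancel. *)
Lemma psum_a_shifted : exists C, exists2 K, 0 <= K & forall y, 1 <= y ->
  `|psum (fun n => a n * (psi (y / n%:R) - y / n%:R + C)) y|
    <= K * (Num.sqrt y * (ln y + 1)).
Proof.
have [g [K3 K3_ge0 H3]] := psum_a_div c_gt0 aA.
have [K2 K2_ge0 H2] := psum_a_ln_div c_gt0 aA.
(* The main terms are [c y ln y - c y - y (c ln y + g) + C c y]; they vanish for this [C]. *)
pose C := (c + g) / c; exists C.
have K_ge0 : 0 <= K0 + K2 + K3 + `|C| * K0 by rewrite !addr_ge0// mulr_ge0.
exists (K0 + K2 + K3 + `|C| * K0) => // y y1.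
have y0 : 0 <= y by lra.
have -> : psum (fun n => a n * (psi (y / n%:R) - y / n%:R + C)) y
    = psum (fun n => a n * psi (y / n%:R)) y
      - y * psum (fun n => a n / n%:R) y + C * psum a y.
  rewrite -!psumZ -psumB -psumD; apply: eq_psum => n _ _; ring.
rewrite psum_a_psi// psum_a_ln//.
have l0 : 0 <= ln y by rewrite ln_ge0.
have r1 := sqrt_ge1 y1; have rE : Num.sqrt y ^+ 2 = y by rewrite sqr_sqrtr.
move: (H3 y y1) (H2 y y1) (aA y1).
have Cc : C * c = c + g by rewrite /C divfK// gt_eqF.
move: (psum _ _) (psum _ _) (psum _ _) => A S1 S2 h3 h2 hA.
have -> : ln y * A - S1 - y * S2 + C * A = (ln y + C) * (A - c * y) - (S1 - c * y)
    - y * (S2 - c * ln y - g).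
  by rewrite -[g](addKr c) -Cc; ring.
have {}h3 : `|y * (S2 - c * ln y - g)| <= K3 * Num.sqrt y.
  rewrite normrM (ger0_norm y0); apply: le_trans (ler_wpM2l y0 h3) _.
  have -> : y * (K3 / Num.sqrt y) = K3 * Num.sqrt y; last by [].
  by rewrite -[X in X * _]rE; field; rewrite gt_eqF//; lra.
have {}hA : `|(ln y + C) * (A - c * y)| <= (ln y + `|C|) * (K0 * Num.sqrt y).
  by rewrite normrM ler_pM// (le_trans (ler_normD _ _))// (ger0_norm l0).
apply: le_trans (ler_normB _ _) _; apply: le_trans (lerD (ler_normB _ _) h3) _.
apply: le_trans (lerD (lerD hA h2) (lexx _)) _.
have C0 := normr_ge0 C; move: (`|C|) C0 K_ge0 => D D0 _.
move: (Num.sqrt y) (ln y) r1 l0 => r l r1 l0.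
have r0 : 0 <= r by lra.
have e1 : 0 <= D * K0 * (r * l) by rewrite !mulr_ge0.
have e2 : 0 <= K3 * (r * l) by rewrite !mulr_ge0.
have e3 : 0 <= K0 * r by rewrite mulr_ge0.
lra.
Qed.

Lemma psum_delta (H : nat -> R) x : 1 <= x ->
  psum (fun n => (n == 1)%N%:R * H n) x = H 1%N.
Proof.
move=> x1; rewrite /psum big_ltn ?ltnS ?truncn_gt0// eqxx mul1r big_nat_cond big1 ?addr0//.
by move=> n /andP[/andP[n1 _] _]; rewrite gtn_eqF// mul0r.
Qed.

(** Since [mu * a] is the unit of convolution and [mu * (a ln) = L], both terms on the left are sums
    of [mu d a e F (x / (d e))] over pairs [(d, e)], with extra factors [ln (x / (d e))] and [ln e];
    these add up to [ln (x / d)]. *)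
Lemma tatuzawa_iseki (F : R -> R) x : 1 <= x ->
  F x * ln x + psum (fun n => L n * F (x / n%:R)) x
  = psum (fun d => mobius L d *
      (ln (x / d%:R) * psum (fun n => a n * F (x / d%:R / n%:R)) (x / d%:R))) x.
Proof.
move=> x1; have x0 : 0 < x by lra.
have -> : F x * ln x
    = psum (fun n => dconv (mobius L) a n * (fun y => F y * ln y) (x / n%:R)) x.
  transitivity (psum (fun n => (n == 1)%N%:R * (F (x / n%:R) * ln (x / n%:R))) x).
    by rewrite psum_delta// invr1 mulr1.
  by apply: eq_psum => n n0 _; rewrite (mobius_dconv a1 aL).
have -> : psum (fun n => L n * F (x / n%:R)) x
    = psum (fun n => dconv (mobius L) (fun d => a d * ln d%:R) n * F (x / n%:R)) x.
  by apply: eq_psum => n n0 _; rewrite (mobius_dconv_ln a1 aL).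
rewrite (psum_dconv_weight _ _ (fun y => F y * ln y) (ltW x0)).
rewrite (psum_dconv_weight _ _ F (ltW x0)) -psumD; apply: eq_psum => d d0 _ /=.
rewrite -mulrDr; congr (_ * _); rewrite -psumD -psumZ; apply: eq_psum => e e0 _.
rewrite [ln (x / d%:R / e%:R)]ln_divE ?ltr0n// ?divr_gt0 ?ltr0n//; ring.
Qed.

(** At [y = x / d], the factor [ln y] times the bound of [psum_a_shifted] is [O(y ^ (3/4))]. As
    [|mu| <= a] and [a] has linear partial sums, the sum over [d] is [O(x)]. *)
Lemma selberg_shifted : exists C, exists2 K, 0 <= K & forall x, 1 <= x ->
  `|(psi x - x + C) * ln x + psum (fun n => L n * (psi (x / n%:R) - x / n%:R + C)) x| <= K * x.
Proof.
have [C [K K_ge0 H]] := psum_a_shifted; exists C.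
exists ((c + K0) * (64 * K) * 4) => [|x x1].
  by rewrite !mulr_ge0// addr_ge0// ltW.
have x0 : 0 <= x by lra.
rewrite (tatuzawa_iseki (fun y => psi y - y + C))//.
apply: le_trans (norm_psum _ _) _.
apply: (@le_trans _ _ (psum (fun d => a d * (64 * K * root34 (x / d%:R))) x)).
  apply: le_psum => d d0 dx; rewrite normrM ler_pM// ?(mobius_le a1 L_ge0 aL)//.
  have y1 := divn_ge1 d0 dx; move: (x / d%:R) y1 => y y1.
  have l0 : 0 <= ln y by rewrite ln_ge0.
  rewrite normrM (ger0_norm l0).
  apply: le_trans (ler_wpM2l l0 (H _ y1)) _.
  rewrite [64 * K]mulrC -mulrA; have := ler_wpM2l K_ge0 (sqrt_lnsq_le y1).
  apply: le_trans; rewrite mulrCA ler_wpM2l// mulrCA ler_wpM2l ?sqrtr_ge0//.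
  by rewrite expr2 ler_wpM2r//; lra.
rewrite -2!mulrA; apply: le_trans (psum_compare (B := c + K0) _ _ _ _ _) _ => //.
- by move=> n n0; apply: (psum_a_le aA); rewrite ler1n.
- by move=> n n0 nx; rewrite !mulr_ge0 ?root34_ge0.
- by move=> n n0 nx; rewrite ler_wpM2l ?root34_div_decr// mulr_ge0.
rewrite ler_wpM2l ?addr_ge0 ?(ltW c_gt0)//.
by rewrite psumZ -[leRHS]mulrA ler_wpM2l ?mulr_ge0// psum_root34_div.
Qed.

(** The lower bound [k x / n <= psum a (x / n)] is inserted into
    [sum L n psum a (x / n) = sum a n ln n], which is [O(x ln x)]. This half of Mertens' estimate is
    available before any bound on [psi]. *)
Lemma psum_L_div_le : exists2 K, 0 <= K & forall x, 1 <= x ->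
  psum (fun n => L n / n%:R) x <= K * (ln x + 1).
Proof.
have [k k0 Hk] := psum_a_ge a1 a_ge0 c_gt0 aA.
have cK : 0 <= c + K0 by rewrite addr_ge0// ltW.
exists ((c + K0) / k) => [|x x1]; first by rewrite divr_ge0// ltW.
have x0 : 0 < x by lra.
have l0 : 0 <= ln x by rewrite ln_ge0.
have h1 : k * x * psum (fun n => L n / n%:R) x <= psum (fun n => a n * ln n%:R) x.
  rewrite -psum_L_A ?(ltW x0)// -psumZ; apply: le_psum => n n0 nx.
  by rewrite mulrCA -!mulrA ler_wpM2l// Hk// divn_ge1.
have h2 : psum (fun n => a n * ln n%:R) x <= (c + K0) * x * ln x.
  apply: (@le_trans _ _ (psum a x * ln x)); last by rewrite ler_wpM2r// (psum_a_le aA).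
  rewrite -psumZr; apply: le_psum => n n0 nx; rewrite ler_wpM2l// ln_mono// ltr0n//.
have := le_trans h1 h2; rewrite [k * x]mulrC [(c + K0) * x]mulrC -!mulrA ler_pM2l// => h.
rewrite mulrCA ler_pdivlMl// (le_trans h)// ler_wpM2l//; lra.
Qed.

Lemma chebyshev_upper : exists2 B, 0 <= B & forall x, 0 <= x -> psi x <= B * x.
Proof.
have [C [K K_ge0 H]] := selberg_shifted.
have [K5 K5_ge0 H5] := psum_L_div_le.
pose D := `|C|; have D0 : 0 <= D by exact: normr_ge0.
(* Beyond this [X], [ln x - |C| >= (ln x + 1) / 2], and the logarithm can be divided out; up to [X],
   [psi x <= psi X]. *)
pose X := expR (2 * D + 1); have X0 : 0 < X by exact: expR_gt0.
pose B := psi X + 2 * (1 + D + K5 + K).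
have B0 : 0 <= B by rewrite addr_ge0// mulr_ge0// !addr_ge0.
exists B => // x x0; have [x1|x1] := ltP x 1.
  have -> : psi x = 0.
    rewrite /psi /psum; have -> : Num.truncn x = 0%N; last by rewrite big_geq.
    by apply/truncn0Pn; rewrite -ltNge.
  exact: mulr_ge0.
have [xX|xX] := leP x X.
  apply: (@le_trans _ _ (B * 1)); last by rewrite ler_wpM2l.
  rewrite mulr1 (@le_trans _ _ (psi X))//; last first.
    by rewrite lerDl mulr_ge0// !addr_ge0.
  by apply: psum_homo => // n _; exact: L_ge0.
have lx : 2 * D + 1 <= ln x by rewrite -(expRK (2 * D + 1)) ln_mono// ltW.
have /ler_normlW := H _ x1; have := H5 _ x1.
have -> : psum (fun n => L n * (psi (x / n%:R) - x / n%:R + C)) x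
   = psum (fun n => L n * psi (x / n%:R)) x - x * psum (fun n => L n / n%:R) x + C * psi x.
  rewrite -!psumZ -psumB -psumD; apply: eq_psum => n _ _; ring.
have : 0 <= psum (fun n => L n * psi (x / n%:R)) x.
  by apply: psum_ge0 => n _ _; rewrite mulr_ge0.
have /andP[C1 C2] : - D <= C <= D by rewrite -ler_norml.
have p0 : 0 <= psi x := psi_ge0 x.
have pX : 0 <= psi X := psi_ge0 X.
rewrite /B; move: (psi X) pX (psi x) p0 (psum _ _) (psum _ _) (ln x) lx.
move=> q q0 p p0 T S l hl S0 hT h.
have e1 : x * T <= x * (K5 * (l + 1)) by rewrite ler_wpM2l.
have e2 : - D * p <= C * p by rewrite ler_wpM2r.
have e3 : - D * l <= C * l by rewrite ler_wpM2r//; lra.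
have e4 : p * (l - D) <= x * l + D * l + x * (K5 * (l + 1)) + K * x by lra.
have e5 : p * ((l + 1) / 2) <= p * (l - D) by rewrite ler_wpM2l//; lra.
have e6 : x * l + D * l + x * (K5 * (l + 1)) + K * x <= (1 + D + K5 + K) * x * (l + 1).
  have : 0 <= K * x * l by rewrite !mulr_ge0//; lra.
  have : D * l <= D * l * x by rewrite ler_peMr// mulr_ge0//; lra.
  have : 0 <= D * x by rewrite mulr_ge0.
  lra.
have : p * ((l + 1) / 2) <= (1 + D + K5 + K) * x * (l + 1) by lra.
have -> : p * ((l + 1) / 2) = (p / 2) * (l + 1) by ring.
rewrite ler_pM2r; last lra.
have : 0 <= q * x by rewrite mulr_ge0.
lra.
Qed.

Lemma psum_L_compare : exists2 B, 0 <= B & forall (t : nat -> R) x, 0 <= x ->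
  (forall n, (0 < n)%N -> n%:R <= x -> 0 <= t n) ->
  (forall n, (0 < n)%N -> n.+1%:R <= x -> t n.+1 <= t n) ->
  psum (fun n => L n * t n) x <= B * psum t x.
Proof.
have [B B0 H] := chebyshev_upper; exists B => // t x x0 t0 tt.
by apply: psum_compare => // n n0; apply: H.
Qed.

(** [c x sum L n / n] is compared with [sum L n psum a (x / n) = sum a n ln n], which is
    [c x ln x + O(x)]. The difference is at most [K0 sum L n sqrt (x / n)], hence [O(x)] by
    Chebyshev's bound. *)
Lemma mertens : exists2 K, 0 <= K & forall x, 1 <= x ->
  `|psum (fun n => L n / n%:R) x - ln x| <= K.
Proof.
have [B B0 HB] := psum_L_compare.
have [K2 K2_ge0 H2] := psum_a_ln_div c_gt0 aA.
pose K := (2 * K0 * B + 2 * K0 + 2 * K2 + c) / c.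
exists K => [|x x1].
  by rewrite divr_ge0 ?(ltW c_gt0)// !addr_ge0 ?mulr_ge0 ?(ltW c_gt0).
have x0 : 0 < x by lra.
have h1 : `|c * x * psum (fun n => L n / n%:R) x - psum (fun n => L n * psum a (x / n%:R)) x|
    <= 2 * K0 * B * x.
  rewrite -psumZ -psumB; apply: le_trans (norm_psum _ _) _.
  apply: (@le_trans _ _ (psum (fun n => K0 * (L n * Num.sqrt (x / n%:R))) x)).
    apply: le_psum => n n0 nx.
    have -> : c * x * (L n / n%:R) - L n * psum a (x / n%:R)
        = - (L n * (psum a (x / n%:R) - c * (x / n%:R))) by ring.
    rewrite normrN normrM (ger0_norm (L_ge0 _)) [leRHS]mulrCA ler_wpM2l//.
    by rewrite aA// divn_ge1.
  rewrite psumZ; have : psum (fun n => L n * Num.sqrt (x / n%:R)) x <= B * (2 * x).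
    apply: le_trans (HB _ _ (ltW x0) _ _) _.
    - by move=> n _ _; rewrite sqrtr_ge0.
    - by move=> n n0 _; rewrite sqrt_div_decr// ltW.
    by rewrite ler_wpM2l// psum_sqrt_div// ltW.
  move/(ler_wpM2l K0_ge0); lra.
move: h1; rewrite psum_L_A ?(ltW x0)// psum_a_ln//.
have := H2 _ x1; have := aA x1; have l0 : 0 <= ln x by rewrite ln_ge0.
have := sqrt_lnS_le x1; have r1 := sqrt_ge1 x1.
move: (psum _ _) (psum _ _) (psum _ _) (ln x) (Num.sqrt x) l0 r1 => T S A l r l0 r1 rl hA hS hT.
have {}hA : `|l * (A - c * x)| <= 2 * K0 * x.
  rewrite normrM (ger0_norm l0) (le_trans (ler_wpM2l l0 hA))//.
  have := ler_wpM2l K0_ge0 rl; have : 0 <= K0 * r by rewrite mulr_ge0//; lra.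
  lra.
have {}hS : `|S - c * x| <= 2 * K2 * x.
  by rewrite (le_trans hS)// -[leRHS]mulrA [leRHS]mulrCA ler_wpM2l.
have h : `|c * x * (T - l)| <= (2 * K0 * B + 2 * K0 + 2 * K2 + c) * x.
  have -> : c * x * (T - l) = (c * x * T - (l * A - S)) + l * (A - c * x) - (S - c * x) - c * x.
    ring.
  have -> : (2 * K0 * B + 2 * K0 + 2 * K2 + c) * x
      = 2 * K0 * B * x + 2 * K0 * x + 2 * K2 * x + c * x by ring.
  apply: le_trans (ler_normB _ _) _; rewrite lerD//; last by rewrite ger0_norm// mulr_ge0 ?ltW.
  apply: le_trans (ler_normB _ _) _; rewrite lerD//.
  by apply: le_trans (ler_normD _ _) _; rewrite lerD.
have cx : 0 < c * x by rewrite mulr_gt0.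
move: h; rewrite normrM (gtr0_norm cx) => h.
rewrite /K ler_pdivlMr// -(ler_pM2r x0); apply: le_trans h.
by rewrite le_eqVlt; apply/orP; left; apply/eqP; ring.
Qed.

(** The shift contributes [C (ln x + psi x)], which is [O(x)] by Chebyshev's bound. *)
Lemma selberg_remainder : exists2 K, 0 <= K & forall x, 1 <= x ->
  `|(psi x - x) * ln x + psum (fun n => L n * (psi (x / n%:R) - x / n%:R)) x| <= K * x.
Proof.
have [C [K K_ge0 H]] := selberg_shifted; have [B B0 HB] := chebyshev_upper.
exists (K + `|C| * (1 + B)) => [|x x1]; first by rewrite addr_ge0// mulr_ge0// addr_ge0.
have x0 : 0 <= x by lra.
have := H _ x1.
have -> : psum (fun n => L n * (psi (x / n%:R) - x / n%:R + C)) x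
   = psum (fun n => L n * (psi (x / n%:R) - x / n%:R)) x + C * psi x.
  rewrite -!psumZ -psumD; apply: eq_psum => n _ _; ring.
have hp := HB _ x0; have lx : ln x <= x by rewrite ltW// ln_sublinear//; lra.
have l0 : 0 <= ln x by rewrite ln_ge0.
have p0 := psi_ge0 x.
move: (psum _ _) (psi x) hp p0 (ln x) lx l0 => S p hp p0 l lx l0 h.
have -> : (p - x) * l + S = ((p - x + C) * l + (S + C * p)) - C * (l + p) by ring.
apply: le_trans (ler_normB _ _) _; rewrite [leRHS]mulrDl lerD// normrM -mulrA ler_wpM2l//.
rewrite ger0_norm; lra.
Qed.

(** By Mertens' estimate [sum L n (x / n) = x ln x + O(x)], which accounts for one of the two terms
    [x ln x]. *)
Lemma selberg_symmetry : exists2 K, 0 <= K & forall x, 1 <= x ->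
  `|psi x * ln x + psum (fun n => L n * psi (x / n%:R)) x - 2 * x * ln x| <= K * x.
Proof.
have [K K_ge0 H] := selberg_remainder; have [M M0 HM] := mertens.
exists (K + M) => [|x x1]; first exact: addr_ge0.
have x0 : 0 <= x by lra.
have := H _ x1; have := HM _ x1.
have -> : psum (fun n => L n * (psi (x / n%:R) - x / n%:R)) x
   = psum (fun n => L n * psi (x / n%:R)) x - x * psum (fun n => L n / n%:R) x.
  rewrite -!psumZ -psumB; apply: eq_psum => n _ _; ring.
move: (psum _ _) (psum _ _) (psi x) (ln x) => S T p l hT h.
have -> : p * l + S - 2 * x * l = ((p - x) * l + (S - x * T)) + x * (T - l) by ring.
apply: le_trans (ler_normD _ _) _; rewrite [leRHS]mulrDl lerD// normrM (ger0_norm x0).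
by rewrite mulrC ler_wpM2r.
Qed.

End Selberg.

(** * The remainder [psi x - x]: variation, mean and average *)

Section Remainder.
Variable R : realType.
Variable L : nat -> R.
Variables B M K1 K2 : R.
Let psi := psum L.
Let rem (x : R) := psi x - x.
Hypothesis L_ge0 : forall n, 0 <= L n.
Hypothesis psi_le : forall x, 0 <= x -> psi x <= B * x.
Hypothesis mertens_le : forall x, 1 <= x -> `|psum (fun n => L n / n%:R) x - ln x| <= M.
Hypothesis rem_le : forall x, 1 <= x ->
  `|rem x * ln x + psum (fun n => L n * rem (x / n%:R)) x| <= K1 * x.
Hypothesis symm_le : forall x, 1 <= x ->
  `|psi x * ln x + psum (fun n => L n * psi (x / n%:R)) x - 2 * x * ln x| <= K2 * x.
Implicit Types (x y : R) (n m N : nat).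

Let psi_ge0 x : 0 <= psi x.
Proof. by apply: psum_ge0 => n _ _; exact: L_ge0. Qed.

Let psi_homo x y : x <= y -> psi x <= psi y.
Proof. by apply: psum_homo => n _; exact: L_ge0. Qed.

Let M_ge0 : 0 <= M.
Proof. by have := @mertens_le 1 (lexx _); apply: le_trans. Qed.

Let B_ge0 : 0 <= B.
Proof. by have := @psi_le 1 ler01; rewrite mulr1; apply: le_trans. Qed.

Let K1_ge0 : 0 <= K1.
Proof. by have := @rem_le 1 (lexx _); rewrite mulr1; apply: le_trans. Qed.

Let K2_ge0 : 0 <= K2.
Proof. by have := @symm_le 1 (lexx _); rewrite [K2 * 1]mulr1; apply: le_trans. Qed.

(** Selberg's formula at [x] is subtracted from that at [y]; the sum containing [psi] can only grow,
    so [0 <= psi y - psi x <= 2 (y - x) + O(y / ln x)]. Removing [y - x] centres this interval,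
    whence the coefficient 1. *)
Lemma rem_variation : exists2 K, 0 <= K & forall x y, 1 < x -> x <= y -> y <= 2 * x ->
  `|rem y - rem x| <= (y - x) + K * (y / ln x).
Proof.
exists (2 + 2 * K2) => [|x y x1 xy yx]; first by rewrite addr_ge0// mulr_ge0.
have x0 : 0 < x by lra.
have y0 : 0 < y by lra.
have lx : 0 < ln x by rewrite ln_gt0.
have lxy : ln x <= ln y by rewrite ln_mono.
have hp : psi x <= psi y by exact: psi_homo.
have hS : psum (fun n => L n * psi (x / n%:R)) x <= psum (fun n => L n * psi (y / n%:R)) y.
  apply: (@le_trans _ _ (psum (fun n => L n * psi (y / n%:R)) x)).
    by apply: le_psum => n n0 _; rewrite ler_wpM2l// psi_homo// ler_wpM2r.
  by apply: psum_homo => // n n0; rewrite mulr_ge0.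
have hl : y * (ln y - ln x) <= y.
  rewrite ler_piMr ?(ltW y0)// (le_trans (lnB_le x0 y0))// ler_pdivrMr//; lra.
have hx := symm_le (ltW x1); have hy := symm_le (le_trans (ltW x1) xy).
have p0 := psi_ge0 y.
suff : psi y - psi x <= 2 * (y - x) + (2 + 2 * K2) * (y / ln x).
  have : 0 <= (2 + 2 * K2) * (y / ln x).
    by apply: mulr_ge0; [rewrite addr_ge0 ?mulr_ge0|rewrite divr_ge0 ?ltW].
  by rewrite /rem => h0 h; rewrite ler_norml; apply/andP; split; lra.
rewrite mulrA -(ler_pM2r lx) [leRHS]mulrDl divfK ?gt_eqF//.
move: hx hy hS; rewrite !ler_norml => /andP[hx _] /andP[_ hy] hS.
move: (psum _ x) (psum _ y) (psi x) (psi y) hp p0 hS hx hy => S T p q hp q0 hS hx hy.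
have e1 : 0 <= q * (ln y - ln x) by rewrite mulr_ge0// subr_ge0.
have e2 : K2 * x <= K2 * y by rewrite ler_wpM2l.
move: hx hy hl e1 e2; move: (ln x) (ln y) => l l' hx hy hl e1 e2.
lra.
Qed.

Lemma psum_trunc (f : nat -> R) x y : y <= x ->
  (forall n, (0 < n)%N -> y < n%:R -> f n = 0) -> psum f x = psum f y.
Proof.
move=> /le_truncn yx f0; rewrite /psum (@big_cat_nat _ _ _ (Num.truncn y).+1)//=.
rewrite [X in _ + X]big_nat_cond [X in _ + X]big1 ?addr0// => n /andP[/andP[n1 _] _].
apply: f0; first exact: leq_trans n1.
by case: n n1 => // n; rewrite ltnS truncn_le_nat.
Qed.

Lemma psum_initial m y : 0 <= y ->
  `|psum (fun n => (n <= m)%N%:R) y - Num.min m%:R y| <= 1.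
Proof.
move=> y0; have [my|ym] := leP m%:R y.
  rewrite (@psum_trunc _ _ m%:R)//; last first.
    by move=> n _; rewrite ltr_nat ltnNge => /negPf ->.
  have -> : psum (fun n => (n <= m)%N%:R) m%:R = psum (fun=> 1) m%:R :> R.
    by apply: eq_psum => n _; rewrite ler_nat => ->.
  by rewrite psum1// natrK subrr normr0.
have -> : psum (fun n => (n <= m)%N%:R) y = psum (fun=> 1) y :> R.
  apply: eq_psum => n _ ny; have : n%:R <= m%:R :> R by apply: le_trans ny (ltW ym).
  by rewrite ler_nat => ->.
have /andP[] := truncn_itv y0; rewrite psum1// -natr1 => h1 h2.
by rewrite ler_norml; apply/andP; split; lra.
Qed.

(** After exchanging sums, [L k] is counted [min m (x / k)] times up to an error 1, and these errors
    total at most [psi x]. The main sum is [x] times the difference of the Mertens sums at [x] and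
    [x / m], plus [m psi (x / m)]. *)
Lemma sum_psi_div x m : (0 < m)%N -> m%:R <= x ->
  `|\sum_(1 <= n < m.+1) psi (x / n%:R) - x * ln m%:R| <= (2 * B + 2 * M) * x.
Proof.
move=> m0 mx; have m1 : 1 <= m%:R :> R by rewrite ler1n.
have x0 : 0 < x by lra.
have mR : 0 < m%:R :> R by lra.
have xm1 : 1 <= x / m%:R by exact: divn_ge1.
pose g n : R := (n <= m)%N%:R.
have -> : \sum_(1 <= n < m.+1) psi (x / n%:R) = psum (fun k => L k * psum g (x / k%:R)) x.
  rewrite -psum_dconv ?(ltW x0)//.
  transitivity (psum (dconv g L) x); last by apply: eq_psum => n n0 _; rewrite dconvC.
  rewrite psum_dconv ?(ltW x0)// (@psum_trunc _ _ m%:R)//; last first.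
    by move=> n _; rewrite ltr_nat ltnNge /g => /negPf ->; rewrite mul0r.
  rewrite psum_nat big_nat_cond [RHS]big_nat_cond; apply: eq_bigr => n.
  by rewrite ltnS /g => /andP[/andP[_ ->] _]; rewrite mul1r.
pose h k := L k * Num.min m%:R (x / k%:R).
have e1 : `|psum (fun k => L k * psum g (x / k%:R)) x - psum h x| <= B * x.
  rewrite -psumB; apply: le_trans (norm_psum _ _) _; apply: le_trans (psi_le (ltW x0)).
  apply: le_psum => k k0 _; rewrite -mulrBr normrM (ger0_norm (L_ge0 _)).
  by rewrite ler_piMr// psum_initial// divr_ge0// ltW.
have e2 : psum h x = x * psum (fun k => L k / k%:R) x
    - (x * psum (fun k => L k / k%:R) (x / m%:R) - m%:R * psi (x / m%:R)).
  have -> : x * psum (fun k => L k / k%:R) (x / m%:R) - m%:R * psi (x / m%:R)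
      = psum (fun k => L k * (x / k%:R) - h k) x.
    rewrite -!psumZ -psumB [RHS](@psum_trunc _ _ (x / m%:R)).
    - apply: eq_psum => k k0 kx; rewrite /h min_l; first by ring.
      by rewrite ler_pdivlMr ?ltr0n// mulrC -ler_pdivlMr.
    - by rewrite ler_pdivrMr// ler_peMr// ltW.
    move=> k k0 kx; rewrite /h min_r ?subrr//.
    by rewrite ler_pdivrMr ?ltr0n// mulrC -ler_pdivrMr// ltW.
  rewrite -psumZ -psumB; apply: eq_psum => k _ _; ring.
have h1 := mertens_le (le_trans m1 mx); have h2 := mertens_le xm1.
rewrite ln_divE// in h2.
have p0 := psi_ge0 (x / m%:R).
have p1 : m%:R * psi (x / m%:R) <= B * x.
  have := ler_wpM2l (ltW mR) (psi_le (divr_ge0 (ltW x0) (ltW mR))).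
  by rewrite mulrCA [m%:R * (x / _)]mulrC divfK ?gt_eqF.
have p2 : 0 <= m%:R * psi (x / m%:R) by rewrite mulr_ge0// ltW.
rewrite e2 in e1; move: e1 h1 h2 p1 p2.
move: (m%:R * psi _) (psum _ _) (psum _ _) (psum _ _) => q T S P e1 h1 h2 p1 p2.
move: e1 h1 h2; rewrite !ler_norml => /andP[e1 e1'] /andP[h1 h1'] /andP[h2 h2'].
have f1 := ler_wpM2l (ltW x0) h1; have f2 := ler_wpM2l (ltW x0) h1'.
have f3 := ler_wpM2l (ltW x0) h2; have f4 := ler_wpM2l (ltW x0) h2'.
by apply/andP; split; lra.
Qed.

(** The terms [x ln m] of [sum_psi_div] and of the harmonic sum cancel. *)
Lemma sum_rem_div : exists2 K, 0 <= K & forall x m, (0 < m)%N -> m%:R <= x ->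
  `|\sum_(1 <= n < m.+1) rem (x / n%:R)| <= K * x.
Proof.
exists (2 * B + 2 * M + 1) => [|x m m0 mx].
  by rewrite !addr_ge0// mulr_ge0.
have m1 : 1 <= m%:R :> R by rewrite ler1n.
have x0 : 0 < x by lra.
have h1 := sum_psi_div m0 mx; have [h2 h3] := harmonic_bounds m1.
have -> : \sum_(1 <= n < m.+1) rem (x / n%:R)
    = \sum_(1 <= n < m.+1) psi (x / n%:R) - x * psum (fun n => n%:R^-1) m%:R.
  by rewrite psum_nat mulr_sumr -sumrB.
have f1 := ler_wpM2l (ltW x0) h2; have f2 := ler_wpM2l (ltW x0) h3.
move: h1; rewrite !ler_norml => /andP[h1 h1'].
by apply/andP; split; lra.
Qed.

(** The analogue of Selberg's [Lambda_2]; it appears when the remainder formula is applied twice. *)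
Let L2 n := L n * ln n%:R + dconv L L n.

(** With [E] the left side of the remainder formula, [ln x E x - sum L m E (x / m)] has no cross
    terms: it is [rem x ln^2 x] plus the sum of [rem (x / n)] with weights [L ln - L * L]. Absolute
    values turn this difference into the sum [L2]. *)
Lemma rem_ln2_le : exists2 K, 0 <= K & forall x, 1 <= x ->
  `|rem x| * ln x ^+ 2 <= psum (fun n => L2 n * `|rem (x / n%:R)|) x + K * (x * (ln x + 1)).
Proof.
exists (2 * K1 + K1 * M) => [|x x1]; first by rewrite addr_ge0// mulr_ge0.
have x0 : 0 < x by lra.
have l0 : 0 <= ln x by rewrite ln_ge0.
pose E y := rem y * ln y + psum (fun n => L n * rem (y / n%:R)) y.
have id : rem x * ln x ^+ 2 = ln x * E x - psum (fun m => L m * E (x / m%:R)) x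
    - psum (fun n => L n * ln n%:R * rem (x / n%:R)) x
    + psum (fun n => dconv L L n * rem (x / n%:R)) x.
  rewrite (psum_dconv_weight _ _ rem (ltW x0)).
  have -> : psum (fun m => L m * E (x / m%:R)) x
     = ln x * psum (fun n => L n * rem (x / n%:R)) x
       - psum (fun n => L n * ln n%:R * rem (x / n%:R)) x
       + psum (fun d => L d * psum (fun e => L e * rem (x / d%:R / e%:R)) (x / d%:R)) x.
    rewrite -psumZ -psumB -psumD; apply: eq_psum => m m0 mx; rewrite /E.
    by rewrite [ln (x / _)]ln_divE ?ltr0n//; ring.
  by rewrite /E; ring.
have h1 : `|ln x * E x| <= K1 * x * ln x.
  by rewrite normrM (ger0_norm l0) mulrC ler_wpM2r// rem_le.
have h2 : `|psum (fun m => L m * E (x / m%:R)) x| <= K1 * (x * (ln x + M)).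
  apply: le_trans (norm_psum _ _) _.
  apply: (@le_trans _ _ (psum (fun m => K1 * x * (L m / m%:R)) x)).
    apply: le_psum => m m0 mx; rewrite normrM (ger0_norm (L_ge0 _)).
    have := ler_wpM2l (L_ge0 m) (rem_le (divn_ge1 m0 mx)).
    by move/le_trans; apply; rewrite le_eqVlt; apply/orP; left; apply/eqP; ring.
  rewrite psumZ -mulrA ler_wpM2l// ler_wpM2l ?(ltW x0)//.
  by have := mertens_le x1; rewrite ler_norml => /andP[_]; lra.
have h3 : psum (fun n => L2 n * `|rem (x / n%:R)|) x
   = psum (fun n => `|L n * ln n%:R * rem (x / n%:R)|) x
     + psum (fun n => `|dconv L L n * rem (x / n%:R)|) x.
  rewrite -psumD; apply: eq_psum => n n0 _; rewrite /L2 !normrM (ger0_norm (L_ge0 _)).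
  by rewrite (ger0_norm (ln_nat_ge0 _ _)) (ger0_norm (dconv_ge0 _ _ _))//; ring.
have -> : `|rem x| * ln x ^+ 2 = `|rem x * ln x ^+ 2|.
  by rewrite normrM (ger0_norm (sqr_ge0 _)).
rewrite id h3.
apply: le_trans (ler_normD _ _) _; apply: le_trans (lerD (ler_normB _ _) (norm_psum _ _)) _.
apply: le_trans (lerD (lerD (ler_normB _ _) (norm_psum _ _)) (lexx _)) _.
have e1 : 0 <= K1 * M * (x * ln x) by rewrite !mulr_ge0// ltW.
have e2 : 0 <= K1 * x by rewrite mulr_ge0// ltW.
lra.
Qed.

(** Selberg's formula, with [psi x ln x] replaced by [sum L n ln n] at the cost of
    [sum L n ln (x / n)], which is [O(x)]. *)
Lemma psum_L2 : exists2 K, 0 <= K & forall x, 1 <= x ->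
  `|psum L2 x - 2 * x * ln x| <= K * x.
Proof.
exists (K2 + B) => [|x x1]; first exact: addr_ge0.
have x0 : 0 < x by lra.
have -> : psum L2 x = psi x * ln x + psum (fun n => L n * psi (x / n%:R)) x
    - psum (fun n => L n * ln (x / n%:R)) x.
  rewrite psumD psum_dconv ?(ltW x0)// addrAC; congr (_ + _).
  rewrite -psumZr -psumB; apply: eq_psum => n n0 _.
  by rewrite ln_divE ?ltr0n//; ring.
have h1 : 0 <= psum (fun n => L n * ln (x / n%:R)) x.
  by apply: psum_ge0 => n n0 nx; rewrite mulr_ge0// ln_ge0// divn_ge1.
have h2 : psum (fun n => L n * ln (x / n%:R)) x <= B * x.
  apply: le_trans (psum_compare (B := B) _ _ _ _ _) _ => //.
  - exact: ltW.
  - by move=> n n0; exact: psi_le.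
  - by move=> n n0 nx; rewrite ln_ge0// divn_ge1.
  - by move=> n n0 _; rewrite ln_div_decr.
  by rewrite ler_wpM2l//; have [] := psum_ln_div x1.
have := symm_le x1; rewrite !ler_norml => /andP[h3 h4].
by apply/andP; split; lra.
Qed.

Lemma psum_L2_ln : exists2 K, 0 <= K & forall n, (0 < n)%N ->
  `|psum (fun n => L2 n - 2 * ln n%:R) n%:R| <= K * n%:R.
Proof.
have [K K_ge0 H] := psum_L2; exists (K + 2) => [|n n0]; first by rewrite addr_ge0.
have n1 : 1 <= n%:R :> R by rewrite ler1n.
have := H _ n1; rewrite psumB psumZ; have [h1 h2] := sum_ln_bounds R n0.
rewrite [psum (fun n => ln _) _]psum_nat; have := @ln_le_subr1 R n%:R.
rewrite ltr0n => /(_ n0).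
by rewrite !ler_norml => hl /andP[h3 h4]; apply/andP; split; lra.
Qed.

(** The weights [L2 n] of [rem_ln2_le] and [2 ln n] have partial sums that differ by [O(n)], so Abel
    summation exchanges them. *)
Lemma rem_average : exists2 K, 0 <= K & forall x, 1 <= x ->
  `|rem x| * ln x ^+ 2
    <= 2 * psum (fun n => ln n%:R * `|rem (x / n%:R)|) x + K * (x * (ln x + 1)).
Proof.
have [K K_ge0 H] := rem_ln2_le; have [K' K'_ge0 H'] := psum_L2_ln.
exists (K + K' * (B + 1)) => [|x x1].
  by rewrite addr_ge0// mulr_ge0// addr_ge0.
have x0 : 0 < x by lra.
(* [|rem (x / n)|] is not monotone in [n], but [psi] and the identity increase, so its variation is
   at most the decrease of [t n]. *)
pose t n := psi (x / n%:R) + x / n%:R.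
have h : `|psum (fun n => (L2 n - 2 * ln n%:R) * `|rem (x / n%:R)|) x|
    <= psum (fun n => K' * t n) x.
  apply: abel_psum_le => [|n n0 nx|n n0 nx|n n0 nx]; first exact: ltW.
  - apply: le_trans (H' _ n0) _.
    have -> : psum (fun=> K') n%:R = K' * psum (fun=> 1) n%:R.
      by rewrite -psumZ; apply: eq_psum => *; rewrite mulr1.
    by rewrite psum1// natrK.
  - apply: le_trans (ler_dist_dist _ _) _; rewrite /rem /t.
    have d : x / n.+1%:R <= x / n%:R.
      by rewrite ler_pM2l// lef_pV2 ?posrE ?ltr0n// ler_nat.
    have := psi_homo d; move: (x / n%:R) (x / n.+1%:R) d => u v.
    move: (psi u) (psi v) => p q uv pq.
    by rewrite ler_norml; apply/andP; split; lra.
  rewrite normr_id /rem /t; have y1 := divn_ge1 n0 nx; have := psi_ge0 (x / n%:R).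
  by move=> p0; rewrite ler_norml; apply/andP; split; lra.
have ht : psum (fun n => K' * t n) x <= K' * (B + 1) * (x * (ln x + 1)).
  have [_ hh] := harmonic_bounds x1.
  rewrite psumZ -[leRHS]mulrA ler_wpM2l//.
  apply: (@le_trans _ _ (psum (fun n => (B + 1) * x * n%:R^-1) x)).
    apply: le_psum => n n0 nx; rewrite /t mulrDl mul1r mulrDl lerD//.
    by rewrite -mulrA psi_le// divr_ge0// ltW.
  rewrite psumZ -mulrA ler_wpM2l ?addr_ge0// ler_wpM2l// ltW//.
apply: le_trans (H _ x1) _; rewrite [(K + _) * _]mulrDl [K * _ + _]addrC addrA lerD2r.
have -> : psum (fun n => L2 n * `|rem (x / n%:R)|) x =
  psum (fun n => (L2 n - 2 * ln n%:R) * `|rem (x / n%:R)|) x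
  + 2 * psum (fun n => ln n%:R * `|rem (x / n%:R)|) x.
  by rewrite -psumZ -psumD; apply: eq_psum => n _ _; ring.
rewrite [leLHS]addrC lerD2l.
exact: le_trans (ler_norm _) (le_trans h ht).
Qed.

End Remainder.

(** * From Selberg's formula to an asymptotic *)

Section Tauberian.
Variable R : realType.
Variable r : R -> R.
Variables B K M V : R.
Hypothesis r_le : forall x, 1 <= x -> `|r x| <= B * x.
Hypothesis r_average : forall x, 1 <= x ->
  `|r x| * ln x ^+ 2
    <= 2 * psum (fun n => ln n%:R * `|r (x / n%:R)|) x + K * (x * (ln x + 1)).
Hypothesis r_sum : forall x m, (0 < m)%N -> m%:R <= x ->
  `|\sum_(1 <= n < m.+1) r (x / n%:R)| <= M * x.
Hypothesis r_variation : forall x y, 1 < x -> x <= y -> y <= 2 * x ->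
  `|r y - r x| <= (y - x) + V * (y / ln x).
Implicit Types (x y : R) (n m k : nat).

Let B_ge0 : 0 <= B.
Proof. by have := @r_le 1 (lexx _); rewrite mulr1; apply: le_trans. Qed.

Let M_ge0 : 0 <= M.
Proof. by have := @r_sum 1 1 isT (lexx _); rewrite mulr1; apply: le_trans. Qed.

Lemma sum_inv_le m n : (0 < m)%N -> (m <= n)%N ->
  \sum_(m.+1 <= k < n.+1) k%:R^-1 <= ln n%:R - ln m%:R :> R.
Proof.
move=> m0; elim: n => [|n IH]; first by rewrite leqn0 => /eqP mn; rewrite mn in m0.
rewrite leq_eqVlt => /predU1P[->|mn]; first by rewrite big_geq// subrr.
rewrite ltnS in mn; rewrite big_nat_recr//=.
have [h _] := lnS_bounds R (leq_trans m0 mn).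
by move: h (IH mn); move: (n.+1%:R^-1) => q; lra.
Qed.

Lemma sum_inv_ge m n : (m <= n)%N ->
  ln n.+1%:R - ln m.+1%:R <= \sum_(m.+1 <= k < n.+1) k%:R^-1 :> R.
Proof.
elim: n => [|n IH]; first by rewrite leqn0 => /eqP ->; rewrite big_geq// subrr.
rewrite leq_eqVlt => /predU1P[->|mn]; first by rewrite big_geq// subrr.
rewrite big_nat_recr//=; have [_ h] := lnS_bounds R (ltn0Sn n).
by move: h (IH mn); move: (n.+1%:R^-1) => q; lra.
Qed.

Let rev_mono x m n : 0 <= x -> (0 < m)%N -> (m <= n)%N -> x / n%:R <= x / m%:R.
Proof.
move=> x0 m0 mn; rewrite ler_wpM2l// lef_pV2 ?posrE ?ltr0n ?ler_nat//.
exact: leq_trans mn.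
Qed.

(** With a constant sign the sum of absolute values is the absolute value of a sum, itself the
    difference of two sums bounded by [r_sum]. *)
Lemma block_constant_sign x m p : 0 < x -> (m < p)%N -> p%:R <= x -> (0 < m)%N ->
  (forall n, (m < n)%N -> (n < p)%N -> 0 < r (x / n%:R) * r (x / n.+1%:R)) ->
  \sum_(m.+1 <= n < p.+1) `|r (x / n%:R)| <= 2 * M * x.
Proof.
move=> x0 mp px m0 same; pose s := Num.sg (r (x / m.+1%:R)).
have sE n : (m < n)%N -> (n <= p)%N -> `|r (x / n%:R)| = s * r (x / n%:R).
  elim: n => // n IH; rewrite ltnS leq_eqVlt => /predU1P[<- _|mn np].
    by rewrite -normrEsg.
  have := IH mn (ltnW np); have := same n mn np.
  move: (r (x / n%:R)) (r (x / n.+1%:R)) => u v uv us.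
  have u0 : u != 0 by apply/eqP => u0; move: uv; rewrite u0 mul0r ltxx.
  have -> : s = Num.sg u.
    by apply: (mulIf u0); rewrite -us normrEsg.
  have [v0|v0|v0] := ltrgt0P v.
  - by rewrite gtr0_sg ?mul1r//; move: uv; rewrite pmulr_lgt0.
  - by rewrite ltr0_sg ?mulN1r//; move: uv; rewrite nmulr_lgt0.
  - by rewrite v0 mulr0.
have -> : \sum_(m.+1 <= n < p.+1) `|r (x / n%:R)| = s * \sum_(m.+1 <= n < p.+1) r (x / n%:R).
  rewrite mulr_sumr big_nat_cond [RHS]big_nat_cond.
  by apply: eq_bigr => n /andP[/andP[mn np] _]; exact: sE.
have -> : \sum_(m.+1 <= n < p.+1) r (x / n%:R)
    = \sum_(1 <= n < p.+1) r (x / n%:R) - \sum_(1 <= n < m.+1) r (x / n%:R).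
  rewrite (@big_cat_nat _ _ _ m.+1 1 p.+1)//=; last by rewrite ltnS ltnW.
  by rewrite addrAC subrr add0r.
have hp := r_sum (leq_trans m0 (ltnW mp)) px.
have mx : m%:R <= x by apply: le_trans px; rewrite ler_nat ltnW.
have hm := r_sum m0 mx.
apply: le_trans (ler_norm _) _; rewrite normrM.
apply: (@le_trans _ _ (1 * (2 * M * x))); last by rewrite mul1r.
apply: ler_pM => //; first by rewrite normr_sg lern1; case: (_ == _).
apply: le_trans (ler_normB _ _) _; lra.
Qed.

(** The stretch from [n - j] to [n] carries at least [(j + 1) / n] of the harmonic sum, and there
    the factor [e] is halved. *)
Lemma block_sign_change x m p n e j : 0 < x -> (0 < m)%N -> (m < n - j)%N -> (n < p)%N ->
  0 <= e ->
  (forall k, (m < k)%N -> (k <= p)%N -> `|r (x / k%:R)| <= e * (x / k%:R)) ->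
  (forall k, (n - j <= k)%N -> (k <= n)%N -> `|r (x / k%:R)| <= e / 2 * (x / k%:R)) ->
  \sum_(m.+1 <= k < p.+1) `|r (x / k%:R)|
   <= e * x * \sum_(m.+1 <= k < p.+1) k%:R^-1 - e / 2 * x * ((j.+1)%:R / n%:R).
Proof.
move=> x0 m0 mnj np e0 He Hh.
have jn : (j < n)%N by rewrite -subn_gt0 (leq_trans _ mnj).
have n0 : (0 < n)%N by exact: leq_trans jn.
pose a := (n - j)%N.
have an : (a <= n)%N by rewrite leq_subr.
rewrite (@big_cat_nat _ _ _ a m.+1 p.+1)//=; last first.
  by rewrite ltnW// ltnS (leq_trans an)// ltnW.
rewrite (@big_cat_nat _ _ _ n.+1 a p.+1)//=; last 2 first.
- by rewrite ltnW.
- by rewrite ltnS ltnW.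
rewrite [in leRHS](@big_cat_nat _ _ _ a m.+1 p.+1)//=; last first.
  by rewrite ltnW// ltnS (leq_trans an)// ltnW.
rewrite [in leRHS](@big_cat_nat _ _ _ n.+1 a p.+1)//=; last 2 first.
- by rewrite ltnW.
- by rewrite ltnS ltnW.
have H1 : \sum_(m.+1 <= k < a) `|r (x / k%:R)| <= e * x * \sum_(m.+1 <= k < a) k%:R^-1.
  rewrite mulr_sumr big_nat_cond [leRHS]big_nat_cond; apply: ler_sum => k.
  move=> /andP[/andP[mk ka] _]; rewrite -mulrA He//.
  by rewrite (leq_trans (ltnW ka))// (leq_trans an)// ltnW.
have H3 : \sum_(n.+1 <= k < p.+1) `|r (x / k%:R)| <= e * x * \sum_(n.+1 <= k < p.+1) k%:R^-1.
  rewrite mulr_sumr big_nat_cond [leRHS]big_nat_cond; apply: ler_sum => k.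
  move=> /andP[/andP[mk ka] _]; rewrite -mulrA He//.
  by rewrite (leq_trans _ mk)// ltnS (leq_trans _ an)// ltnW.
have H2 : \sum_(a <= k < n.+1) `|r (x / k%:R)| <= e / 2 * x * \sum_(a <= k < n.+1) k%:R^-1.
  rewrite mulr_sumr big_nat_cond [leRHS]big_nat_cond; apply: ler_sum => k.
  by move=> /andP[/andP[mk ka] _]; rewrite -mulrA Hh.
have H4 : (j.+1)%:R / n%:R <= \sum_(a <= k < n.+1) k%:R^-1 :> R.
  have -> : (j.+1)%:R / n%:R = \sum_(a <= k < n.+1) n%:R^-1 :> R.
    rewrite big_const_nat iter_addr_0 /a subSn ?leq_subr// subKn 1?ltnW//.
    by rewrite mulr_natl.
  rewrite big_nat_cond [leRHS]big_nat_cond; apply: ler_sum => k.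
  move=> /andP[/andP[ak kn] _].
  have k0 : (0 < k)%N by rewrite (leq_trans _ ak)// (leq_trans _ mnj).
  by rewrite lef_pV2 ?posrE ?ltr0n// ler_nat -ltnS.
have ex : 0 <= e / 2 * x by rewrite mulr_ge0 ?divr_ge0// ltW.
have := ler_wpM2l ex H4; lra.
Qed.

(** The sign change makes [|r (x / n)|] at most the jump from [x / (n + 1)] to [x / n], and
    [r_variation] carries this bound to [x / k]. The errors are [al / 16] from [1 / (n + 1)],
    [al / 16] from each of two terms in [V], and [al / 4] from the distance between [n] and [k]:
    [7 al / 16] in all. *)
Lemma near_sign_change al x n k : 0 < al -> 0 < x -> (0 < n)%N -> (k <= n)%N -> (0 < k)%N ->
  1 < x / n.+1%:R -> 16 / al <= n%:R -> 16 * V / al <= ln (x / n.+1%:R) ->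
  (n - k)%:R <= al / 4 * n%:R -> (n <= 2 * k)%N ->
  r (x / n%:R) * r (x / n.+1%:R) <= 0 ->
  `|r (x / k%:R)| <= al / 2 * (x / k%:R).
Proof.
move=> al0 x0 n0 kn k0 y1 n16 V16 nk nk2 rr.
set y := x / n.+1%:R in y1 V16 rr.
have y0 : 0 < y by lra.
have nR : 0 < n%:R :> R by rewrite ltr0n.
have kR : 0 < k%:R :> R by rewrite ltr0n.
have yz : y <= x / n%:R by apply: rev_mono => //; exact: ltW.
have zw : x / n%:R <= x / k%:R by apply: rev_mono => //; exact: ltW.
have zy : x / n%:R - y = x / n%:R / n.+1%:R.
  by rewrite /y -natr1; field; apply/andP; split; lra.
have wz : x / k%:R - x / n%:R = x / k%:R * ((n - k)%:R / n%:R).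
  by rewrite natrB//; field; apply/andP; split; lra.
have z2y : x / n%:R <= 2 * y.
  rewrite -subr_ge0 (_ : _ - _ = y - (x / n%:R - y)); last by ring.
  rewrite zy subr_ge0 /y ler_pM2r ?invr_gt0//.
  by rewrite ler_pdivrMr// ler_peMr ?ler1n// ltW.
have w2z : x / k%:R <= 2 * (x / n%:R).
  rewrite mulrCA ler_pM2l// ler_pdivlMr// mulrC ler_pdivrMr//.
  by rewrite -natrM ler_nat.
have h1 := r_variation y1 yz z2y.
have h2 := r_variation (lt_le_trans y1 yz) zw w2z.
have ly : 0 < ln y by rewrite ln_gt0.
have lyz : ln y <= ln (x / n%:R) by rewrite ln_mono.
have vy : V / ln y <= al / 16.
  rewrite ler_pdivrMr//; move: V16; rewrite ler_pdivrMr//; lra.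
have vz : V / ln (x / n%:R) <= al / 16.
  rewrite ler_pdivrMr; last by rewrite (lt_le_trans ly).
  by move: V16; rewrite ler_pdivrMr//; nra.
have n1 : n.+1%:R^-1 <= al / 16.
  rewrite -[al / 16]invrK lef_pV2 ?posrE ?invr_gt0 ?divr_gt0// invf_div.
  by rewrite (le_trans n16)// ler_nat.
have nkn : (n - k)%:R / n%:R <= al / 4 by rewrite ler_pdivrMr.
have rz : `|r (x / n%:R)| <= `|r (x / n%:R) - r y|.
  move: rr; move: (r _) (r y) => u v uv.
  have [u0|u0] := lerP 0 u; have [v0|v0] := lerP 0 v.
  - have [->|u1] := eqVneq u 0; first by rewrite normr0.
    have -> : v = 0 by nra.
    by rewrite subr0.
  - by rewrite !ger0_norm; lra.
  - by rewrite !ltr0_norm; lra.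
  - exfalso; nra.
have z0 : 0 < x / n%:R by rewrite divr_gt0.
have w0 : 0 < x / k%:R by rewrite divr_gt0.
move: h1 h2; rewrite zy wz; move: rz zw vy vz n1 nkn z0 w0.
set z := x / n%:R; set w := x / k%:R => rz zw vy vz n1 nkn z0 w0 h1 h2.
have e1 : V * (z / ln y) <= al / 16 * z by rewrite mulrCA mulrC ler_pM2r.
have e2 : V * (w / ln z) <= al / 16 * w by rewrite mulrCA mulrC ler_pM2r.
have e3 : z / n.+1%:R <= al / 16 * z by rewrite mulrC ler_pM2r.
have e4 : w * ((n - k)%:R / n%:R) <= al / 4 * w by rewrite mulrC ler_pM2r.
have e5 : `|r w| <= `|r z| + `|r w - r z|.
  by rewrite -{1}[r w](subrK (r z)) addrC; exact: ler_normD.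
have e6 : al * z <= al * w by rewrite ler_pM2l.
have e7 : 0 <= al * w by rewrite mulr_ge0 ?ltW.
move: e3 h1; move: (n.+1%:R^-1) => q e3 h1.
lra.
Qed.

(** [l], [n0], [d] and [X1] depend on [e] only through its lower bound [al]; this uniformity lets
    [improve_bound] choose [e] above [al] by a margin fixed by [d]. *)
Lemma block_bound al : 0 < al -> exists l n0 : nat, exists d X1 : R,
  [/\ (1 < l)%N, (0 < n0)%N, 0 < d < 1, 1 < X1 &
  forall e x m, al <= e -> 0 < x -> (n0 <= m)%N -> X1 <= x / (l * m)%:R ->
   (forall y, x / (l * m)%:R <= y -> `|r y| <= e * y) ->
   \sum_(m.+1 <= k < (l * m).+1) `|r (x / k%:R)|
     <= (1 - d) * e * x * \sum_(m.+1 <= k < (l * m).+1) k%:R^-1].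
Proof.
move=> al0.
(* [ln l >= 4 + 4 M / al] makes [e + 2 M], which comes from the case of constant sign, at most half
   of [e (ln l - 1)]; the harmonic sum of the block is at least [ln l - 1]. *)
pose u := expR (4 + 4 * M / al); pose l := (Num.truncn u).+4.
(* The relative length of the stretch ending at a sign change: [al / 4] is what [near_sign_change]
   allows, and [1 / 2] keeps the stretch beyond [m]. *)
pose eta := Num.min (al / 4) (1 / 2) : R.
have eta0 : 0 < eta by rewrite /eta lt_min divr_gt0//=; lra.
have l4 : (3 < l)%N by [].
have lR : 1 <= l%:R :> R by rewrite ler1n.
have ul : 4 + 4 * M / al <= ln l%:R.
  rewrite -(expRK (4 + _)) ln_mono ?expR_gt0//.
  by apply: le_trans (ltW (truncnS_gt _)) _; rewrite ler_nat /l; move: (Num.truncn _) => t; lia.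
have ll0 : 0 < ln l%:R :> R.
  by apply: lt_le_trans ul; rewrite ltr_wpDr// divr_ge0 ?mulr_ge0// ltW.
(* [1 / 2] is the saving with a constant sign; with a sign change the saving [eta / 2] is spread
   over a harmonic sum of at most [ln l]. *)
pose d := Num.min (1 / 2) (eta / (2 * ln l%:R)) : R.
have d0 : 0 < d by rewrite /d lt_min; apply/andP; split; [lra|rewrite divr_gt0// mulr_gt0].
have d12 : d <= 1 / 2 by rewrite /d ge_min lexx.
have dl : d * ln l%:R <= eta / 2.
  have : d <= eta / (2 * ln l%:R) by rewrite /d ge_min lexx orbT.
  by rewrite ler_pdivlMr ?mulr_gt0//; lra.
pose n0 := (Num.truncn (16 / al)).+1.
exists l, n0, d, (expR (1 + 16 * `|V| / al)); split=> //.
- by rewrite d0 /=; lra.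
- by rewrite expR_gt1 ltr_pwDl// divr_ge0 ?mulr_ge0// ltW.
move=> e x m ale x0 nm Xx He.
have m0 : (0 < m)%N by exact: leq_trans nm.
have e0 : 0 < e by lra.
pose p := (l * m)%N.
have mp : (2 * m < p)%N by rewrite ltn_pmul2r// (ltn_trans _ l4).
have mp1 : (m <= p)%N by rewrite leq_pmull.
have pR : 0 < p%:R :> R by rewrite ltr0n (leq_trans m0).
have xp1 : 1 < x / p%:R.
  apply: lt_le_trans Xx.
  by rewrite expR_gt1 ltr_pwDl// divr_ge0 ?mulr_ge0// ltW.
have px : p%:R <= x by move: xp1; rewrite ltr_pdivlMr// mul1r => /ltW.
have Hk k : (0 < k)%N -> (k <= p)%N -> `|r (x / k%:R)| <= e * (x / k%:R).
  by move=> k0 kp; apply: He; apply: rev_mono => //; exact: ltW.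
have mR : 0 < m%:R :> R by rewrite ltr0n.
have s_le : \sum_(m.+1 <= k < p.+1) k%:R^-1 <= ln l%:R :> R.
  apply: le_trans (sum_inv_le m0 mp1) _; rewrite /p natrM ln_mulE ?ltr0n//; lra.
(* Sign changes are sought beyond [2 m] only, so that the stretch from [n - j] to [n], with
   [2 j <= n], stays beyond [m]. If there is none, the terms up to [2 m] cost at most [e x]. *)
have [[n [mn np rr]]|no] := EM (exists n, [/\ (2 * m < n)%N, (n < p)%N &
    r (x / n%:R) * r (x / n.+1%:R) <= 0]).
- have n_gt0 : (0 < n)%N by exact: leq_trans mn.
  have nR : 0 < n%:R :> R by rewrite ltr0n.
  pose j := Num.truncn (eta * n%:R).
  have en0 : 0 <= eta * n%:R by rewrite mulr_ge0// ltW.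
  have /andP[j1 j2] := truncn_itv en0.
  have j2n : (2 * j <= n)%N.
    rewrite -(ler_nat R) natrM; have : eta <= 1 / 2 by rewrite /eta ge_min lexx orbT.
    move: j1; rewrite -/j => j1 h; have := ler_wpM2r (ltW nR) h; lra.
  have mnj : (m < n - j)%N by move: mn j2n; clear; lia.
  have := @block_sign_change x m p n e j x0 m0 mnj np (ltW e0).
  have h1 k : (m < k)%N -> (k <= p)%N -> `|r (x / k%:R)| <= e * (x / k%:R).
    by move=> mk; apply: Hk; exact: leq_trans mk.
  have h2 k : (n - j <= k)%N -> (k <= n)%N -> `|r (x / k%:R)| <= e / 2 * (x / k%:R).
    move=> jk kn; have k0 : (0 < k)%N by move: mnj jk; clear; lia.
    apply: (@le_trans _ _ (al / 2 * (x / k%:R))); last first.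
      by rewrite ler_wpM2r ?divr_ge0// ?(ltW x0)//; lra.
    have yp : x / p%:R <= x / n.+1%:R by apply: rev_mono => //; exact: ltW.
    apply: (@near_sign_change al x n k) => //.
    - exact: lt_le_trans yp.
    - have h : 16 / al < n0%:R by rewrite /n0 truncnS_gt.
      by rewrite (le_trans (ltW h))// ler_nat; move: mn nm; clear; lia.
    - apply: (@le_trans _ _ (ln (expR (1 + 16 * `|V| / al)))).
        rewrite expRK; apply: (@le_trans _ _ (16 * `|V| / al)); last by lra.
        by rewrite ler_pM2r ?invr_gt0// ler_pM2l// ler_norm.
      by rewrite ln_mono ?expR_gt0// (le_trans Xx).
    - apply: (@le_trans _ _ j%:R); first by rewrite ler_nat; move: jk; clear; lia.
      rewrite (le_trans j1)// ler_wpM2r ?(ltW nR)//.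
      by rewrite /eta ge_min lexx.
    - by move: jk j2n; clear; lia.
  move/(_ h1 h2)/le_trans; apply.
  have : eta <= j.+1%:R / n%:R by rewrite ler_pdivlMr// ltW.
  have ex : 0 < e * x by rewrite mulr_gt0.
  have d_s : d * \sum_(m.+1 <= k < p.+1) k%:R^-1 <= eta / 2.
    by apply: le_trans dl; rewrite ler_pM2l.
  move: d_s; rewrite -/p; move: (\sum_(_ <= _ < _) _) (j.+1%:R / _) => s q ds eq.
  have := ler_wpM2l (ltW ex) ds; have := ler_wpM2l (ltW ex) eq; lra.
have same n : (2 * m < n)%N -> (n < p)%N -> 0 < r (x / n%:R) * r (x / n.+1%:R).
  by move=> mn np; rewrite ltNge; apply/negP => h; apply: no; exists n.
have m20 : (0 < 2 * m)%N by rewrite muln_gt0.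
have c1 := block_constant_sign x0 mp px m20 same.
have m2 : (m <= 2 * m)%N by rewrite leq_pmull.
rewrite -/p (@big_cat_nat _ _ _ (2 * m).+1)//=; last by rewrite ltnS ltnW.
have c2 : \sum_(m.+1 <= k < (2 * m).+1) `|r (x / k%:R)| <= e * x.
  apply: (@le_trans _ _ (e * x * \sum_(m.+1 <= k < (2 * m).+1) k%:R^-1)).
    rewrite mulr_sumr big_nat_cond [leRHS]big_nat_cond; apply: ler_sum => k.
    move=> /andP[/andP[mk km] _]; rewrite -mulrA; apply: Hk; first exact: leq_trans mk.
    by rewrite -ltnS (leq_trans km)// ltnS ltnW.
  rewrite ler_piMr ?mulr_ge0 ?(ltW e0) ?(ltW x0)//.
  apply: le_trans (sum_inv_le m0 m2) _; rewrite natrM ln_mulE ?ltr0n//.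
  have := @ln_le_subr1 R 2; rewrite ltr0n => /(_ isT); lra.
have c3 : ln l%:R - 1 <= \sum_(m.+1 <= k < p.+1) k%:R^-1 :> R.
  apply: le_trans (sum_inv_ge mp1).
  have h : ln m.+1%:R <= 1 + ln m%:R :> R.
    have [_] := lnS_bounds R m0; have : m%:R^-1 <= 1 :> R by rewrite invf_le1// ler1n.
    lra.
  have : ln p%:R <= ln p.+1%:R :> R by rewrite ln_mono// ler_nat.
  by rewrite /p natrM ln_mulE ?ltr0n//; lra.
move: c3; set s := \sum_(m.+1 <= k < p.+1) k%:R^-1 => c3.
have hM : M * 4 <= al * (ln l%:R - 4).
  have : 4 * M / al <= ln l%:R - 4 by lra.
  by rewrite ler_pdivrMr//; lra.
apply: le_trans (lerD c2 c1) _.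
have f1 : M * 4 <= e * (ln l%:R - 4).
  apply: le_trans hM _; rewrite ler_wpM2r//.
  have : 0 <= 4 * M / al by rewrite divr_ge0 ?mulr_ge0// ltW.
  lra.
have f2 : e * (ln l%:R - 1) <= e * s by rewrite ler_pM2l.
have f3 : e + 2 * M <= e * s / 2 by lra.
have f4 := ler_wpM2r (ltW x0) f3.
have s0 : 0 <= s by apply: sumr_ge0.
have f5 : 0 <= (1 / 2 - d) * (e * x * s).
  by rewrite mulr_ge0 ?subr_ge0// mulr_ge0// mulr_ge0// ltW.
lra.
Qed.

(** Within a block [l m] exceeds [k] by a factor of at most [l], so the weight [ln k] can be taken
    out at the cost of adding [ln l]. *)
Lemma blocks_bound l n0 Q x j : (1 < l)%N -> (0 < n0)%N -> 0 <= Q -> 0 < x ->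
  (forall i, (i < j)%N ->
   \sum_((n0 * l ^ i).+1 <= k < (l * (n0 * l ^ i)).+1) `|r (x / k%:R)|
     <= Q * x * \sum_((n0 * l ^ i).+1 <= k < (l * (n0 * l ^ i)).+1) k%:R^-1) ->
  \sum_(n0.+1 <= k < (n0 * l ^ j).+1) ln k%:R * `|r (x / k%:R)|
   <= Q * x * \sum_(n0.+1 <= k < (n0 * l ^ j).+1) (ln k%:R + ln l%:R) / k%:R.
Proof.
move=> l1 n00 Q0 x0; have l0 : (0 < l)%N by exact: ltnW.
elim: j => [|j IH] H; first by rewrite expn0 muln1 !big_geq// mulr0.
have E : (n0 * l ^ j.+1)%N = (l * (n0 * l ^ j))%N by rewrite expnS mulnCA.
pose m := (n0 * l ^ j)%N.
have m0 : (0 < m)%N by rewrite muln_gt0 n00 expn_gt0 l0.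
have mlm : (m <= l * m)%N by rewrite leq_pmull.
have n0m : (n0 <= m)%N by rewrite leq_pmulr// expn_gt0 l0.
rewrite E -/m !(@big_cat_nat _ _ _ m.+1 n0.+1 (l * m).+1)//= mulrDr lerD//.
  by apply: IH => i ij; apply: H; exact: leqW.
apply: (@le_trans _ _ (ln (l * m)%:R * \sum_(m.+1 <= k < (l * m).+1) `|r (x / k%:R)|)).
  rewrite mulr_sumr big_nat_cond [leRHS]big_nat_cond; apply: ler_sum => k.
  move=> /andP[/andP[mk km] _]; rewrite ler_wpM2r// ln_mono ?ltr0n ?ler_nat//.
  exact: leq_trans mk.
apply: le_trans (ler_wpM2l (ln_nat_ge0 _ _) (H j (ltnSn _))) _; rewrite -/m.
rewrite [leLHS]mulrCA ler_wpM2l ?mulr_ge0// ?(ltW x0)// mulr_sumr.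
apply: ler_sum_nat => k /andP[mk km]; rewrite ler_wpM2r//.
rewrite natrM ln_mulE ?ltr0n// addrC lerD2r ln_mono ?ltr0n// ler_nat.
exact: ltnW.
Qed.

Let eventually_le (al : R) := exists X, forall x, X <= x -> `|r x| <= al * x.

(** For [e = al (1 + d)] the blocks give the factor [Q = (1 - d^2) al < al]. As [sum ln k / k] is at
    most [ln^2 x / 2] up to lower order and [r_average] carries a factor 2, [Q] passes to
    [|r x| / x] unchanged, up to [O(1 / ln x)]. *)
Lemma improve_bound al : 0 < al -> (forall e, 0 < e -> eventually_le (al + e)) ->
  exists2 be, be < al & eventually_le be.
Proof.
move=> al0 Hal; have [l [n0 [d [X1 [l1 n00 /andP[d0 d1] X11 Hblock]]]]] := block_bound al0.
have ald : 0 < al * d by rewrite mulr_gt0.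
have [X2 HX2] := Hal _ ald; pose e := al + al * d.
have ale : al <= e by rewrite lerDl ltW.
have e0 : 0 < e by lra.
pose Q := (1 - d) * e.
have Q0 : 0 <= Q by rewrite mulr_ge0 ?subr_ge0// ltW.
have Qal : Q < al.
  rewrite /Q /e -subr_gt0 (_ : _ - _ = al * d * d); last by ring.
  by rewrite mulr_gt0.
pose X := Num.max X1 X2.
have X_1 : X1 <= X by rewrite le_max lexx.
have X_2 : X2 <= X by rewrite le_max lexx orbT.
have X0 : 0 < X by lra.
have lR : 0 < l%:R :> R by rewrite ltr0n ltnW.
have lnl : 0 <= ln l%:R :> R by exact: ln_nat_ge0.
pose C := 2 * B * (ln n0%:R * (ln n0%:R + 1)) + 2 * B * ln (X * l%:R)
   + 2 * Q * (1 + ln l%:R) + `|K|.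
have lXl : 0 <= ln (X * l%:R).
  rewrite ln_ge0//; have : 1 <= l%:R :> R by rewrite ler1n ltnW.
  by nra.
have C0 : 0 <= C.
  rewrite /C; have nn := ln_nat_ge0 R n0.
  have q3 : 0 <= 2 * Q * (1 + ln l%:R).
    by apply: mulr_ge0; [apply: mulr_ge0|rewrite addr_ge0].
  by rewrite (addr_ge0 (addr_ge0 (addr_ge0 _ _) q3))// mulr_ge0 ?mulr_ge0 ?addr_ge0.
have n0R : 0 < n0%:R :> R by rewrite ltr0n.
have main x : n0%:R * X <= x -> 1 <= x -> `|r x| * ln x ^+ 2 <= Q * x * ln x ^+ 2 + C * (x * (ln x + 1)).
  move=> n0Xx x1; have x0 : 0 < x by lra.
  have l0 : 0 <= ln x by rewrite ln_ge0.
  (* The blocks stop at [P = n0 l^j], the last one with [x / P >= X]. From there up to [x] the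
     harmonic sum is at most [ln (X l)], so the trivial bound by [B] costs only [O(x ln x)]. *)
  have [j [j1 j2]] : exists j, (n0 * l ^ j)%:R <= x / X /\ x / X < (n0 * l ^ j.+1)%:R.
    have ex : exists j, x / X < (n0 * l ^ j)%:R.
      exists (Num.truncn (x / X)).+1; apply: lt_le_trans (truncnS_gt _) _.
      rewrite ler_nat (leq_trans (ltnW (ltn_expl _ l1)))// leq_pmull//.
    case: (ex_minnP ex) => -[|j] hj min.
      move: hj; rewrite expn0 muln1 ltNge ler_pdivlMr// n0Xx //.
    exists j; split=> //; rewrite leNgt; apply/negP => /min.
    by rewrite ltnn.
  pose P := (n0 * l ^ j)%N.
  have P0 : (0 < P)%N by rewrite muln_gt0 n00 expn_gt0 ltnW.
  have PR : 0 < P%:R :> R by rewrite ltr0n.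
  have n0P : (n0 <= P)%N by rewrite leq_pmulr// expn_gt0 ltnW.
  have Px : P%:R <= x by apply: le_trans j1 _; rewrite ler_pdivrMr// ler_peMr//; lra.
  have [N0 Nx xN] := truncn_bounds x1.
  pose N := Num.truncn x.
  have PN : (P <= N)%N by rewrite /N truncn_ge_nat// ltW.
  have rk k : (0 < k)%N -> (k <= N)%N -> `|r (x / k%:R)| <= B * x * k%:R^-1.
    move=> k0 kN; rewrite -mulrA r_le// ler_pdivlMr ?ltr0n// mul1r.
    by apply: le_trans Nx; rewrite ler_nat.
  have lk k : (0 < k)%N -> (k <= N)%N -> ln k%:R <= ln x.
    by move=> k0 kN; rewrite ln_mono ?ltr0n// (le_trans _ Nx)// ler_nat.
  have s1 : \sum_(1 <= k < n0.+1) ln k%:R * `|r (x / k%:R)|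
      <= B * x * (ln n0%:R * (ln n0%:R + 1)).
    apply: (@le_trans _ _ (B * x * (ln n0%:R * \sum_(1 <= k < n0.+1) k%:R^-1))).
      rewrite !mulr_sumr big_nat_cond [leRHS]big_nat_cond; apply: ler_sum => k.
      move=> /andP[/andP[k0 kn0] _]; rewrite mulrCA ler_pM ?ln_nat_ge0//.
        by rewrite ln_mono ?ltr0n// ler_nat.
      by rewrite rk// (leq_trans _ PN)// (leq_trans _ n0P).
    rewrite ler_wpM2l ?mulr_ge0 ?(ltW x0)// ler_wpM2l ?ln_nat_ge0// -psum_nat.
    by have [] := @harmonic_bounds R n0%:R; rewrite ?ler1n.
  have s3 : \sum_(P.+1 <= k < N.+1) ln k%:R * `|r (x / k%:R)| <= B * x * (ln x * ln (X * l%:R)).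
    apply: (@le_trans _ _ (B * x * (ln x * \sum_(P.+1 <= k < N.+1) k%:R^-1))).
      rewrite !mulr_sumr big_nat_cond [leRHS]big_nat_cond; apply: ler_sum => k.
      move=> /andP[/andP[k0 kn0] _]; have k_gt0 : (0 < k)%N by exact: leq_trans k0.
      by rewrite mulrCA ler_pM ?ln_nat_ge0 ?lk ?rk.
    rewrite ler_wpM2l ?mulr_ge0 ?(ltW x0)// ler_wpM2l//.
    apply: le_trans (sum_inv_le P0 PN) _.
    have h : ln N%:R <= ln (X * l%:R * P%:R).
      apply: (@le_trans _ _ (ln x)); first exact: lk.
      apply: ln_mono => //; move: j2; rewrite expnS mulnCA natrM ltr_pdivrMr// => j2.
      by rewrite ltW// (lt_le_trans j2)// le_eqVlt; apply/orP; left; apply/eqP; rewrite -/P; ring.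
    by move: h; rewrite [ln (_ * P%:R)]ln_mulE ?mulr_gt0//; lra.
  have s2 : \sum_(n0.+1 <= k < P.+1) ln k%:R * `|r (x / k%:R)|
      <= Q * x * (ln x ^+ 2 / 2 + 1 + ln l%:R * (ln x + 1)).
    apply: le_trans (blocks_bound l1 n00 Q0 x0 _) _ => [i ij|].
      have h1 : X <= x / (l * (n0 * l ^ i))%:R.
        rewrite ler_pdivlMr; last by rewrite ltr0n !muln_gt0 expn_gt0 n00 (ltnW l1).
        rewrite mulrC -ler_pdivlMr//; apply: le_trans j1; rewrite ler_nat.
        by rewrite mulnCA -expnS leq_mul2l leq_pexp2l ?orbT// ltnW.
      apply: Hblock => //.
      - by rewrite leq_pmulr// expn_gt0 ltnW.
      - exact: le_trans h1.
      - by move=> y hy; apply: HX2; apply: le_trans hy; exact: le_trans h1.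
    rewrite (ler_wpM2l (mulr_ge0 Q0 (ltW x0)))//.
    apply: (@le_trans _ _ (\sum_(1 <= k < N.+1) (ln k%:R + ln l%:R) / k%:R)).
      rewrite (@big_cat_nat _ _ _ n0.+1 1 N.+1)//=; last by rewrite ltnS (leq_trans n0P).
      rewrite [in leRHS](@big_cat_nat _ _ _ P.+1 n0.+1 N.+1)//=.
      have pos a b : 0 <= \sum_(a <= k < b) (ln k%:R + ln l%:R) / k%:R :> R.
        by apply: sumr_ge0 => k _; rewrite divr_ge0// addr_ge0// ln_nat_ge0.
      by rewrite [leRHS]addrCA lerDl addr_ge0 ?pos.
    under eq_bigr do rewrite mulrDl.
    rewrite big_split /= -mulr_sumr lerD//.
      apply: le_trans (sum_ln_div_le _ _) _; rewrite lerD2r ler_pM2r//.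
      by rewrite ler_pXn2r ?nnegrE ?ln_nat_ge0// lk.
    rewrite ler_wpM2l//; have [_] := harmonic_bounds x1; exact.
  have Sx : psum (fun n => ln n%:R * `|r (x / n%:R)|) x =
     \sum_(1 <= k < n0.+1) ln k%:R * `|r (x / k%:R)|
     + (\sum_(n0.+1 <= k < P.+1) ln k%:R * `|r (x / k%:R)|
     + \sum_(P.+1 <= k < N.+1) ln k%:R * `|r (x / k%:R)|).
    rewrite /psum -/N (@big_cat_nat _ _ _ n0.+1 1 N.+1)//=; last by rewrite ltnS (leq_trans n0P).
    by rewrite (@big_cat_nat _ _ _ P.+1 n0.+1 N.+1).
  apply: le_trans (r_average x1) _; rewrite Sx.
  have xl : 0 <= x * (ln x + 1) by rewrite mulr_ge0 ?(ltW x0)// addr_ge0.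
  have s4 : K * (x * (ln x + 1)) <= `|K| * (x * (ln x + 1)) by rewrite ler_wpM2r// ler_norm.
  have z1 : 0 <= B * (ln n0%:R * (ln n0%:R + 1)) * (x * ln x).
    by rewrite !mulr_ge0// ?addr_ge0 ?ln_nat_ge0 ?(ltW x0).
  have z2 : 0 <= B * ln (X * l%:R) * x by rewrite !mulr_ge0// ltW.
  have z3 : 0 <= Q * x * ln x by rewrite (mulr_ge0 (mulr_ge0 Q0 (ltW x0))).
  move: s1 s2 s3 s4 z1 z2 z3; rewrite /C.
  move: (\sum_(1 <= _ < _) _) (\sum_(_ <= _ < P.+1) _) (\sum_(P.+1 <= _ < _) _) => S1 S2 S3.
  move: (ln n0%:R * (ln n0%:R + 1)) (ln (X * l%:R)) (ln l%:R) (`|K|) (ln x) => c1 c2 c3 c4 c5.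
  lra.
(* Half of the gap between [Q] and [al] absorbs [C x (ln x + 1)] once [ln x] is at least 1 and
   [4 C / (al - Q)]. *)
exists ((Q + al) / 2); first by lra.
pose Y := expR (Num.max 1 (4 * C / (al - Q))).
exists (Num.max Y (n0%:R * X)) => x; rewrite ge_max => /andP[Yx nx].
have Y1 : 1 < Y by rewrite expR_gt1 lt_max ltr01.
have x1 : 1 <= x by lra.
have x0 : 0 < x by lra.
have : Num.max 1 (4 * C / (al - Q)) <= ln x.
  by rewrite -(expRK (Num.max _ _)) ln_mono// expR_gt0.
rewrite ge_max ler_pdivrMr ?subr_gt0// => /andP[l1x lC].
have hm := main x nx x1; have lx0 : 0 < ln x ^+ 2 by rewrite exprn_gt0//; lra.
rewrite -(ler_pM2r lx0); apply: le_trans hm _.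
have f1 : C * (x * (ln x + 1)) <= C * (x * (2 * ln x)).
  by rewrite ler_wpM2l// ler_pM2l//; lra.
have f2 : 4 * C * (x * ln x) <= ln x * (al - Q) * (x * ln x).
  by rewrite ler_wpM2r// mulr_ge0//; lra.
have -> : (Q + al) / 2 * x * ln x ^+ 2 = Q * x * ln x ^+ 2
   + (ln x * (al - Q) * (x * ln x)) / 2 by field.
rewrite lerD2l; lra.
Qed.

(** The limsup of [|r x| / x] is taken as the infimum of [E], which contains [B]. Since an infimum
    need not be attained, [improve_bound] starts from the bounds [al + e] only. *)
Lemma remainder_small e : 0 < e -> exists X, forall x, X <= x -> `|r x| <= e * x.
Proof.
move=> e0; pose E := [set al | eventually_le al]%classic.
have lbE : lbound E 0.
  move=> al [X HX]; have h := HX (Num.max X 1); rewrite le_max lexx in h.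
  have {}h := le_trans (normr_ge0 _) (h isT).
  have x1 : 0 < Num.max X 1 by rewrite lt_max ltr01 orbT.
  by move: h; rewrite pmulr_lge0.
have E0 : (E !=set0)%classic by exists B; exists 1 => x x1; exact: r_le.
have hasE : has_inf E by split => //; exists 0.
have near_inf d : 0 < d -> eventually_le (inf E + d).
  move=> d0; have [al [X HX] ald] := inf_adherent d0 hasE.
  exists (Num.max X 1) => x; rewrite ge_max => /andP[Xx x1].
  by apply: le_trans (HX x Xx) _; rewrite ler_wpM2r// ?ltW//; lra.
have inf0 : inf E <= 0.
  rewrite leNgt; apply/negP => i0; have [be be_lt be_ev] := improve_bound i0 near_inf.
  by have := ge_inf (ex_intro _ 0 lbE) be_ev; rewrite leNgt be_lt.
have [X HX] := near_inf e e0.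
exists (Num.max X 1) => x; rewrite ge_max => /andP[Xx x1].
by apply: le_trans (HX x Xx) _; rewrite ler_wpM2r//; lra.
Qed.

End Tauberian.

(** * The prime number theorem for a Beurling system *)

Section PrimeNumberTheorem.
Variable R : realType.

Theorem beurling_pnt (a L : nat -> R) (c K0 : R) :
  a 1%N = 1 -> (forall n, 0 <= a n) -> (forall n, 0 <= L n) ->
  (forall n, (0 < n)%N -> dconv a L n = a n * ln n%:R) ->
  0 < c -> (forall x, 1 <= x -> `|psum a x - c * x| <= K0 * Num.sqrt x) ->
  forall e, 0 < e -> exists X, forall x, X <= x -> `|psum L x - x| <= e * x.
Proof.
move=> a1 a0 L0 aL c0 aA e e0.
have [B B0 HB] := chebyshev_upper a1 a0 L0 aL c0 aA.
have [M M0 HM] := mertens a1 a0 L0 aL c0 aA.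
have [K1 _ H1] := selberg_remainder a1 a0 L0 aL c0 aA.
have [K2 _ H2] := selberg_symmetry a1 a0 L0 aL c0 aA.
have [V _ HV] := rem_variation L0 H2.
have [S _ HS] := sum_rem_div L0 HB HM.
have [K _ HK] := rem_average L0 HB HM H1 H2.
apply: (@remainder_small R (fun x => psum L x - x) (B + 1) K S V) => //.
move=> x x1; have x0 : 0 <= x by lra.
have p0 : 0 <= psum L x by apply: psum_ge0.
have := HB x x0; move=> h; rewrite ler_norml; apply/andP; split; nra.
Qed.

End PrimeNumberTheorem.

(** * Arithmetic of Z[sqrt -2] *)

Section Arithmetic.
Implicit Types (a b p q : zsqrtm2) (n : nat).

Definition nrm a : nat := `|znorm a|%N.
Arguments nrm a%_ring_scope.

Lemma nrmE a : (nrm a)%:Z = znorm a.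
Proof. by rewrite /nrm gez0_abs ?znorm_ge0. Qed.

Lemma nrmM a b : nrm (a * b) = (nrm a * nrm b)%N.
Proof. by rewrite /nrm znormM abszM. Qed.

Lemma nrm_eq0 a : (nrm a == 0%N) = (a == 0).
Proof. by rewrite /nrm absz_eq0 znorm_eq0. Qed.

Lemma nrm_gt0 a : (0 < nrm a)%N = (a != 0).
Proof. by rewrite lt0n nrm_eq0. Qed.

Lemma nrm1 : nrm 1 = 1%N.
Proof. by []. Qed.

Lemma nrmN a : nrm (- a) = nrm a.
Proof. by rewrite /nrm /znorm; case: a => x y /=; rewrite !sqrrN. Qed.

Lemma nrmX a k : nrm (a ^+ k) = (nrm a ^ k)%N.
Proof. by elim: k => [|k IH]; rewrite ?expr0 // exprS nrmM IH expnS. Qed.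

Lemma unit_nrm a : (a \is a GRing.unit) = (nrm a == 1%N).
Proof. by rewrite unfold_in /= /zsqrtm2_unit /nrm -nrmE. Qed.

Lemma nrm1P a : nrm a = 1%N -> a = 1 \/ a = - 1.
Proof.
case: a => x y /(congr1 Posz); rewrite nrmE /znorm /= => h.
have y0 : y = 0 by nia.
have : x = 1 \/ x = -1 by nia.
by case=> ->; rewrite y0; [left|right].
Qed.

Lemma round_div (u : int) n : (0 < n)%N -> exists q : int, `|2 * (u - q * n%:Z)| <= n%:Z.
Proof.
move=> n0; exists ((2 * u + n%:Z) %/ (2 * n%:Z))%Z.
have n0' : 2 * n%:Z != 0 :> int by lia.
have := divz_eq (2 * u + n%:Z) (2 * n%:Z).
have := modz_ge0 (2 * u + n%:Z) n0'.
have := @ltz_pmod (2 * u + n%:Z) (2 * n%:Z).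
move: ((_ %/ _)%Z) ((_ %% _)%Z) => q r; rewrite ler_norml; nia.
Qed.

(** Both coordinates of [a / b], computed as those of [a * zconj b] over [nrm b], are rounded with
    errors at most [1/2], so the remainder has norm at most [(1/4 + 2/4) nrm b]. *)
Lemma euclid a b : b != 0 -> exists q, (nrm (a - q * b) < nrm b)%N.
Proof.
move=> b0; have n0 : (0 < nrm b)%N by rewrite nrm_gt0.
have [q1 h1] := round_div (zre (a * zconj b)) n0.
have [q2 h2] := round_div (zim (a * zconj b)) n0.
exists (Zsqrtm2 q1 q2).
have E : (a - Zsqrtm2 q1 q2 * b) * zconj b
   = a * zconj b - Zsqrtm2 q1 q2 * Zsqrtm2 (nrm b)%:Z 0.
  by rewrite mulrBl -mulrA znormE nrmE.
have : (nrm (a - Zsqrtm2 q1 q2 * b) * nrm b < nrm b * nrm b)%N.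
  have -> : (nrm (a - Zsqrtm2 q1 q2 * b) * nrm b)%N = nrm ((a - Zsqrtm2 q1 q2 * b) * zconj b).
    by rewrite nrmM /nrm /znorm /= sqrrN.
  rewrite E -ltz_nat PoszM nrmE.
  move: h1 h2; case: (a * zconj b) => u v; rewrite /znorm /=.
  move: n0; move: (nrm b) => n n0 h1 h2.
  have -> : u - (q1 * n%:Z - 2 * (q2 * 0)) = u - q1 * n%:Z by ring.
  have -> : v - (q1 * 0 + q2 * n%:Z) = v - q2 * n%:Z by ring.
  move: h1 h2; move: (u - _) (v - _) => s t; rewrite !ler_norml.
  nia.
by rewrite ltn_pmul2r.
Qed.

Lemma divides_refl a : divides a a.
Proof. by exists 1; rewrite mul1r. Qed.

Lemma divides_mull a b c : divides a b -> divides a (c * b).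
Proof. by case=> d ->; exists (c * d); rewrite mulrA. Qed.

Lemma divides_trans a b c : divides a b -> divides b c -> divides a c.
Proof. by case=> d -> [e ->]; exists (e * d); rewrite mulrA. Qed.

Lemma divides_nrm a b : divides a b -> (nrm a %| nrm b)%N.
Proof. by case=> c ->; rewrite nrmM dvdn_mull. Qed.

(* A nonzero combination of [a] and [b] of least norm divides both. *)
Lemma bezout a b : a != 0 -> exists u v,
  divides (u * a + v * b) a /\ divides (u * a + v * b) b.
Proof.
move=> a0; pose S n := `[< exists u v, nrm (u * a + v * b) = n /\ (0 < n)%N >].
have exS : exists n, S n.
  exists (nrm a); apply/asboolP; exists 1, 0.
  by rewrite mul1r mul0r addr0 nrm_gt0.
case: (ex_minnP exS) => n /asboolP[u [v [dn n0]]] min; exists u, v.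
have d0 : u * a + v * b != 0 by rewrite -nrm_gt0 dn.
have div w z : divides (u * a + v * b) (w * a + z * b).
  have [q hq] := euclid (w * a + z * b) d0.
  exists q; apply/eqP; rewrite -subr_eq0 -nrm_eq0 -leqn0 leqNgt; apply/negP => r0.
  have : (n <= nrm (w * a + z * b - q * (u * a + v * b)))%N.
    apply: min; apply/asboolP; exists (w - q * u), (z - q * v); split=> //.
    by congr nrm; ring.
  by rewrite leqNgt -dn hq.
split.
- by have := div 1 0; rewrite mul1r mul0r addr0.
- by have := div 0 1; rewrite mul1r mul0r add0r.
Qed.

(** A divisor [p] of least norm above 1 is prime: if it divides [b * c], the Bezout divisor of [p]
    and [b] is either a unit, and [p] divides [c], or by minimality an associate of [p], and [p]
    divides [b]. *)
Lemma prime_divisor a : a != 0 -> nrm a != 1%N -> exists2 p, prime_elt p & divides p a.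
Proof.
move=> a0 a1; pose S n := `[< exists p, [/\ divides p a, nrm p = n & (1 < n)%N] >].
have exS : exists n, S n.
  exists (nrm a); apply/asboolP; exists a; split=> //; first exact: divides_refl.
  by rewrite ltn_neqAle eq_sym a1 nrm_gt0.
case: (ex_minnP exS) => n /asboolP[p [pa pn n1]] min; exists p => //.
have p0 : p != 0 by rewrite -nrm_gt0 pn ltnW.
split; first exact/eqP; first by rewrite unit_nrm pn gtn_eqF.
move=> b c pbc; have [u [v [dp db]]] := bezout b p0.
have [e pe] := dp; have := congr1 nrm pe; rewrite nrmM => ne.
have [d1|d1] := eqVneq (nrm (u * p + v * b)) 1%N.
  right; have [x hx] := pbc.
  have E : (u * p + v * b) * c = (u * c + v * x) * p.
    by rewrite !mulrDl -[v * b * c]mulrA hx; ring.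
  case: (nrm1P d1) => d; move: E; rewrite d ?mulN1r ?mul1r => E.
    by exists (u * c + v * x).
  by exists (- (u * c + v * x)); rewrite mulNr -E opprK.
left; apply: divides_trans db.
have d0 : (0 < nrm (u * p + v * b))%N.
  by move: n1; rewrite -pn ne; case: (nrm (u * p + v * b)) => //; rewrite muln0.
have hm : (n <= nrm (u * p + v * b))%N.
  apply: min; apply/asboolP; exists (u * p + v * b); split=> //.
    exact: divides_trans pa.
  by rewrite ltn_neqAle eq_sym d1.
have e1 : nrm e = 1%N.
  have e0 : (0 < nrm e)%N by move: n1; rewrite -pn ne; case: (nrm e).
  apply/eqP; rewrite eqn_leq e0 andbT.
  by rewrite -(leq_pmul2r d0) mul1n -ne pn.
case: (nrm1P e1) => ee; move: pe; rewrite ee ?mulN1r ?mul1r => pe.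
  by exists 1; rewrite mul1r -pe.
by exists (- 1); rewrite mulN1r -[LHS]opprK -pe.
Qed.

Lemma prime_nrm_gt1 p : prime_elt p -> (1 < nrm p)%N.
Proof.
move=> [p0 pu _]; rewrite ltn_neqAle nrm_gt0 eq_sym -unit_nrm pu /=.
exact/eqP.
Qed.

Lemma prime_eltN p : prime_elt p -> prime_elt (- p).
Proof.
move=> [p0 pu pp].
have dN x : divides (- p) x <-> divides p x.
  by split=> -[c ->]; exists (- c); rewrite ?mulrNN ?mulNr ?mulrN.
split; [by move/eqP; rewrite oppr_eq0 => /eqP|by rewrite unitrN|].
by move=> a b /dN /pp[] h; [left|right]; apply/dN.
Qed.

Lemma prime_divides_prime p q : prime_elt p -> prime_elt q -> divides p q ->
  p = q \/ p = - q.
Proof.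
move=> [p0 pu _] [q0 qu qq] [c hc].
case: (qq c p); first by exists 1; rewrite mul1r.
  move=> [e he]; exfalso; apply: (negP pu).
  have : e * p = 1.
    by apply: (mulIf (introN eqP q0)); rewrite mul1r mulrAC -he -hc.
  by move=> ep; apply/unitrPr; exists e; rewrite mulrC.
move=> [e he]; have : e * c = 1.
  by apply: (mulIf (introN eqP p0)); rewrite mul1r -mulrA -hc -he.
move/(congr1 nrm); rewrite nrmM nrm1 => /eqP; rewrite muln_eq1 => /andP[/eqP e1 _].
by case: (nrm1P e1) => ee; rewrite he ee ?mul1r ?mulN1r; [left|right].
Qed.

Lemma prime_pow_divides p b c k : prime_elt p -> ~ divides p b ->
  divides (p ^+ k) (b * c) -> divides (p ^+ k) c.
Proof.
move=> pp nb; elim: k c => [|k IH] c; first by move=> _; exists c; rewrite expr0 mulr1.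
have [p0 pu ppr] := pp.
move=> [d hd]; case: (ppr b c) => //; first by exists (d * p ^+ k); rewrite hd exprSr mulrA.
move=> [e he]; have : divides (p ^+ k) (b * e).
  exists d; apply: (mulIf (introN eqP p0)).
  by rewrite -mulrA -he hd exprSr mulrA.
by move/IH => [f hf]; exists f; rewrite he hf exprSr mulrA.
Qed.

End Arithmetic.

(** * Unique factorization and the von Mangoldt function *)

Section Counting.
Variable R : realType.
Implicit Types (a b p q : zsqrtm2) (n m k K : nat).

(** A box containing all elements of norm at most [n], so that elements are counted on
    duplicate-free lists. *)
Definition zbox n : seq zsqrtm2 :=
  [seq Zsqrtm2 (i%:Z - n%:Z) (j%:Z - n%:Z) | i <- iota 0 (2 * n).+1, j <- iota 0 (2 * n).+1].

Definition elems n : seq zsqrtm2 := [seq a <- zbox n | nrm a == n].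

Lemma zbox_uniq n : uniq (zbox n).
Proof.
apply: allpairs_uniq; rewrite ?iota_uniq// => -[i j] [k l] _ _ /= [].
by move=> /addIr[->] /addIr[->].
Qed.

Lemma mem_zbox n (x y : int) :
  (Zsqrtm2 x y \in zbox n) = (- n%:Z <= x <= n%:Z) && (- n%:Z <= y <= n%:Z).
Proof.
apply/allpairsP/idP => [[[i j] [+ + [-> ->]]]|h].
  by rewrite !mem_iota /=; lia.
exists (absz (x + n%:Z), absz (y + n%:Z)); rewrite !mem_iota; split=> /=; try lia.
by congr Zsqrtm2; lia.
Qed.

Lemma elems_uniq n : uniq (elems n).
Proof. by rewrite filter_uniq// zbox_uniq. Qed.

Lemma mem_elems n a : (a \in elems n) = (nrm a == n).
Proof.
rewrite mem_filter; apply/andb_idr => /eqP; case: a => x y h.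
have := nrmE (Zsqrtm2 x y); rewrite h /znorm /= mem_zbox => e.
by apply/andP; split; apply/andP; split; nia.
Qed.

Definition is_prime p : bool := `[< prime_elt p >].
Definition dvdz2 a b : bool := `[< divides a b >].

(** Multiplication by [q] is a bijection from the elements of norm [n / nrm q] onto the multiples of
    [q] of norm [n]. *)
Lemma count_multiples q n : q != 0 -> (0 < n)%N ->
  count (dvdz2 q) (elems n) = if (nrm q %| n)%N then size (elems (n %/ nrm q)) else 0%N.
Proof.
move=> q0 n0; have nq : (0 < nrm q)%N by rewrite nrm_gt0.
case: ifPn => [/dvdnP[m nm]|ndv]; last first.
  apply/eqP; rewrite -leqn0 leqNgt -has_count; apply/negP => /hasP[b].
  by rewrite mem_elems => /eqP bn /asboolP/divides_nrm; rewrite bn (negPf ndv).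
rewrite nm mulnK// -size_filter -[RHS](size_map ( *%R q)).
apply/perm_size/uniq_perm.
- by rewrite filter_uniq// elems_uniq.
- by rewrite map_inj_uniq ?elems_uniq//; exact: mulfI.
move=> b; rewrite mem_filter mem_elems; apply/andP/mapP => [[/asboolP[c bc] /eqP nb]|].
  exists c; last by rewrite bc mulrC.
  by rewrite mem_elems -(eqn_pmul2r nq) -nrmM -bc nb.
move=> [c]; rewrite mem_elems => /eqP nc ->; split.
  by apply/asboolP; exists c; rewrite mulrC.
by rewrite nrmM nc mulnC.
Qed.

(** The exponent of a prime [p] in [b], as the number of its powers dividing [b]; the truncation is
    harmless for nonzero [b] with [nrm b <= K], because [nrm p >= 2]. *)
Definition val K p b : nat := \sum_(1 <= k < K.+1) dvdz2 (p ^+ k) b.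

Lemma valN K p b : val K (- p) b = val K p b.
Proof.
apply: eq_bigr => k _; congr nat_of_bool; apply/asboolP/asboolP => -[c ->];
  exists (c * (- 1) ^+ k); rewrite (exprNn p k) -!mulrA//; congr (_ * _).
by rewrite mulrA -exprD addnn -mul2n exprM sqrrN !expr1n mul1r.
Qed.

Lemma sum_shift (f : nat -> nat) K :
  (f 0 + \sum_(1 <= k < K.+1) f k = \sum_(0 <= k < K) f k + f K)%N.
Proof.
elim: K => [|K IH]; first by rewrite !big_geq// addn0.
by rewrite [X in (_ + X)%N]big_nat_recr//= [in RHS]big_nat_recr//= -IH addnA.
Qed.

Lemma val_mul_same K p b : is_prime p -> b != 0 -> (nrm b <= K)%N ->
  val K p (b * p) = (val K p b).+1.
Proof.
move=> /asboolP pp b0 bK; have p0 : p != 0 by have [/eqP] := pp.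
have shift k : dvdz2 (p ^+ k.+1) (b * p) = dvdz2 (p ^+ k) b.
  apply/asboolP/asboolP => -[c hc]; exists c.
    by apply: (mulIf p0); rewrite hc exprSr mulrA.
  by rewrite hc exprSr mulrA.
have f0 : dvdz2 (p ^+ 0) b by apply/asboolP; exists b; rewrite expr0 mulr1.
have fK : dvdz2 (p ^+ K) b = false.
  apply/negP => /asboolP/divides_nrm; rewrite nrmX => /dvdn_leq.
  rewrite nrm_gt0 b0 => /(_ isT); rewrite leqNgt.
  by rewrite (leq_ltn_trans bK)// ltn_expl// prime_nrm_gt1.
have := sum_shift (fun k => dvdz2 (p ^+ k) b) K; rewrite f0 fK addn0 add1n => ->.
by rewrite /val big_add1 /=; apply: eq_bigr => k _; rewrite shift.
Qed.

Lemma val_mul_other K p q b : is_prime p -> is_prime q -> p != q -> p != - q ->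
  val K p (b * q) = val K p b.
Proof.
move=> /asboolP pp /asboolP qp pq pNq; apply: eq_bigr => k _; congr nat_of_bool.
apply/asboolP/asboolP => [|h]; last by rewrite mulrC; exact: divides_mull.
rewrite mulrC; apply: prime_pow_divides => // /(prime_divides_prime pp qp)[] h.
  by rewrite h eqxx in pq.
by rewrite h eqxx in pNq.
Qed.

Lemma val_mul K p q b : is_prime p -> is_prime q -> b != 0 -> (nrm b <= K)%N ->
  val K p (b * q) = (val K p b + ((p == q) + (p == - q)))%N.
Proof.
move=> pp qp b0 bK; have q0 : q != 0 by have /asboolP[/eqP] := qp.
have qNq : q != - q.
  rewrite -addr_eq0 -mulr2n -[q *+ 2]mulr_natl mulf_eq0 negb_or q0 andbT.
  by [].
have [->|pq] := eqVneq p q; first by rewrite (negPf qNq) val_mul_same// addn1.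
have [->|pNq] := eqVneq p (- q); last by rewrite val_mul_other// addn0.
by rewrite !valN val_mul_same// addn1.
Qed.

Lemma sum_seq_pred1 (T : eqType) (s : seq T) (P : pred T) (F : T -> R) x :
  uniq s -> x \in s -> P x -> \sum_(y <- s | P y) (y == x)%:R * F y = F x.
Proof.
move=> us xs Px; rewrite big_mkcond (bigD1_seq x)//= Px eqxx mul1r big1 ?addr0//.
by move=> y /negPf ->; rewrite mul0r; case: ifP.
Qed.

Lemma sum_assoc K q : is_prime q -> (nrm q <= K)%N ->
  \sum_(1 <= d < K.+1) \sum_(p <- elems d | is_prime p)
     ((p == q) + (p == - q))%:R * ln d%:R = 2 * ln (nrm q)%:R :> R.
Proof.
move=> qp qK; have q0 : (0 < nrm q)%N by rewrite ltnW// prime_nrm_gt1//; exact/asboolP.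
have Nqp : is_prime (- q) by apply/asboolP/prime_eltN/asboolP.
rewrite (bigD1_seq (nrm q)) ?iota_uniq ?mem_index_iota ?q0//= [X in _ + X]big1 ?addr0.
  under eq_bigr do rewrite natrD mulrDl.
  rewrite big_split /= !sum_seq_pred1 ?elems_uniq ?mem_elems ?nrmN//; ring.
move=> d dq; rewrite big_seq_cond big1// => p /andP[+ _]; rewrite mem_elems => /eqP pd.
have -> : p == q = false by apply/eqP => pq; rewrite -pd pq eqxx in dq.
have -> : p == - q = false by apply/eqP => pq; rewrite -pd pq nrmN eqxx in dq.
by rewrite mul0r.
Qed.

(* Unique factorization; each prime is counted along with its opposite, whence
   the factor 2. *)
Lemma sum_val K b : b != 0 -> (nrm b <= K)%N ->
  \sum_(1 <= d < K.+1) \sum_(p <- elems d | is_prime p) (val K p b)%:R * ln d%:R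
  = 2 * ln (nrm b)%:R :> R.
Proof.
have [N] := ubnP (nrm b); elim: N b => // N IH b bN b0 bK.
have [b1|b1] := eqVneq (nrm b) 1%N.
  rewrite b1 ln1 mulr0 big1_seq// => d _; rewrite big1// => p /asboolP pp.
  rewrite /val big1_seq ?mul0r// => k; rewrite mem_index_iota => /andP[_ /andP[k0 _]].
  case E: (dvdz2 _ _) => //; move/asboolP: E => /divides_nrm; rewrite b1 dvdn1 nrmX => /eqP h.
  have := prime_nrm_gt1 pp; rewrite ltnNge => /negP[].
  by case: k k0 h => // k _ h; rewrite -h expnS leq_pmulr// expn_gt0 ltnW// prime_nrm_gt1.
have [q qp [c bc]] := prime_divisor b0 b1.
have q1 := prime_nrm_gt1 qp; have qb : is_prime q by exact/asboolP.
have c0 : c != 0 by apply: contraNneq b0 => c0; rewrite bc c0 mul0r.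
have cn : (0 < nrm c)%N by rewrite nrm_gt0.
have cb : (nrm c < nrm b)%N by rewrite bc nrmM ltn_Pmulr.
have cK : (nrm c <= K)%N by rewrite (leq_trans (ltnW cb)).
have qK : (nrm q <= K)%N by rewrite (leq_trans _ bK)// bc nrmM leq_pmull.
transitivity (\sum_(1 <= d < K.+1) \sum_(p <- elems d | is_prime p) (val K p c)%:R * ln d%:R
  + \sum_(1 <= d < K.+1) \sum_(p <- elems d | is_prime p)
     ((p == q) + (p == - q))%:R * ln d%:R : R).
  rewrite -big_split /=; apply: eq_bigr => d _; rewrite -big_split /=.
  by apply: eq_bigr => p pp; rewrite bc val_mul// natrD mulrDl.
rewrite IH// ?sum_assoc//; last by rewrite (leq_trans cb).
by rewrite bc nrmM natrM ln_mulE ?ltr0n ?(ltnW q1)//; ring.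
Qed.

(** As [Z[sqrt -2]] is principal with units [+-1], this is the number of ideals of norm [n], for
    [n > 0]. *)
Definition ideal_count n : R := (size (elems n))%:R / 2.

(** The von Mangoldt function of ideals, summed over the ideals of norm [m]; it is halved because
    [p] and [- p] generate the same ideal. *)
Definition ideal_mangoldt m : R :=
  (\sum_(1 <= d < m.+1) \sum_(p <- elems d | is_prime p)
     \sum_(1 <= k < m.+1 | (d ^ k == m)%N) ln d%:R) / 2.

(** [d ^ k = m] with [d > 1] and [k > 0] forces [d, k <= m]; a range independent of [m] allows sums
    over [m] to be exchanged with the others. *)
Lemma ideal_mangoldt_widen m n : (0 < m <= n)%N ->
  ideal_mangoldt m = (\sum_(1 <= d < n.+1) \sum_(p <- elems d | is_prime p)
     \sum_(1 <= k < n.+1 | (d ^ k == m)%N) ln d%:R) / 2.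
Proof.
move=> /andP[m0 mn]; congr (_ / 2).
rewrite [RHS](@big_cat_nat _ _ _ m.+1)//= [X in _ + X]big1_seq ?addr0; last first.
  move=> d; rewrite mem_index_iota => /andP[_ /andP[md _]].
  rewrite big1// => p _; rewrite big1_seq// => k; rewrite mem_index_iota.
  move=> /andP[/eqP dk /andP[k0 _]]; move: (md); rewrite -{1}dk ltnNge.
  case: k k0 {dk} => // k _; rewrite expnS leq_pmulr// expn_gt0.
  by rewrite (leq_trans _ md).
apply: eq_big_nat => d _; rewrite big_seq_cond [RHS]big_seq_cond.
apply: eq_bigr => p /andP[]; rewrite mem_elems => /eqP pd /asboolP pp.
rewrite [RHS](@big_cat_nat _ _ _ m.+1)//= [X in _ + X]big1_seq ?addr0// => k.
rewrite mem_index_iota => /andP[/eqP dk /andP[mk _]].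
have := ltn_expl k (prime_nrm_gt1 pp); rewrite pd dk => km.
by move: mk; rewrite ltnNge ltnW.
Qed.

(** Pairs of an element [b] of norm [n] and a prime power dividing it, with weight [ln (nrm p)], are
    counted in two ways: by prime powers with [count_multiples], by [b] with [sum_val]. The halves
    in the two definitions make [1/4], against the 2 of [sum_val]. *)
Lemma ideal_mangoldt_conv n : (0 < n)%N ->
  dconv ideal_count ideal_mangoldt n = ideal_count n * ln n%:R.
Proof.
move=> n0; rewrite dconvC// /dconv.
pose T (F : nat -> zsqrtm2 -> nat -> R) := \sum_(1 <= d < n.+1)
   \sum_(p <- elems d | is_prime p) \sum_(1 <= k < n.+1) F d p k.
have TE F G : (forall d p k, is_prime p -> nrm p = d -> (0 < k)%N -> F d p k = G d p k) -> T F = T G.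
  move=> FG; apply: eq_bigr => d _; rewrite big_seq_cond [RHS]big_seq_cond.
  apply: eq_bigr => p /andP[]; rewrite mem_elems => /eqP pd pp.
  by apply: eq_big_nat => k /andP[k0 _]; exact: FG.
have Tsum (I : eqType) (s : seq I) (P : pred I) (F : I -> nat -> zsqrtm2 -> nat -> R) :
    \sum_(i <- s | P i) T (F i) = T (fun d p k => \sum_(i <- s | P i) F i d p k).
  rewrite /T exchange_big /=; apply: eq_bigr => d _.
  rewrite exchange_big /=; apply: eq_bigr => p _.
  by rewrite exchange_big.
have TZ c F : c * T F = T (fun d p k => c * F d p k).
  rewrite /T mulr_sumr; apply: eq_bigr => d _; rewrite mulr_sumr.
  by apply: eq_bigr => p _; rewrite mulr_sumr.
transitivity (\sum_(1 <= m < n.+1 | (m %| n)%N) T (fun d p k =>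
    (size (elems (n %/ m)))%:R / 4 * ((d ^ k == m)%N%:R * ln d%:R))).
  rewrite big_nat_cond [RHS]big_nat_cond; apply: eq_bigr => m /andP[/andP[m0 mn] dv].
  rewrite -TZ (@ideal_mangoldt_widen m n) ?m0//= /ideal_count /T.
  transitivity ((\sum_(1 <= d < n.+1) \sum_(p <- elems d | is_prime p)
       \sum_(1 <= k < n.+1) (d ^ k == m)%N%:R * ln d%:R) / 2 * ((size (elems (n %/ m)))%:R / 2) : R);
    last by field.
  congr (_ / 2 * _).
  apply: eq_bigr => d _; apply: eq_bigr => p _; rewrite big_mkcond.
  by apply: eq_bigr => k _; case: eqP; rewrite ?mul1r ?mul0r.
rewrite Tsum.
transitivity (T (fun d p k => \sum_(b <- elems n) 4^-1 * ((dvdz2 (p ^+ k) b)%:R * ln d%:R))).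
  apply: TE => d p k pp pd k0.
  have p0 : p != 0 by have /asboolP[/eqP] := pp.
  have dk0 : (0 < d ^ k)%N by rewrite expn_gt0 -pd nrm_gt0 p0.
  have -> : \sum_(b <- elems n) 4^-1 * ((dvdz2 (p ^+ k) b)%:R * ln d%:R)
      = 4^-1 * ((count (dvdz2 (p ^+ k)) (elems n))%:R * ln d%:R) :> R.
    rewrite -mulr_sumr -mulr_suml -sum1_count natr_sum [in RHS]big_mkcond /=.
    by congr (_ * (_ * _)); apply: eq_bigr => b _; case: (dvdz2 _ b).
  rewrite count_multiples ?expf_neq0// nrmX pd big_mkcond /=; case: ifPn => dv.
    have dkn : (d ^ k <= n)%N by exact: dvdn_leq.
    rewrite (bigD1_seq (d ^ k)%N) ?iota_uniq ?mem_index_iota ?dk0 ?ltnS//=.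
    rewrite dv eqxx mul1r big1 ?addr0; first by ring.
    by move=> m /negPf h; rewrite eq_sym h mul0r mulr0; case: ifP.
  rewrite mul0r mulr0 big1// => m _; case: ifP => // mn; case: eqP => [h|]; last first.
    by rewrite mul0r mulr0.
  by rewrite h mn in dv.
rewrite -(Tsum _ (elems n) xpredT (fun b d p k => 4^-1 * ((dvdz2 (p ^+ k) b)%:R * ln d%:R))).
transitivity (\sum_(b <- elems n) 4^-1 * (2 * ln n%:R) : R); last first.
  by rewrite big_const_seq count_predT iter_addr_0 /ideal_count -mulr_natr; field.
rewrite big_seq_cond [RHS]big_seq_cond; apply: eq_bigr => b /andP[].
rewrite mem_elems => /eqP bn _.
rewrite -TZ; congr (_ * _); rewrite -[in RHS]bn -(@sum_val n b) ?bn//; last first.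
  by rewrite -nrm_gt0 bn.
apply: eq_bigr => d _; apply: eq_bigr => p _.
by rewrite -mulr_suml /val -natr_sum.
Qed.

End Counting.

(** * Counting lattice points *)

Section Quadrants.
Variable R : realType.
Implicit Types (a b : zsqrtm2) (n m : nat).

Definition in_quadrant a : bool := (0 < zre a) && (0 < zim a).

Lemma mem_zbox_nrm n a : (nrm a <= n)%N -> a \in zbox n.
Proof.
case: a => x y; rewrite -lez_nat nrmE /znorm /= mem_zbox => h.
by apply/andP; split; apply/andP; split; nia.
Qed.

Lemma count_zbox_inv (P : pred zsqrtm2) f n : involutive f ->
  (forall a, (f a \in zbox n) = (a \in zbox n)) ->
  count (fun a => P (f a)) (zbox n) = count P (zbox n).
Proof.
move=> fK fm; rewrite -[LHS](count_map f P); apply/permP/uniq_perm.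
- by rewrite map_inj_uniq ?zbox_uniq//; exact: inv_inj.
- exact: zbox_uniq.
move=> a; rewrite -[in RHS](fK a) fm -[in LHS](fK a) mem_map//; exact: inv_inj.
Qed.

Lemma zconjK : involutive zconj.
Proof. by case=> x y; rewrite /zconj /= opprK. Qed.

Lemma le_truncn_sqrt (z : R) i : (0 < i)%N -> (i <= Num.truncn (Num.sqrt z))%N = (i%:R ^+ 2 <= z).
Proof.
move=> i0; rewrite truncn_ge_nat ?sqrtr_ge0//; have [z0|z0] := leP 0 z.
  rewrite -[in RHS](sqr_sqrtr z0) ler_pXn2r ?nnegrE ?sqrtr_ge0//.
(* [Num.sqrt] is 0 at negative reals, so both sides are false. *)
rewrite (ler0_sqrtr (ltW z0)) leNgt ltr0n i0; apply/esym/negbTE.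
by rewrite -ltNge (lt_le_trans z0)// sqr_ge0.
Qed.

Lemma count_axes (S : pred zsqrtm2) n : (forall a, S a -> (nrm a <= n)%N) ->
  (count (fun a => S a && ~~ ((zre a != 0) && (zim a != 0))) (zbox n))%:R
    <= 4 * Num.sqrt n%:R + 2 :> R.
Proof.
move=> Sn; pose s := Num.truncn (Num.sqrt n%:R : R).
pose A := [seq Zsqrtm2 0 (i%:Z - s%:Z) | i <- iota 0 (2 * s).+1]
  ++ [seq Zsqrtm2 (i%:Z - s%:Z) 0 | i <- iota 0 (2 * s).+1].
have bnd (u : int) : u ^+ 2 <= n%:Z -> - s%:Z <= u <= s%:Z.
  move=> un; have h : (`|u| <= s)%N.
    have [->//|u0] := posnP `|u|%N; rewrite /s le_truncn_sqrt// -natrX ler_nat.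
    by move: un; rewrite expnS expn1 expr2; nia.
  by move: h; lia.
have cA : (count (fun a => S a && ~~ ((zre a != 0) && (zim a != 0))) (zbox n) <= size A)%N.
  rewrite -size_filter; apply: uniq_leq_size; first by rewrite filter_uniq// zbox_uniq.
  move=> [x y]; rewrite mem_filter negb_and !negbK => /andP[/andP[/Sn + xy] _].
  rewrite -lez_nat nrmE /znorm /= in xy * => h; rewrite mem_cat; apply/orP.
  case/orP: xy => /eqP e; rewrite e in h *; [left|right]; apply/mapP.
    have /bnd {}h : y ^+ 2 <= n%:Z by nia.
    exists (absz (y + s%:Z)); first by rewrite mem_iota; lia.
    by congr Zsqrtm2; lia.
  have /bnd {}h : x ^+ 2 <= n%:Z by nia.
  exists (absz (x + s%:Z)); first by rewrite mem_iota; lia.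
  by congr Zsqrtm2; lia.
move: cA; rewrite size_cat !size_map !size_iota -(ler_nat R) => /le_trans; apply.
have : s%:R <= Num.sqrt n%:R :> R by rewrite truncn_le sqrtr_ge0.
rewrite natrD -natr1 natrM; lra.
Qed.

(** Negation, conjugation and their composite permute the box and preserve [S]; off the axes,
    exactly one of the element and its three images lies in the open quadrant. *)
Lemma count_quadrants (S : pred zsqrtm2) n :
  (forall a, S (- a) = S a) -> (forall a, S (zconj a) = S a) ->
  (forall a, S a -> (nrm a <= n)%N) ->
  `|(count S (zbox n))%:R - 4 * (count (fun a => S a && in_quadrant a) (zbox n))%:R|
    <= 4 * Num.sqrt n%:R + 2 :> R.
Proof.
move=> SN Sc Sn; have := @count_axes S n Sn.
pose Q f a := S a && in_quadrant (f a).
have memN a : (- a \in zbox n) = (a \in zbox n).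
  case: a => x y; have -> : - Zsqrtm2 x y = Zsqrtm2 (- x) (- y) by [].
  by rewrite !mem_zbox; lia.
have memC a : (zconj a \in zbox n) = (a \in zbox n).
  by case: a => x y; rewrite /zconj /= !mem_zbox; lia.
have q1 : count (Q zconj) (zbox n) = count (Q id) (zbox n).
  rewrite -(count_zbox_inv (Q id) zconjK memC); apply: eq_count => a.
  by rewrite /Q Sc.
have q2 : count (Q -%R) (zbox n) = count (Q id) (zbox n).
  rewrite -(count_zbox_inv (Q id) opprK memN); apply: eq_count => a.
  by rewrite /Q SN.
have q3 : count (Q (fun a => - zconj a)) (zbox n) = count (Q id) (zbox n).
  rewrite -(@count_zbox_inv (Q id) (fun a => - zconj a)).
  - by apply: eq_count => a; rewrite /Q SN Sc.
  - by case=> x y; rewrite /zconj; congr Zsqrtm2; rewrite /= !opprK.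
  - by move=> a; rewrite memN memC.
have E : count S (zbox n) = (count (Q id) (zbox n) + count (Q zconj) (zbox n)
   + (count (Q -%R) (zbox n) + count (Q (fun a => (- zconj a)%R)) (zbox n))
   + count (fun a => S a && ~~ ((zre a != 0%R) && (zim a != 0%R))) (zbox n))%N.
  elim: (zbox n) => //= a s ->.
  have -> : S a = (Q id a + Q zconj a + (Q -%R a + Q (fun a => (- zconj a)%R) a)
    + (S a && ~~ ((zre a != 0%R) && (zim a != 0%R))))%N :> nat.
    rewrite /Q /in_quadrant; case: (S a) => //=; case: a => x y /=.
    by case: (ltrgt0P x) => hx; case: (ltrgt0P y) => hy; rewrite ?oppr_gt0; lia.
  lia.
rewrite E q1 q2 q3; move: (count _ _) (count _ _) => v u.
rewrite !natrD (_ : _ - _ = u%:R); last by ring.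
by rewrite ger0_norm.
Qed.

End Quadrants.

(** * Lattice points in an ellipse *)

Section Lattice.
Variable R : realType.
Implicit Types (a b : zsqrtm2) (n m : nat).

(** The profile of the ellipse [u^2 + 2 s^2 = 1], continued by 0 since [Num.sqrt] vanishes at
    negative reals. *)
Let h (s : R) : R := Num.sqrt (1 - 2 * s ^+ 2).

Let h_decr s t : 0 <= s -> s <= t -> h t <= h s.
Proof. by move=> s0 st; apply: ler_wsqrtr; nra. Qed.

Let h_continuous : continuous h.
Proof.
suff : continuous (Num.sqrt \o (fun s : R => 1 - 2 * s ^+ 2)) by [].
move=> x; apply: continuous_comp; last exact: sqrt_continuous.
apply: cvgB; first exact: cvg_cst.
by apply: cvgM; [exact: cvg_cst|exact: exprn_continuous].
Qed.

Let antiderivative : exists F : R -> R, forall s t, 0 <= s -> s <= t -> t <= 2 ->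
  h t * (t - s) <= F t - F s /\ F t - F s <= h s * (t - s).
Proof.
pose mu := @lebesgue_measure R.
(* With base point [-1] and integrability up to 3, [[0, 2]] is in the interior, where the
   fundamental theorem of calculus gives the derivative. *)
pose F (x : R) := (\int[mu]_(t in [set` `[(-1 : R), x]]) (h t))%R.
have hint : mu.-integrable `[(-1 : R), 3] (EFin \o h).
  apply: continuous_compact_integrable; first exact: segment_compact.
  by apply: continuous_subspaceT => x; exact: h_continuous.
have dF (x : R) : -1 < x -> x < 3 -> is_derive x 1 F (h x).
  move=> x1 x3; have [dx Fx] := continuous_FTC1_closed x3 hint x1 (@h_continuous x).
  by rewrite -Fx derive1E; exact: DeriveDef.
exists F => s t s0 st t2.
have cF : {within `[s, t], continuous F}%classic.
  apply: derivable_within_continuous => x; rewrite in_itv /= => /andP[sx xt].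
  have x1 : -1 < x by lra.
  have x3 : x < 3 by lra.
  by have [] := dF x x1 x3.
have dF' (x : R) : x \in `]s, t[ -> is_derive x 1 F (h x).
  by rewrite in_itv /= => /andP[sx xt]; apply: dF; lra.
have [u] := MVT_segment st dF' cF; rewrite in_itv /= => /andP[su ut] ->.
have u0 : 0 <= u by lra.
have d0 : 0 <= t - s by rewrite subr_ge0.
by split; rewrite ler_wpM2r// h_decr.
Qed.

(* The mean value theorem for a primitive of [sqrt (1 - 2 s^2)] replaces the
   area of the ellipse. *)
Let sum_sqrt_ellipse : exists2 c : R, 0 < c & forall n, (0 < n)%N ->
  `|\sum_(1 <= j < (Num.truncn (Num.sqrt n%:R : R)).+1) Num.sqrt (n%:R - 2 * j%:R ^+ 2)
    - c * n%:R| <= Num.sqrt n%:R.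
Proof.
have [F HF] := antiderivative.
have h_ge0 s : 0 <= h s by exact: sqrtr_ge0.
have h_le1 s : h s <= 1.
  by rewrite -[leRHS]sqrtr1 ler_wsqrtr// gerBl mulr_ge0// sqr_ge0.
(* This is the area of a quarter of the ellipse; it is positive because [h (1/2) > 0]. *)
exists (F 1 - F 0) => [|n n0].
  have [|||h1 _] := HF 0 (1 / 2); try lra.
  have [|||h2 _] := HF (1 / 2) 1; try lra.
  have h12 : 0 < h (1 / 2) by rewrite sqrtr_gt0; lra.
  have := mulr_ge0 (h_ge0 1) (_ : 0 <= 1 - 1 / 2); lra.
pose y := Num.sqrt n%:R : R.
have nR : 1 <= n%:R :> R by rewrite ler1n.
have y1 : 1 <= y by exact: sqrt_ge1.
have y0 : 0 < y by lra.
have yE : y ^+ 2 = n%:R by rewrite sqr_sqrtr.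
pose J := Num.truncn y.
have [J0 Jy yJ] := truncn_bounds y1.
have term j : Num.sqrt (n%:R - 2 * j%:R ^+ 2) = y * h (j%:R / y).
  transitivity (Num.sqrt (y ^+ 2) * h (j%:R / y)); last by rewrite sqrtr_sqr ger0_norm ?ltW.
  by rewrite /h -sqrtrM ?sqr_ge0// -yE; congr Num.sqrt; field; rewrite gt_eqF.
under eq_bigr do rewrite term.
(* A Riemann sum of [h] with step [1 / y]: as [h] decreases, each term lies between two consecutive
   increments of [F], which telescope. *)
have telesc k : (k <= J)%N ->
    F ((k%:R + 1) / y) - F (1 / y) <= (\sum_(1 <= j < k.+1) y * h (j%:R / y)) / n%:R
    /\ (\sum_(1 <= j < k.+1) y * h (j%:R / y)) / n%:R <= F (k%:R / y) - F 0.
  elim: k => [_|k IH kJ].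
    by rewrite big_geq// !mul0r add0r !subrr.
  rewrite big_nat_recr//= [(\sum_(_ <= _ < _) _ + _) / _]mulrDl.
  have -> : y * h (k.+1%:R / y) / n%:R = h (k.+1%:R / y) * y^-1.
    by rewrite -yE; field; rewrite gt_eqF.
  have [i1 i2] := IH (ltnW kJ).
  have ky : k.+1%:R <= y by apply: le_trans Jy; rewrite ler_nat.
  have e1 : (k%:R + 1) / y = k.+1%:R / y by rewrite natr1.
  have e2 : k.+1%:R / y - k%:R / y = y^-1 by rewrite -natr1; field; rewrite gt_eqF.
  have e3 : (k.+1%:R + 1) / y - k.+1%:R / y = y^-1 by field; rewrite gt_eqF.
  have p1 : 0 <= k%:R / y by rewrite divr_ge0// ltW.
  have p2 : 0 < y^-1 by rewrite invr_gt0.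
  have p3 : k.+1%:R / y <= 1 by rewrite ler_pdivrMr// mul1r.
  have p4 : y^-1 <= 1 by rewrite invf_le1.
  have [|||j1 _] := HF (k%:R / y) (k.+1%:R / y); try lra.
  have [|||_ j2] := HF (k.+1%:R / y) ((k.+1%:R + 1) / y); try lra.
  rewrite e2 in j1; rewrite e3 in j2; rewrite e1 in i1.
  split; lra.
have [t1 t2] := telesc J (leqnn J).
have p4 : y^-1 <= 1 by rewrite invf_le1.
have p0 : 0 < y^-1 by rewrite invr_gt0.
have Jy1 : J%:R / y <= 1 by rewrite ler_pdivrMr// mul1r.
have Jy0 : 0 <= J%:R / y by rewrite divr_ge0// ltW.
have Jy2 : 1 <= (J%:R + 1) / y by rewrite ler_pdivlMr// mul1r ltW.
have Jy3 : (J%:R + 1) / y <= 2 by rewrite mulrDl mul1r; lra.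
have [|||a1 _] := HF (J%:R / y) 1; try lra.
have [|||a2 _] := HF 1 ((J%:R + 1) / y); try lra.
have [|||_ a3] := HF 0 (1 / y); try lra.
have b1 : 0 <= F 1 - F (J%:R / y) by apply: le_trans a1; rewrite mulr_ge0// subr_ge0.
have b2 : 0 <= F ((J%:R + 1) / y) - F 1 by apply: le_trans a2; rewrite mulr_ge0// subr_ge0.
have b3 : F (1 / y) - F 0 <= y^-1.
  by apply: le_trans a3 _; rewrite subr0 mul1r ler_piMl// ltW.
set S := \sum_(_ <= _ < _) _ in t1 t2 *.
have n0R : 0 < n%:R :> R by lra.
have -> : S - (F 1 - F 0) * n%:R = (S / n%:R - (F 1 - F 0)) * n%:R.
  by rewrite [RHS]mulrBl divfK// gt_eqF.
rewrite normrM (gtr0_norm n0R) -/y.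
have : `|S / n%:R - (F 1 - F 0)| <= y^-1 by rewrite ler_norml; apply/andP; split; lra.
move/(ler_wpM2r (ltW n0R))/le_trans; apply.
by rewrite -yE expr2 mulKf ?gt_eqF.
Qed.

Lemma ideal_count1 : ideal_count R 1 = 1.
Proof.
rewrite /ideal_count; have -> : size (elems 1) = 2%N; last by field.
have /perm_size -> // : perm_eq (elems 1) [:: 1; - 1].
apply: uniq_perm => //.
move=> a; rewrite mem_elems !inE; apply/eqP/orP => [/nrm1P[->|->]|[/eqP ->|/eqP ->]] //.
- by left.
- by right.
Qed.

Lemma sum_size_elems n : (\sum_(1 <= m < n.+1) size (elems m))%N
  = count (fun a => (nrm a <= n)%N && (a != 0)) (zbox n).
Proof.
transitivity (\sum_(1 <= m < n.+1) \sum_(a <- zbox n) (nrm a == m))%N.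
  apply: eq_big_nat => m /andP[_ mn]; rewrite -big_mkcond /= sum1_count.
  rewrite -size_filter; apply/perm_size/uniq_perm.
  - exact: elems_uniq.
  - by rewrite filter_uniq// zbox_uniq.
  move=> a; rewrite mem_elems mem_filter; apply/esym/andb_idr => /eqP am.
  by apply: mem_zbox_nrm; rewrite am -ltnS.
rewrite exchange_big -sum1_count [RHS]big_mkcond; apply: eq_bigr => a _.
case: ifPn => [/andP[an a0]|].
  rewrite (bigD1_seq (nrm a)) ?iota_uniq ?mem_index_iota ?nrm_gt0 ?a0//=.
  by rewrite eqxx big1// => m /negPf; rewrite eq_sym => ->.
rewrite -nrm_gt0 => hn; rewrite big1_seq// => m; rewrite mem_index_iota => /andP[_ /andP[m0 mn]].
by case: eqP => // am; move: hn; rewrite am m0 andbT -ltnS mn.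
Qed.

(** Elements are counted row by row, with [zim a = j]; a row outside the ellipse gives 0, as
    [Num.sqrt] of a negative number is 0. *)
Lemma count_quadrant_sqrt n :
  count (fun a => ((nrm a <= n)%N && (a != 0)) && in_quadrant a) (zbox n)
  = (\sum_(1 <= j < n.+1) Num.truncn (Num.sqrt (n%:R - 2 * j%:R ^+ 2 : R)))%N.
Proof.
pose t j := iota 1 (Num.truncn (Num.sqrt (n%:R - 2 * j%:R ^+ 2 : R))).
pose s := [seq Zsqrtm2 i%:Z j%:Z | j <- iota 1 n, i <- t j].
have -> : (\sum_(1 <= j < n.+1) Num.truncn (Num.sqrt (n%:R - 2 * j%:R ^+ 2 : R)))%N = size s.
  rewrite /s size_allpairs_dep sumnE big_map /index_iota subn1 /=.
  by apply: eq_bigr => j _; rewrite size_iota.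
rewrite -size_filter; apply/perm_size/uniq_perm.
- by rewrite filter_uniq// zbox_uniq.
- apply: allpairs_uniq_dep; rewrite ?iota_uniq//; first by move=> j _; rewrite iota_uniq.
  by move=> -[j i] [k l] _ _ /= [-> ->].
have key i j : (0 < i)%N -> (i \in t j) = (i ^ 2 + 2 * j ^ 2 <= n)%N.
  move=> i0; rewrite mem_iota i0 /= add1n ltnS le_truncn_sqrt// lerBrDr.
  by rewrite -!natrX -natrM -natrD ler_nat.
move=> [x y]; rewrite mem_filter /in_quadrant /=.
apply/idP/allpairsPdep => [|[j [i [+ + [-> ->]]]]].
  move=> /andP[/andP[/andP[+ _] /andP[x0 y0]] _].
  rewrite -lez_nat nrmE /znorm /= => hn.
  have hj : (0 < `|y|)%N by lia.
  exists `|y|%N, `|x|%N; rewrite key; last by lia.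
  split; first by rewrite mem_iota; nia.
    by move: hn; rewrite !expnS !expn0 !expr2; nia.
  by congr Zsqrtm2; lia.
rewrite mem_iota => /andP[j0 _] it.
have i0 : (0 < i)%N by move: it; rewrite mem_iota => /andP[].
move: it; rewrite key// => hij.
have hn : (nrm (Zsqrtm2 i%:Z j%:Z) <= n)%N.
  by rewrite -lez_nat nrmE /znorm /=; move: hij; rewrite !expnS !expn0 !expr2; nia.
rewrite hn mem_zbox_nrm//= !ltz_nat i0 j0 !andbT.
by apply/eqP => /(congr1 zre) /= e; move: i0; rewrite -ltz_nat e ltxx.
Qed.

Lemma psum_ideal_count : exists2 c : R, 0 < c & exists K0, forall x, 1 <= x ->
  `|psum (ideal_count R) x - c * x| <= K0 * Num.sqrt x.
Proof.
have [c c0 Hc] := sum_sqrt_ellipse.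
(* Four quadrants, halved for the two units. *)
exists (2 * c); first by rewrite mulr_gt0.
exists (8 + 2 * c) => x x1.
have [n0 nx xn] := truncn_bounds x1; rewrite /psum.
move: (Num.truncn x) n0 nx xn => n n0 nx xn.
have -> : \sum_(1 <= m < n.+1) ideal_count R m
    = (\sum_(1 <= m < n.+1) size (elems m))%N%:R / 2.
  by rewrite natr_sum mulr_suml.
rewrite sum_size_elems.
pose S a := (nrm a <= n)%N && (a != 0).
have SN a : S (- a) = S a by rewrite /S nrmN oppr_eq0.
have Sc a : S (zconj a) = S a.
  have E : nrm (zconj a) = nrm a by rewrite /nrm /znorm /= sqrrN.
  by rewrite /S -!nrm_eq0 E.
have Sn a : S a -> (nrm a <= n)%N by case/andP.
have := @count_quadrants R S n SN Sc Sn.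
rewrite {SN Sc Sn}/S count_quadrant_sqrt natr_sum; have hc := Hc _ n0.
pose J := Num.truncn (Num.sqrt n%:R : R).
have n1 : 1 <= n%:R :> R by rewrite ler1n.
have y1 := sqrt_ge1 n1; have [J0 Jy yJ] := truncn_bounds y1.
have yE : Num.sqrt n%:R ^+ 2 = n%:R :> R by rewrite sqr_sqrtr.
have Jn : (J <= n)%N by rewrite -(ler_nat R) (le_trans Jy)// sqrt_le_id.
have hT : `|\sum_(1 <= j < n.+1) (Num.truncn (Num.sqrt (n%:R - 2 * j%:R ^+ 2 : R)))%:R
   - \sum_(1 <= j < J.+1) Num.sqrt (n%:R - 2 * j%:R ^+ 2 : R)| <= Num.sqrt n%:R.
  rewrite (@big_cat_nat _ _ _ J.+1 1 n.+1)//= [X in _ + X - _]big1_seq ?addr0; last first.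
    move=> j; rewrite mem_index_iota => /andP[_ /andP[Jj _]].
    have jy : Num.sqrt n%:R < j%:R :> R.
      by apply: lt_le_trans yJ _; rewrite natr1 ler_nat.
    rewrite ler0_sqrtr ?truncn0// subr_le0 -yE.
    have : Num.sqrt n%:R ^+ 2 <= j%:R ^+ 2 :> R.
      by rewrite ler_pXn2r ?nnegrE ?sqrtr_ge0// ltW.
    have := sqr_ge0 (j%:R : R); lra.
  rewrite -sumrB; apply: le_trans (ler_norm_sum _ _ _) _.
  apply: (@le_trans _ _ (\sum_(1 <= j < J.+1) 1 : R)); last first.
    by rewrite big_const_nat iter_addr_0 subn1.
  apply: ler_sum => j _.
  have /andP[h1 h2] := truncn_itv (sqrtr_ge0 (n%:R - 2 * j%:R ^+ 2 : R)).
  by move: h2; rewrite -natr1 => h2; rewrite ler_norml; apply/andP; split; lra.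
have sx : Num.sqrt n%:R <= Num.sqrt x by rewrite ler_wsqrtr.
move: hc hT; rewrite -/J; move: (\sum_(1 <= _ < J.+1) _) (\sum_(_ <= _ < n.+1) _) => S T.
have x1' := sqrt_ge1 x1.
rewrite !ler_norml => /andP[a1 a2] /andP[b1 b2] /andP[d1 d2].
have e1 : c * n%:R <= c * x by rewrite ler_pM2l.
have e2 : c * x <= c * n%:R + c by have := ler_wpM2l (ltW c0) (ltW xn); lra.
have e3 : c <= c * Num.sqrt x by rewrite ler_peMr// ltW.
by apply/andP; split; lra.
Qed.

End Lattice.

(** * Counting primes *)

Section PrimeElements.
Variable R : realType.
Implicit Types (a b p : zsqrtm2) (n m d k : nat) (x y r : R).

Definition prime_count n : nat := \sum_(1 <= d < n.+1) count is_prime (elems d).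

Lemma prime_countE n :
  prime_count n = count (fun a => is_prime a && (nrm a <= n)%N) (zbox n).
Proof.
transitivity (\sum_(1 <= m < n.+1) \sum_(a <- zbox n) (is_prime a && (nrm a == m)))%N.
  apply: eq_big_nat => m /andP[_ mn]; rewrite -big_mkcond /= sum1_count.
  rewrite -!size_filter; apply/perm_size/uniq_perm.
  - by rewrite filter_uniq// elems_uniq.
  - by rewrite filter_uniq// zbox_uniq.
  move=> a; rewrite mem_filter mem_elems mem_filter; case: (is_prime a) => //=.
  by apply/esym/andb_idr => /eqP am; apply: mem_zbox_nrm; rewrite am -ltnS.
rewrite exchange_big -sum1_count [RHS]big_mkcond; apply: eq_bigr => a _.
case pa: (is_prime a) => /=; last by rewrite big1.
have a0 : (0 < nrm a)%N by rewrite ltnW// prime_nrm_gt1//; exact/asboolP.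
case: ifPn => an.
  rewrite (bigD1_seq (nrm a)) ?iota_uniq ?mem_index_iota ?a0//=.
  by rewrite eqxx big1// => m /negPf; rewrite eq_sym => ->.
rewrite big1_seq// => m; rewrite mem_index_iota => /andP[_ /andP[m0 mn]].
by case: eqP => // am; move: an; rewrite am -ltnS mn.
Qed.

Lemma sum_indicator_le n t : (\sum_(1 <= k < n.+1) (k <= t) <= t)%N.
Proof.
have : (\sum_(1 <= k < n.+1) (k <= t) <= minn n t)%N.
  elim: n => [|n IH]; first by rewrite big_geq.
  rewrite big_nat_recr//=; move: (\sum_(_ <= _ < _) _)%N IH => s IH.
  by case: (leqP n.+1 t) => /= h; lia.
by move/leq_trans; apply; rewrite geq_minr.
Qed.

(** What one prime element of norm [d] contributes to [2 * psum (ideal_mangoldt R) n%:R]: one [ln d]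
    for each of its powers of norm at most [n]. *)
Definition pow_weight n d : R := (\sum_(1 <= k < n.+1) (d ^ k <= n))%N%:R * ln d%:R.

Lemma pow_weight_ge n d : (0 < d <= n)%N -> ln d%:R <= pow_weight n d.
Proof.
move=> /andP[d0 dn]; rewrite /pow_weight ler_peMl ?ln_nat_ge0// ler1n.
have n0 : (1 < n.+1)%N by rewrite ltnS (leq_trans d0).
by rewrite (big_ltn n0) expn1 dn add1n.
Qed.

Lemma pow_weight_le n d : (1 < d <= n)%N -> pow_weight n d <= ln n%:R.
Proof.
move=> /andP[d1 dn]; have d0 : (0 < d)%N by exact: ltnW.
have n0 : (0 < n)%N by exact: leq_trans dn.
apply: (@le_trans _ _ ((trunc_log d n)%:R * ln d%:R)).
  rewrite ler_wpM2r ?ln_nat_ge0// ler_nat.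
  apply: leq_trans (sum_indicator_le n _).
  rewrite leq_sum// => k _; case: (leqP (d ^ k) n) => // h.
  by rewrite (trunc_log_max d1 h).
rewrite mulr_natl -lnXn ?ltr0n// -natrX ln_mono ?ltr0n ?expn_gt0 ?d0//.
by rewrite ler_nat trunc_logP.
Qed.

Lemma psum_ideal_mangoldt n : 2 * psum (ideal_mangoldt R) n%:R
  = \sum_(1 <= d < n.+1) (count is_prime (elems d))%:R * pow_weight n d.
Proof.
rewrite psum_nat; under eq_big_nat => m mn.
  rewrite ltnS in mn; rewrite (ideal_mangoldt_widen R mn); over.
rewrite -mulr_suml mulrC divfK// exchange_big; apply: eq_big_nat => d /andP[d0 _].
rewrite exchange_big -sum1_count natr_sum mulr_suml; apply: eq_bigr => p _.
rewrite mul1r /pow_weight natr_sum mulr_suml.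
under eq_bigr do rewrite big_mkcond.
rewrite exchange_big; apply: eq_big_nat => k _.
have dk0 : (0 < d ^ k)%N by rewrite expn_gt0 d0.
case: leqP => dkn; last first.
  rewrite mul0r big1_seq// => m; rewrite mem_index_iota => /andP[_ /andP[_ mn]].
  by case: eqP => // e; move: mn; rewrite -e ltnS leqNgt dkn.
rewrite (bigD1_seq (d ^ k)%N) ?iota_uniq ?mem_index_iota ?dk0//= eqxx mul1r.
by rewrite big1 ?addr0// => m /negPf; rewrite eq_sym => ->.
Qed.

Lemma elems_prime_gt1 d : (0 < d)%N -> count is_prime (elems d) = 0%N \/ (1 < d)%N.
Proof.
move=> d0; have [|] := posnP (count is_prime (elems d)); first by left.
rewrite -has_count => /hasP[p]; rewrite mem_elems => /eqP <- /asboolP pp.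
by right; exact: prime_nrm_gt1.
Qed.

Lemma psum_le_prime_count n :
  2 * psum (ideal_mangoldt R) n%:R <= (prime_count n)%:R * ln n%:R.
Proof.
rewrite psum_ideal_mangoldt natr_sum mulr_suml; apply: ler_sum_nat => d /andP[d0 dn].
have [->|d1] := elems_prime_gt1 d0; first by rewrite !mul0r.
by rewrite ler_wpM2l// pow_weight_le// d1.
Qed.

(** Primes of norm at most [y] are bounded by all elements of such norm; each of the others has
    weight at least [ln y] in [psum_ideal_mangoldt]. *)
Lemma prime_count_le n y : 1 < y ->
  (prime_count n)%:R <= 2 * psum (ideal_count R) y + 2 * psum (ideal_mangoldt R) n%:R / ln y.
Proof.
move=> y1; have ly : 0 < ln y by rewrite ln_gt0.
pose m := Num.truncn y.
have term d : (0 < d)%N -> (d <= n)%N -> (count is_prime (elems d))%:R <=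
    (if (d <= m)%N then (size (elems d))%:R else 0)
    + (count is_prime (elems d))%:R * pow_weight n d / ln y :> R.
  move=> d0 dn; case: leqP => dm.
    rewrite ler_wpDr ?ler_nat ?count_size// divr_ge0 ?(ltW ly)// mulr_ge0//.
    by rewrite (le_trans (ln_nat_ge0 R d))// pow_weight_ge// d0.
  rewrite add0r -mulrA ler_peMr// ler_pdivlMr// mul1r.
  apply: (@le_trans _ _ (ln d%:R)); last by rewrite pow_weight_ge// d0.
  rewrite ln_mono//; first by lra.
  by rewrite ltW// (lt_le_trans (truncnS_gt _))// ler_nat.
have -> : 2 * psum (ideal_count R) y = \sum_(1 <= d < m.+1) (size (elems d))%:R.
  by rewrite /psum mulr_sumr; apply: eq_bigr => d _; rewrite /ideal_count mulrC divfK.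
rewrite psum_ideal_mangoldt natr_sum.
apply: (@le_trans _ _ (\sum_(1 <= d < n.+1) ((if (d <= m)%N then (size (elems d))%:R else 0)
    + (count is_prime (elems d))%:R * pow_weight n d / ln y))).
  by apply: ler_sum_nat => d /andP[d0 dn]; exact: term.
rewrite big_split /= -mulr_suml lerD2r.
have pos i j : 0 <= \sum_(i <= d < j) (size (elems d))%:R :> R by exact: sumr_ge0.
have [nm|mn] := leqP n m.
  rewrite [leRHS](@big_cat_nat _ _ _ n.+1)//= ler_wpDr//; apply: ler_sum_nat => d.
  by move=> /andP[_ dn]; case: ifP.
rewrite [leLHS](@big_cat_nat _ _ _ m.+1)//=; last by rewrite ltnS ltnW.
rewrite [X in _ + X]big1_seq ?addr0.
  by apply: ler_sum_nat => d /andP[_ dm]; case: ifP.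
by move=> d; rewrite mem_index_iota => /andP[_ /andP[md _]]; rewrite leqNgt md.
Qed.

Lemma quadrant_prime_countE r : let n := Num.truncn (r ^+ 2) in
  quadrant_prime_count r
  = count (fun a => (is_prime a && (nrm a <= n)%N) && ((0 < zre a) && (0 <= zim a))) (zbox n).
Proof.
move=> n; rewrite /quadrant_prime_count -size_filter.
apply/perm_size/uniq_perm; first exact: finmap.fset_uniq.
  by rewrite filter_uniq// zbox_uniq.
have key a : ((znorm a)%:~R <= r ^+ 2 :> R) = (nrm a <= n)%N.
  by rewrite -nrmE truncn_ge_nat ?sqr_ge0.
move=> a; rewrite in_fset_set; last exact: finite_quadrant_primes.
rewrite mem_filter; apply/idP/andP.
  rewrite inE => -[pa x0 y0]; rewrite key => an; split; last exact: mem_zbox_nrm.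
  by rewrite x0 y0 an !andbT; apply/asboolP.
move=> [/andP[/andP[/asboolP pa an] /andP[x0 y0]] _].
by rewrite inE; split=> //; rewrite key.
Qed.

(** Negation and conjugation preserve primes, and the region counted is the open quadrant with a
    half-axis. At most [4 sqrt n + 2 <= 6 r] primes lie on the axes, and [30 r] is four times this
    for the half-axis, plus once for [count_quadrants]. *)
Lemma quadrant_prime_count_bound r : 1 <= r ->
  `|4 * (quadrant_prime_count r)%:R - (prime_count (Num.truncn (r ^+ 2)))%:R| <= 30 * r.
Proof.
move=> r1; rewrite quadrant_prime_countE prime_countE; set n := Num.truncn _.
pose S a := is_prime a && (nrm a <= n)%N.
have primeN a : is_prime (- a) = is_prime a.
  by apply/asboolP/asboolP => /prime_eltN; rewrite ?opprK.
have nrmC a : nrm (zconj a) = nrm a by rewrite /nrm /znorm /= sqrrN.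
have zconjM a b : zconj (a * b) = zconj a * zconj b.
  by case: a b => [x y] [z t]; congr Zsqrtm2; rewrite /=; ring.
have primeC1 a : prime_elt a -> prime_elt (zconj a).
  move=> pa; have [a0 au ap] := pa; split.
  - by apply/eqP; rewrite -nrm_gt0 nrmC nrm_gt0; exact/eqP.
  - by rewrite unit_nrm nrmC -unit_nrm.
  have dC u v : divides (zconj u) v -> divides u (zconj v).
    by case=> c ->; exists (zconj c); rewrite zconjM zconjK.
  have dC' u v : divides u (zconj v) -> divides (zconj u) v.
    by case=> c hc; exists (zconj c); rewrite -zconjM -hc zconjK.
  by move=> b c /dC; rewrite zconjM => /ap[] h; [left|right]; exact: dC'.
have SN a : S (- a) = S a by rewrite /S primeN nrmN.
have Sc a : S (zconj a) = S a.
  rewrite /S nrmC; congr (_ && _).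
  by apply/asboolP/asboolP => /primeC1//; rewrite zconjK.
have Sn a : S a -> (nrm a <= n)%N by case/andP.
have := @count_quadrants R S n SN Sc Sn; have := @count_axes R S n Sn.
have q1 : (count (fun a => S a && in_quadrant a) (zbox n)
    <= count (fun a => S a && ((0 < zre a) && (0 <= zim a))%R) (zbox n))%N.
  by apply: sub_count => a /andP[-> /andP[x0 y0]]; rewrite /= x0 ltW.
have q2 : (count (fun a => S a && ((0 < zre a) && (0 <= zim a))%R) (zbox n)
    <= count (fun a => S a && in_quadrant a) (zbox n)
     + count (fun a => S a && ~~ ((zre a != 0%R) && (zim a != 0%R))) (zbox n))%N.
  rewrite -count_predUI; apply: leq_trans (leq_addr _ _); apply: sub_count => a /=.
  case/andP=> -> /andP[x0 y0]; rewrite /in_quadrant x0 /= (gt_eqF x0) /=.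
  by rewrite lt_def y0 andbT; case: (_ == _).
move: q1 q2; rewrite -!(ler_nat R) natrD.
have r0 : 0 <= r by lra.
have nr : Num.sqrt n%:R <= r.
  rewrite -[leRHS](ger0_norm r0) -sqrtr_sqr ler_wsqrtr//.
  by rewrite truncn_le sqr_ge0.
rewrite -/S; move: (count _ _) (count _ _) (count _ _) (count _ _) => A B C D.
rewrite !ler_norml => h1 h2 h3 /andP[h4 h5]; apply/andP; split; lra.
Qed.

Lemma ideal_mangoldt_ge0 n : 0 <= ideal_mangoldt R n.
Proof.
rewrite divr_ge0//; apply: sumr_ge0 => d _; apply: sumr_ge0 => p _.
by apply: sumr_ge0 => k _; exact: ln_nat_ge0.
Qed.

Lemma prime_ideal_theorem e : 0 < e ->
  exists X, forall x, X <= x -> `|psum (ideal_mangoldt R) x - x| <= e * x.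
Proof.
have [c c0 [K0 HK]] := psum_ideal_count R.
apply: (@beurling_pnt R (ideal_count R) (ideal_mangoldt R) c K0) => //.
- exact: ideal_count1.
- by move=> n; rewrite divr_ge0.
- exact: ideal_mangoldt_ge0.
- by move=> n n0; exact: ideal_mangoldt_conv.
Qed.

Lemma expR_ge_sqr x : 0 <= x -> (x / 2) ^+ 2 <= expR x.
Proof.
move=> x0; have -> : expR x = expR (x / 2) ^+ 2.
  by rewrite -expRM_natl; congr expR; field.
rewrite ler_pXn2r ?nnegrE ?expR_ge0 ?divr_ge0//.
by have := expR_ge1Dx (x / 2); lra.
Qed.

(** For [x = r^2], the cut [y = x ^ (1 - e)] in [prime_count_le] keeps [ln y] close to [ln x] while
    [y ln x] is negligible against [x]. Of the error [6 e], one [e] comes from the axes, one from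
    norms up to [y], and [4 e] from [psi / (1 - e)]. *)
Lemma quadrant_prime_count_asymptotic e : 0 < e -> e <= 1 / 2 ->
  exists X, forall r, X <= r ->
  `|(quadrant_prime_count r)%:R / (r ^+ 2 / (4 * ln r)) - 1| <= 6 * e.
Proof.
move=> e0 e12; have [c c0 [K0 HK]] := psum_ideal_count R.
have [X HX] := prime_ideal_theorem e0.
have K00 : 0 <= K0.
  by have := HK 1 (lexx _); rewrite sqrtr1 !mulr1; move/(le_trans (normr_ge0 _)).
pose C := 2 * (c + K0).
have C0 : 0 <= C by rewrite mulr_ge0// addr_ge0// ltW.
(* [120 / e] serves the error [30 r] and [C / e ^ 3] the error [C y], both through [expR_ge_sqr]. *)
pose l0 := Num.max 1 (Num.max (120 / e) (C / e ^+ 3)).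
exists (Num.max (expR l0) X) => r; rewrite ge_max => /andP[lr Xr].
have r0 : 0 < r by apply: lt_le_trans lr; exact: expR_gt0.
pose l := ln r.
have ll : l0 <= l by rewrite -(expRK l0) ln_mono// expR_gt0.
have [l1 le3 lC] : [/\ 1 <= l, 120 <= e * l & C <= e ^+ 3 * l].
  move: ll; rewrite !ge_max => /andP[-> /andP[]].
  by rewrite !ler_pdivrMr ?exprn_gt0// => h1 h2; rewrite ![_ * l]mulrC.
have rE : expR l = r by rewrite lnK// posrE.
have r1 : 1 <= r by rewrite -rE; have := expR_ge1Dx l; lra.
pose x := r ^+ 2.
have x1 : 1 <= x by rewrite exprn_ege1.
have x0 : 0 < x by lra.
have rx : r <= x by rewrite /x expr2 ler_peMr// ltW.
have lx : ln x = 2 * l by rewrite /x lnXn// mulr_natl.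
have hpsi := HX x (le_trans Xr rx).
have psiE : psum (ideal_mangoldt R) x = psum (ideal_mangoldt R) (Num.truncn x)%:R.
  by rewrite psum_nat.
have := quadrant_prime_count_bound r1; rewrite -/x.
have lower : 2 * psum (ideal_mangoldt R) x <= (prime_count (Num.truncn x))%:R * (2 * l).
  rewrite psiE (le_trans (psum_le_prime_count _))// ler_wpM2l// -lx ln_mono//.
    by rewrite ltr0n truncn_gt0.
  by rewrite truncn_le ltW.
pose y := expR ((1 - e) * (2 * l)).
have y1 : 1 < y by rewrite expR_gt1 mulr_gt0//; lra.
have := @prime_count_le (Num.truncn x) y y1; rewrite -psiE expRK.
have hA := psum_a_le HK (ltW y1).
have xy : x = y * expR (e * (2 * l)).
  rewrite /y -expRD -mulrDl subrK mul1r /x -rE -expRM_natl; congr expR; ring.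
have hexp : (e * l) ^+ 2 <= expR (e * (2 * l)).
  have := @expR_ge_sqr (e * (2 * l)); rewrite (_ : e * (2 * l) / 2 = e * l); last by field.
  by apply; rewrite mulr_ge0 ?(ltW e0)// mulr_ge0//; lra.
have hr : (l / 2) ^+ 2 <= r by rewrite -rE expR_ge_sqr//; lra.
move: hpsi lower hA; move: (psum _ x) (psum _ y) (prime_count _) => psi A pi.
move=> hpsi lower hA upper hQ.
move: (quadrant_prime_count r) hQ => Q hQ.
(* the error terms 30 r and C y, compared with x / ln r *)
have f1 : 30 * r * l <= e * x.
  have : 120 * l <= e * (l * l) by rewrite mulrA ler_wpM2r//; lra.
  have := ler_wpM2l (ltW e0) hr.
  rewrite expr2 => g1 g2; have g3 : 30 * l <= e * r by lra.
  by rewrite mulrAC /x expr2 mulrA ler_wpM2r// ltW.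
have y0 : 0 < y by lra.
have f2 : C * y * l <= e * x.
  have : C * l <= e * (e * l) ^+ 2.
    have := ler_wpM2r (_ : 0 <= l) lC; rewrite (_ : e ^+ 3 * l * l = e * (e * l) ^+ 2).
      by apply; lra.
    ring.
  move/le_trans => /(_ _ (ler_wpM2l (ltW e0) hexp)) g.
  by rewrite xy mulrAC mulrCA [y * _]mulrC ler_wpM2r// ltW.
have l_gt0 : 0 < l by lra.
have -> : Q%:R / (r ^+ 2 / (4 * ln r)) - 1 = (4 * Q%:R * l - x) / x.
  by rewrite -/x -/l; field; rewrite !gt_eqF.
rewrite normrM [X in _ * X]ger0_norm ?invr_ge0 ?(ltW x0)// ler_pdivrMr//.
move: hpsi hQ; rewrite !ler_norml => /andP[p1 p2] /andP[q1 q2].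
have q1' := ler_wpM2r (ltW l_gt0) q1; have q2' := ler_wpM2r (ltW l_gt0) q2.
have e1 : 0 < 1 - e by lra.
have upper' : pi%:R * l <= e * x + psi / (1 - e).
  have := ler_wpM2r (ltW l_gt0) upper; rewrite mulrDl.
  have -> : 2 * psi / ((1 - e) * (2 * l)) * l = psi / (1 - e).
    by field; rewrite !gt_eqF.
  move=> g; apply: le_trans g _; rewrite lerD2r; apply: le_trans f2.
  by rewrite ler_wpM2r ?(ltW l_gt0)// /C -mulrA ler_wpM2l.
(* [(1 + e) / (1 - e) <= 1 + 4 e] holds for [e <= 1 / 2]. *)
have psi_le : psi / (1 - e) <= x + 4 * e * x.
  rewrite ler_pdivrMr//; have : 0 <= e * x * (1 - 2 * e) by rewrite (mulr_ge0 (ltW (mulr_gt0 e0 x0)))//; lra.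
  lra.
apply/andP; split; lra.
Qed.

End PrimeElements.

Local Open Scope classical_set_scope.

Theorem theorem4p3 (R : realType) :
  (quadrant_prime_count r)%:R / (r ^+ 2 / (4 * ln r)) @[r --> +oo] --> (1 : R).
Proof.
apply/cvgrPdist_le => /= e e0; pose d := Num.min (e / 6) (1 / 2).
have d0 : 0 < d by rewrite lt_min divr_gt0//=; lra.
have d2 : d <= 1 / 2 by rewrite ge_min lexx orbT.
have de : 6 * d <= e.
  have : d <= e / 6 by rewrite ge_min lexx.
  lra.
have [X HX] := quadrant_prime_count_asymptotic d0 d2.
near=> r; rewrite distrC; apply: le_trans de; apply: HX.
by near: r; apply: nbhs_pinfty_ge; exact: num_real.
Unshelve. all: by end_near. Qed.
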